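(* Fix a real number $t>1$. Let $\Gamma$ be a projective plane with a function $\mathsf{d}$ on unordered pairs of points with values in $[0,1]$ and a function $\angle$ on unordered pairs of lines with values in $[0,\pi/2]$ (pairs of equal elements allowed). Then there exists a valuation $u$ on $\Gamma$ making $(\Gamma,u)$ a projective plane with valuation such that $\mathsf{d}(p,q)=t^{-u(p,q)}$ for all points $p,q$ and $\angle(L,M)=\arcsin(t^{-u(L,M)})$ for all lines $L,M$ (with $t^{-\infty}=0$) if and only if the following conditions are fulfilled: (M1) $\mathsf{d}$ is an ultrametric, i.e. a metric satisfying $\mathsf{d}(p,q)\le\max(\mathsf{d}(p,r),\mathsf{d}(r,q))$ for all points $p,q,r$; (M2) two lines have angle zero if and only if they are equal; (M3) on each line there are two points at the maximal distance $1$ from each other; (M4) through each point there are two lines with a right angle ($\pi/2$); (M5) the sine rule holds: for every triangle with lengths of the sides $A,B,C$ and respective opposite angles $\alpha,\beta,\gamma$, one has $\frac{A}{\sin\alpha}=\frac{B}{\sin\beta}=\frac{C}{\sin\gamma}$. Hence, if these conditions hold, $\Gamma$ is isomorphic to the building at infinity of some two-dimensional $\mathbb{R}$-building.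
   Context: A projective plane here is a generalized $3$-gon: a point-line geometry $\Gamma=(P,B,\mathrm{I})$ in which any two distinct points are on a unique common line, any two distinct lines meet in a unique common point, every element is incident with at least three others, and any point $p$ and line $L$ are joined by an incidence path of length at most $3$, unique if of length less than $3$. A triangle consists of three non-collinear points (corners) and the three lines (sides) joining them; the length of a side is the $\mathsf{d}$-distance of the two corners on it, and the angle at a corner is the $\angle$-value of the two sides through it. A projective plane with valuation (generalized $3$-gon with (non-discrete) valuation) with weight sequence $(a_1,a_2,a_4,a_5)$, all $a_i$ positive reals (it may be taken to be $(1,1,1,1)$), is a pair $(\Gamma,u)$ where $u$ is a function on pairs of points and on pairs of lines with values in $[0,\infty]$ such that: (U1) for each element $z$ there are $x,y$ incident with $z$ with $u(x,y)=0$; (U2) $u(x,y)=\infty$ if and only if $x=y$; (U3) if $x,y,z$ are points on a common line or lines through a common point, then $u(x,y)<u(y,z)$ implies $u(x,z)=u(x,y)$; (U4) whenever $x_1\,\mathrm{I}\,x_2\,\mathrm{I}\cdots\mathrm{I}\,x_6\,\mathrm{I}\,x_1$ (indices modulo $6$), one has $\sum_{i=1}^{2}a_iu(x_{i-1},x_{i+1})=\sum_{i=4}^{5}a_iu(x_{i-1},x_{i+1})$. $\mathbb{R}$-buildings (dimension two). Let $\overline W$ be an irreducible dihedral reflection group of order $2m$, $m\ge 3$, acting naturally on the Euclidean plane $V=\mathbb{R}^2$; let $\mathbf{A}$ be the associated affine plane and $W$ the group generated by all translations of $\mathbf{A}$ and $\overline W$. Let $\mathcal{H}_0$ be the set of axes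 of reflections in $\overline W$. A vector sector is the closure of a connected component of $V\setminus\bigcup\mathcal{H}_0$; its translates are sectors. The two bounding half-lines of a sector are its sector-panels. An $\mathbb{R}$-building $(\Lambda,\mathcal{F})$ is a set $\Lambda$ with a collection $\mathcal{F}$ of injections (charts) $\mathbf{A}\to\Lambda$; images under charts of $\mathbf{A}$, sectors, sector-panels are called apartments, sectors, sector-panels of $\Lambda$; the axioms are: (A1) if $w\in W$, $f\in\mathcal{F}$, then $f\circ w\in\mathcal{F}$; (A2) if $f,f'\in\mathcal{F}$, then $X=f^{-1}(f'(\mathbf{A}))$ is closed and convex in $\mathbf{A}$ and $f|_X=f'\circ w|_X$ for some $w\in W$; (A3) any two points of $\Lambda$ lie in a common apartment; (A4) any two sectors contain subsectors lying in a common apartment; (A5$'$) for $f\in\mathcal{F}$ and $\alpha\in f(\mathbf{A})$ there is a retraction $\rho:\Lambda\to f(\mathbf{A})$ such that the preimage of $\alpha$ is $\{\alpha\}$ and which does not increase the distance on $\Lambda$, where the distance of two points is their Euclidean distance measured in any chart whose apartment contains both. Two sector-panels are parallel if they are at bounded Hausdorff distance. The building at infinity is the geometry whose elements are the parallel classes of sector-panels, divided into points and lines according to the two types ($W$-orbits of directions of sector-panels), two classes being incident when they are represented by the two sector-panels of a common sector. *)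

(* Defs.v *)
From HB Require Import structures.
From mathcomp Require Import all_boot all_order all_algebra.
From mathcomp Require Import all_classical all_reals all_analysis.

Set Implicit Arguments.
Unset Strict Implicit.
Unset Printing Implicit Defensive.

Import Order.TTheory GRing.Theory Num.Theory.
Import numFieldNormedType.Exports.

Local Open Scope classical_set_scope.
Local Open Scope ring_scope.

(** * Point-line geometries and projective planes *)

Record geometry : Type := Geometry {
  points : Type;
  lines : Type;
  inc : points -> lines -> Prop }.

Record projective_plane (G : geometry) : Prop := ProjectivePlane {
  pp_join : forall p q : points G, p <> q -> exists! L, inc p L /\ inc q L;
  pp_meet : forall L M : lines G, L <> M -> exists! p, inc p L /\ inc p M;
  pp_thick_line : forall L : lines G, exists p q r,
    [/\ inc p L, inc q L & inc r L] /\ [/\ p <> q, q <> r & p <> r];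
  pp_thick_point : forall p : points G, exists L M N,
    [/\ inc p L, inc p M & inc p N] /\ [/\ L <> M, M <> N & L <> N];
  (* An incidence path from a point to a line has odd length, and one of
     length 1 is determined by its ends, so uniqueness below length 3 says
     nothing more. *)
  pp_path : forall (p : points G) (L : lines G),
    inc p L \/ exists M q, [/\ inc p M, inc q M & inc q L] }.

Definition geometry_iso (G H : geometry) : Prop :=
  exists (phi : points G -> points H) (psi : lines G -> lines H),
    [/\ bijective phi, bijective psi &
        forall p L, inc p L <-> inc (phi p) (psi L)].

(** * Valuations *)

Section Valuation.
Variables (R : realType) (G : geometry).

(* A function on pairs of points and on pairs of lines is given by its two
   components [uP] and [uL]. *)
Record valuation_with_weights (a1 a2 a4 a5 : R)
    (uP : points G -> points G -> \bar R) (uL : lines G -> lines G -> \bar R)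
    : Prop := ValuationWithWeights {
  valP_sym : forall p q, uP p q = uP q p;
  valL_sym : forall L M, uL L M = uL M L;
  valP_ge0 : forall p q, (0 <= uP p q)%E;
  valL_ge0 : forall L M, (0 <= uL L M)%E;
  val_U1_line : forall L, exists p q, [/\ inc p L, inc q L & uP p q = 0%E];
  val_U1_point : forall p, exists L M, [/\ inc p L, inc p M & uL L M = 0%E];
  valP_U2 : forall p q, uP p q = +oo%E <-> p = q;
  valL_U2 : forall L M, uL L M = +oo%E <-> L = M;
  valP_U3 : forall L p q r, inc p L -> inc q L -> inc r L ->
    (uP p q < uP q r)%E -> uP p r = uP p q;
  valL_U3 : forall p L M N, inc p L -> inc p M -> inc p N ->
    (uL L M < uL M N)%E -> uL L N = uL L M;
  (* (U4) for closed paths [x1, ..., x6] with [x1] a point, then with [x1]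
     a line; degenerate paths are allowed. *)
  valP_U4 : forall (x1 x3 x5 : points G) (x2 x4 x6 : lines G),
    inc x1 x2 -> inc x3 x2 -> inc x3 x4 -> inc x5 x4 -> inc x5 x6 ->
    inc x1 x6 ->
    (a1%:E * uL x6 x2 + a2%:E * uP x1 x3 =
     a4%:E * uP x3 x5 + a5%:E * uL x4 x6)%E;
  valL_U4 : forall (x1 x3 x5 : lines G) (x2 x4 x6 : points G),
    inc x2 x1 -> inc x2 x3 -> inc x4 x3 -> inc x4 x5 -> inc x6 x5 ->
    inc x6 x1 ->
    (a1%:E * uP x6 x2 + a2%:E * uL x1 x3 =
     a4%:E * uL x3 x5 + a5%:E * uP x4 x6)%E }.

Definition valuation (uP : points G -> points G -> \bar R)
    (uL : lines G -> lines G -> \bar R) : Prop :=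
  exists a1 a2 a4 a5 : R,
    [/\ 0 < a1, 0 < a2, 0 < a4 & 0 < a5] /\
    valuation_with_weights a1 a2 a4 a5 uP uL.

End Valuation.

(* [t ^ (- u)], with [t ^ (- oo) = 0]; only used for [u >= 0]. *)
Definition expN (R : realType) (t : R) (u : \bar R) : R :=
  if u is r%:E then t `^ (- r) else 0.

(** * Distance and angle on a projective plane *)

Section Metric.
Variables (R : realType) (G : geometry).

Definition distance_function (d : points G -> points G -> R) : Prop :=
  forall p q, d p q = d q p /\ 0 <= d p q <= 1.

Definition angle_function (ang : lines G -> lines G -> R) : Prop :=
  forall L M, ang L M = ang M L /\ 0 <= ang L M <= pi / 2.

Record ultrametric (T : Type) (d : T -> T -> R) : Prop := Ultrametric {
  um_ge0 : forall p q, 0 <= d p q;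
  um_sym : forall p q, d p q = d q p;
  um_eq0 : forall p q, d p q = 0 <-> p = q;
  um_triangle : forall p q r, d p q <= d p r + d r q;
  um_max : forall p q r, d p q <= Num.max (d p r) (d r q) }.

(* Corners [p], [q], [r] and the sides [a], [b], [c] opposite to them. *)
Definition triangle (p q r : points G) (a b c : lines G) : Prop :=
  [/\ ~ (exists L, [/\ inc p L, inc q L & inc r L]),
      inc q a /\ inc r a, inc r b /\ inc p b & inc p c /\ inc q c].

Definition sine_rule (d : points G -> points G -> R)
    (ang : lines G -> lines G -> R) : Prop :=
  forall p q r a b c, triangle p q r a b c ->
    d q r / sin (ang b c) = d r p / sin (ang c a) /\
    d r p / sin (ang c a) = d p q / sin (ang a b).

Record metric_plane (d : points G -> points G -> R)
    (ang : lines G -> lines G -> R) : Prop := MetricPlane {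
  M1 : ultrametric d;
  M2 : forall L M, ang L M = 0 <-> L = M;
  M3 : forall L, exists p q, [/\ inc p L, inc q L & d p q = 1];
  M4 : forall p, exists L M, [/\ inc p L, inc p M & ang L M = pi / 2];
  M5 : sine_rule d ang }.

End Metric.

(** * The model apartment *)

Section Apartment.
Variables (R : realType) (m : nat).

Notation plane := 'cV[R]_2.

Definition edist (x y : plane) : R :=
  Num.sqrt (\sum_(i < 2) (x i 0 - y i 0) ^+ 2).

Definition unit_vector (th : R) : plane :=
  \col_(i < 2) (if i == 0 then cos th else sin th).

Definition rotation (th : R) : 'M[R]_2 :=
  \matrix_(i < 2, j < 2)
    (if i == j then cos th else if i == 0 then - sin th else sin th).

(* The reflection whose axis is spanned by [unit_vector th]. *)
Definition reflection (th : R) : 'M[R]_2 :=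
  \matrix_(i < 2, j < 2)
    (if i == j then (if i == 0 then cos (2 * th) else - cos (2 * th))
     else sin (2 * th)).

(* The group of order [2 m] generated by the reflections in the lines at
   angles [k * pi / m]; coordinates are chosen so that the first axis is one
   of these lines. *)
Definition Wbar : set 'M[R]_2 :=
  [set g | exists k : nat,
    g = rotation (2 * k%:R * pi / m%:R) \/ g = reflection (k%:R * pi / m%:R)].

Definition W : set (plane -> plane) :=
  [set w | exists g v, Wbar g /\ w = (fun x => g *m x + v)].

Definition axes : set (set plane) :=
  [set H | exists g, [/\ Wbar g, g *m g^T = 1%:M, \det g = -1 &
                         H = [set x | g *m x = x]]].

Definition vector_sector (S : set plane) : Prop :=
  let U := ~` (\bigcup_(H in axes) H) in
  exists2 x, U x & S = closure (connected_component U x).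

Definition translate (v : plane) (A : set plane) : set plane :=
  [set v + x | x in A].

Definition half_line (e : plane) : set plane :=
  [set s *: e | s in [set s : R | 0 <= s]].

(* [half_line e] is one of the two half-lines bounding the vector sector
   [S]. *)
Definition bounding (e : plane) (S : set plane) : Prop :=
  e <> 0 /\ half_line e `<=` closure S `\` interior S.

(* The two [Wbar]-orbits of directions of sector-panels: for [b = false]
   that of the direction at angle [0], for [b = true] that of the direction
   at angle [pi / m]. *)
Definition direction_type (b : bool) (e : plane) : Prop :=
  exists g s, [/\ Wbar g, 0 < s &
    e = s *: (g *m unit_vector (if b then pi / m%:R else 0))].

End Apartment.

(** * Two-dimensional R-buildings and their building at infinity *)

Section Building.
Variables (R : realType) (m : nat) (X : Type) (F : set ('cV[R]_2 -> X)).

(* The distance measured in some chart whose apartment contains both points;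
   by (A2) the chart does not matter, and by (A3) there is one. *)
Definition bdist (x y : X) : R :=
  xget 0 [set r | exists f a b, [/\ F f, f a = x, f b = y & r = edist a b]].

Definition is_sector (S : set X) : Prop :=
  exists f S0 v, [/\ F f, vector_sector m S0 & S = f @` translate v S0].

(* [Q1] and [Q2], of types [b1] and [b2], are bounding half-lines of a
   common sector. *)
Definition panels_of_sector (b1 b2 : bool) (Q1 Q2 : set X) : Prop :=
  exists f S0 v e1 e2,
    [/\ F f, vector_sector m S0,
        bounding e1 S0 /\ direction_type m b1 e1,
        bounding e2 S0 /\ direction_type m b2 e2 &
        Q1 = f @` translate v (half_line e1) /\
        Q2 = f @` translate v (half_line e2)].

Definition is_panel (Q : set X) : Prop :=
  exists f S0 v e, [/\ F f, vector_sector m S0, bounding e S0 &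
    Q = f @` translate v (half_line e)].

Definition is_panel_of_type (b : bool) (Q : set X) : Prop :=
  exists f S0 v e,
    [/\ F f, vector_sector m S0, bounding e S0, direction_type m b e &
        Q = f @` translate v (half_line e)].

Record R_building : Prop := RBuilding {
  rb_m : (3 <= m)%N;
  rb_inj : forall f, F f -> injective f;
  rb_A1 : forall w f, W m w -> F f -> F (f \o w);
  rb_A2 : forall f f', F f -> F f' ->
    let Y := f @^-1` range f' in
    [/\ closed Y, convex_set Y &
        exists2 w, W m w & forall y, Y y -> f y = f' (w y)];
  rb_A3 : forall x y, exists2 f, F f & range f x /\ range f y;
  rb_A4 : forall S S', is_sector S -> is_sector S' ->
    exists T T' f, [/\ is_sector T, is_sector T', T `<=` S, T' `<=` S' &
      F f /\ T `|` T' `<=` range f];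
  rb_A5' : forall f x, F f -> range f x ->
    exists rho : X -> X,
      [/\ range rho `<=` range f,
          forall y, range f y -> rho y = y,
          rho @^-1` [set x] = [set x] &
          forall y z, bdist (rho y) (rho z) <= bdist y z] }.

Definition parallel (Q Q' : set X) : Prop :=
  exists C : R,
    (forall x, Q x -> exists2 y, Q' y & bdist x y <= C) /\
    (forall y, Q' y -> exists2 x, Q x & bdist x y <= C).

Definition parallel_class (b : bool) (c : set (set X)) : Prop :=
  exists2 Q, is_panel_of_type b Q &
    c = [set Q' | is_panel Q' /\ parallel Q Q'].

Definition building_at_infinity : geometry := {|
  points := {c | parallel_class false c};
  lines := {c | parallel_class true c};
  inc := fun c c' => exists Q Q',
    [/\ sval c Q, sval c' Q' & panels_of_sector false true Q Q'] |}.

End Building.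

(* Main.v *)
Require Import Defs.
From HB Require Import structures.
From mathcomp Require Import all_boot all_order all_algebra.
From mathcomp Require Import all_classical all_reals all_analysis.
From mathcomp Require Import ring lra.

Set Implicit Arguments.
Unset Strict Implicit.
Unset Printing Implicit Defensive.

Import Order.TTheory GRing.Theory Num.Theory.
Import numFieldNormedType.Exports.

Local Open Scope classical_set_scope.
Local Open Scope ring_scope.

(** A valuation is a distance and an angle in logarithmic coordinates, so that
    the equivalence compares (U4) with the sine rule. In both directions the
    decisive quantity is the height [d p q * sin (ang pq K)] of a point [p] over
    a line [K], which by the sine rule does not depend on the point [q] of [K].
    Arbitrary weights in (U4) do not matter: comparing the identities for a
    triangle, for its reverse and for their duals shows that the differences of
    two sides and of the opposite angles agree. Heights express the angle
    between two lines through [p] by distances ([sine_section]), so that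
    Ptolemy's inequality for four points of an ultrametric space makes the sine
    of the angle an ultrametric ([sine_max]), and conversely (U3) for angles
    extends the ultrametric inequality from collinear points to all points
    ([dist_ultrametric]), once every line is known to contain a point at
    distance 1 from a given one ([far_point]).

    The building is constructed as for a vector space of dimension 3 over a
    field with a valuation, where its points are the norms with an orthogonal
    basis, up to a factor. There is no vector space here, but heights provide
    the absolute values of the coordinates of a point with respect to a triangle
    ([fcoord]), and norms become functions on points for which, among the three
    products [f p * d q r] for collinear [p], [q], [r], the largest occurs
    twice. A norm is split by a triangle (a [frame]) if it is the largest of the
    terms of its expansion; the norms split by a given triangle form an
    apartment, whose coordinates are the logarithms of the values at the
    corners. The analogue of linear independence is that an expansion is
    dominated by its largest term if this is unique ([seminorm_expand] and
    [seminorm_expand_term]).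

    Two apartments intersect in a convex set given by finitely many inequalities
    ([splits_criterion]), on which the coordinates agree up to a permutation
    ([transition]); that the correspondence is a permutation follows from the
    invariance of volume, proved by Steinitz exchange ([volume_invariant]). Two
    norms have a common frame because the extreme values of their ratio are
    attained and can be split off successively ([common_frame]). Deep in a
    sector the norms are split by every triangle containing the flag at infinity
    of the sector ([sector_splits]), and two flags lie in a common triangle.
    The retraction centred at a norm [g] records the minima of the ratio [f / g]
    over the Schubert cells of the residual plane of [g]; these minima are
    attained at the corners of a frame that splits both norms
    ([adapted_frame]). It does not increase distances, because minima are
    compared as easily as norms, and because the sum of the coordinates is
    governed by volume, so that the displacement of two images lies in the
    convex hull of the permutations of the original one ([proj_length_le]).

    Along a panel the norms grow, after rescaling, everywhere except at one
    point, or except on one line. Panels are parallel exactly if these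
    exceptional sets agree ([trace_parallel], [parallel_trace]); this identifies
    the classes of panels of the two types with the points and the lines of the
    plane. *)

(** * Triples *)

Section Tri.
Variable R : realType.
Implicit Types x y z : R.

(** What an ultrametric absolute value retains of a relation between three
    summands whose sum is zero. *)
Definition max_twice x y z : Prop :=
  [/\ x <= y \/ x <= z, y <= x \/ y <= z & z <= x \/ z <= y].

Lemma max_twice_pM a x y z : 0 < a -> max_twice (x * a) (y * a) (z * a) ->
  max_twice x y z.
Proof. by move=> a0; rewrite /max_twice !ler_pM2r. Qed.

End Tri.

Lemma ord3_third (i : 'I_3) : exists j k,
  [/\ i != j, i != k, j != k & forall m, [\/ m = i, m = j | m = k]].
Proof.
pose o0 : 'I_3 := @Ordinal 3 0 isT; pose o1 : 'I_3 := @Ordinal 3 1 isT.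
pose o2 : 'I_3 := @Ordinal 3 2 isT.
have oP (m : 'I_3) : [\/ m = o0, m = o1 | m = o2].
  case: m => [[|[|[|//]]] h]; [apply: Or31|apply: Or32|apply: Or33];
    exact: val_inj.
have [->|->|->] := oP i; [exists o1, o2|exists o0, o2|exists o0, o1];
  split=> //;
  move=> m; have [->|->|->] := oP m; by [apply: Or31|apply: Or32|apply: Or33].
Qed.

Lemma ord3_other (i j : 'I_3) : i != j -> exists k,
  [/\ i != k, j != k & forall m, [\/ m = i, m = j | m = k]].
Proof.
move=> ij; have [j' [k' [ij' ik' jk' H]]] := ord3_third i.
have [ji|->|->] := H j; first by rewrite ji eqxx in ij.
  by exists k'; split.
exists j'; split=> //; first by rewrite eq_sym.
move=> m; by have [->|->|->] := H m; [apply: Or31|apply: Or33|apply: Or32].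
Qed.

Lemma big3 (T : Type) (idx : T) (op : Monoid.com_law idx) (F : 'I_3 ->
  T) i j k :
  i != j -> i != k -> j != k -> \big[op/idx]_m F m = op (op (F i) (F j)) (F k).
Proof.
move=> ij ik jk; rewrite (bigD1 i) //= (bigD1 j) 1?eq_sym //= (bigD1 k) /=.
  rewrite big1 ?Monoid.mulm1 ?Monoid.mulmA // => m /andP[/andP[mi mj] mk].
  have [k' [_ _ H]] := ord3_other ij.
  by have [E|E|E] := H m; have [E'|E'|E'] := H k; subst;
    rewrite ?eqxx in mi mj mk ik jk.
by rewrite eq_sym ik eq_sym jk.
Qed.

Lemma prod3 (A : comPzRingType) (F : 'I_3 -> A) i j k :
  i != j -> i != k -> j != k -> \prod_m F m = F i * F j * F k.
Proof. exact: big3. Qed.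

Lemma sum3 (A : nmodType) (F : 'I_3 -> A) i j k :
  i != j -> i != k -> j != k -> \sum_m F m = F i + F j + F k.
Proof. exact: big3. Qed.

Lemma ord3_max (R : realType) (F : 'I_3 -> R) : exists i, forall j, F j <= F i.
Proof.
by have [i _ H] := @arg_maxP _ _ _ (ord0 : 'I_3) xpredT F isT; exists i => j;
  exact: H.
Qed.

Section Ptolemy.
Variables (R : realType) (T : Type) (d : T -> T -> R).
Hypothesis pos : forall p q, 0 <= d p q.
Hypothesis sy : forall p q, d p q = d q p.
Hypothesis um : forall p q r, d p q <= d p r \/ d p q <= d r q.

(** If the product on the left were larger than both products on the right, then
    in each of these some factor would be smaller than its counterpart on the
    left, for either way of pairing the factors; every choice contradicts the
    ultrametric inequality for one of the triangles. *)
Lemma ptolemy p q r s :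
  d r s * d p q <= d p s * d q r \/ d r s * d p q <= d q s * d p r.
Proof.
have h1 := um r s p; have h2 := um r s q.
have h3 := um p q r; have h4 := um p q s.
rewrite (sy s q) (sy r q) (sy r p) in h1 h2 h3 h4.
have := pos r s; have := pos p q.
move: (d r s) (d p q) (d p s) (d q r) (d q s) (d p r) h1 h2 h3 h4.
move=> x y a b c e h1 h2 h3 h4 y0 x0.
have [|lt1] := leP (x * y) (a * b); first by left.
have [|lt2] := leP (x * y) (c * e); first by right.
exfalso.
have k1 : a < x \/ b < y.
  have [xa|] := leP x a; last by left.
  have [yb|] := leP y b; last by right.
  by move: lt1; rewrite ltNge ler_pM.
have k2 : b < x \/ a < y.
  have [xa|] := leP x b; last by left.
  have [yb|] := leP y a; last by right.
  by move: lt1; rewrite ltNge (mulrC a) ler_pM.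
have k3 : c < x \/ e < y.
  have [xa|] := leP x c; last by left.
  have [yb|] := leP y e; last by right.
  by move: lt2; rewrite ltNge ler_pM.
have k4 : e < x \/ c < y.
  have [xa|] := leP x e; last by left.
  have [yb|] := leP y c; last by right.
  by move: lt2; rewrite ltNge (mulrC c) ler_pM.
clear lt1 lt2 y0 x0.
case: k1 => k1; case: k3 => k3; (case: h3 => h3; try lra);
 (case: h4 => h4; try lra); (case: h1 => h1; try lra);
 (case: h2 => h2; try lra); (case: k2 => k2; try lra);
 (case: k4 => k4; try lra).
Qed.


End Ptolemy.

(** * Projective planes *)

Section Projective.
Variable G : geometry.
Hypothesis hG : projective_plane G.
Notation P := (points G).
Notation L := (lines G).

Lemma line_through (p q : P) : exists K, inc p K /\ inc q K.
Proof.
have [->|pq] := pselect (p = q).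
  by have [K [_ [_ [[pK _ _] _]]]] := pp_thick_point hG q; exists K.
by have [K [pqK _]] := pp_join hG pq; exists K.
Qed.

Lemma line_eq p q (K M : L) : p <> q ->
  inc p K -> inc q K -> inc p M -> inc q M -> K = M.
Proof.
by move=> pq pK qK pM qM; have [N [_ H]] := pp_join hG pq;
  rewrite -(H K) // -(H M).
Qed.

Lemma point_eq p q (K M : L) : K <> M ->
  inc p K -> inc q K -> inc p M -> inc q M -> p = q.
Proof.
by move=> KM pK qK pM qM; apply: contrapT => pq; apply: KM;
  apply: (line_eq (p := p) (q := q)).
Qed.

Lemma meet_point (K M : L) : exists p, inc p K /\ inc p M.
Proof.
have [->|KM] := pselect (K = M).
  by have [p [_ [_ [[pK _ _] _]]]] := pp_thick_line hG M; exists p.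
by have [p [pKM _]] := pp_meet hG KM; exists p.
Qed.

Lemma other_point p (K : L) : exists2 q, inc q K & q <> p.
Proof.
have [a [b [c [[aK bK _] [ab _ _]]]]] := pp_thick_line hG K.
have [ap|ap] := pselect (a = p); last by exists a.
by exists b => // bp; apply: ab; rewrite ap bp.
Qed.

Lemma off_point (K : L) : exists q, ~ inc q K.
Proof.
have [p [_ [_ [[pK _ _] _]]]] := pp_thick_line hG K.
have [A [B [_ [[pA pB _] [AB _ _]]]]] := pp_thick_point hG p.
have [M [pM MK]] : exists M, inc p M /\ M <> K.
  have [AK|AK] := pselect (A = K); last by exists A.
  by exists B; split=> // BK; apply: AB; rewrite AK BK.
have [q qM qp] := other_point p M.
exists q => qK; apply: MK; exact: (line_eq (nesym qp) pM qM pK qK).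
Qed.

End Projective.

(** * Norms on a plane with heights *)

(** What the building needs of the metric: [delta p K] plays the part
    of the distance from the point [p] to the line [K], that is, of
    [dist p q * sin (ang pq K)] for any [q] on [K]; [gauge_sine] states that
    the product of a side of a triangle with the corresponding height does not
    depend on the side. *)
Record gauged_plane (R : realType) : Type := GaugedPlane {
  gp_geom :> geometry;
  gp_proj : projective_plane gp_geom;
  dist : points gp_geom -> points gp_geom -> R;
  delta : points gp_geom -> lines gp_geom -> R;
  dist_sym : forall p q, dist p q = dist q p;
  dist_ge0 : forall p q, 0 <= dist p q;
  dist_eq0 : forall p q, dist p q = 0 <-> p = q;
  dist_max : forall p q r, dist p q <= dist p r \/ dist p q <= dist r q;
  delta_ge0 : forall p K, 0 <= delta p K;
  delta_eq0 : forall p K, delta p K = 0 <-> inc p K;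
  gauge_sine : forall p q r K M, inc q K -> inc r K -> inc p M -> inc q M ->
    delta p K * dist q r = delta r M * dist p q }.

Section Gauge.
Variables (R : realType) (G : gauged_plane R).
Notation P := (points G).
Notation L := (lines G).
Notation d := (@dist R G).
Local Notation hG := (gp_proj G).
Implicit Types (p q r s : P) (K M : L).

Lemma dist_gt0 p q : p <> q -> 0 < d p q.
Proof.
by move=> pq; rewrite lt_neqAle dist_ge0 andbT eq_sym;
  apply/eqP => /dist_eq0.
Qed.

Lemma delta0 p K : inc p K -> delta p K = 0.
Proof. by move/delta_eq0. Qed.

Lemma delta_gt0 p K : ~ inc p K -> 0 < delta p K.
Proof.
by move=> pK; rewrite lt_neqAle delta_ge0 andbT eq_sym;
  apply/eqP => /delta_eq0.
Qed.

(** The sine rule, applied to an auxiliary point of [M], shows that along a line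
    the heights over [M] are proportional to the distances from the intersection
    with [M]. *)
Lemma delta_prop p q s K M : inc p K -> inc q K -> inc s K -> inc s M ->
  delta p M * d q s = delta q M * d p s.
Proof.
move=> pK qK sK sM; have [x xM xs] := other_point hG s M.
have ep := gauge_sine sM xM pK sK; have eq := gauge_sine sM xM qK sK.
apply: (mulIf (lt0r_neq0 (dist_gt0 (nesym xs)))).
by rewrite mulrAC ep [RHS]mulrAC eq mulrAC.
Qed.

(** Over a field with a valuation, these are the ratios of two norms on the
    vectors spanning the points: three vectors spanning collinear points satisfy
    a linear relation with coefficients proportional to the distances. *)
Record seminorm (g : P -> R) : Prop := Seminorm {
  seminorm_ge0 : forall p, 0 <= g p;
  seminorm_max : forall p q r K, inc p K -> inc q K -> inc r K ->
    g r * d p q <= g p * d q r \/ g r * d p q <= g q * d p r }.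

Record norm (f : P -> R) : Prop := Norm {
  norm_gt0 : forall p, 0 < f p;
  norm_max : forall p q r K, inc p K -> inc q K -> inc r K ->
    f r * d p q <= f p * d q r \/ f r * d p q <= f q * d p r }.

Lemma norm_seminorm f : norm f -> seminorm f.
Proof. by case=> f0 fm; split=> // p; rewrite ltW. Qed.

Lemma seminorm_max_twice g p q r K : seminorm g -> inc p K -> inc q K ->
  inc r K ->
  max_twice (g r * d p q) (g p * d q r) (g q * d p r).
Proof.
move=> [_ gm] pK qK rK; split; first exact: (gm _ _ _ K).
  have := gm q r p K qK rK pK; rewrite (dist_sym r p) (dist_sym q p).
  by tauto.
have := gm p r q K pK rK qK; rewrite (dist_sym r q).
by tauto.
Qed.

(** On a line, heights are proportional to distances from a fourth point, so
    that this is Ptolemy's inequality. *)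
Lemma delta_seminorm K : seminorm (fun p => delta p K).
Proof.
split=> [p|p q r M pM qM rM]; first exact: delta_ge0.
have [s [sM sK]] := meet_point hG M K.
have [rs|rs] := pselect (r = s).
  by left; rewrite rs (delta0 sK) mul0r mulr_ge0 ?delta_ge0 ?dist_ge0.
have drs := dist_gt0 rs; have dr0 : 0 <= delta r K := delta_ge0 _ _.
have ep := delta_prop pM rM sM sK; have eq := delta_prop qM rM sM sK.
have [h|h] := ptolemy (@dist_ge0 _ G) (@dist_sym _ G) (@dist_max _ G) p q r s;
  [left|right]; rewrite -(ler_pM2r drs) mulrAC -mulrA.
  by rewrite [leRHS]mulrAC ep -mulrA ler_wpM2l.
by rewrite [leRHS]mulrAC eq -mulrA ler_wpM2l.
Qed.

End Gauge.

Section SineGeometry.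
Variables (R : realType) (G : geometry).
Hypothesis hG : projective_plane G.
Notation P := (points G).
Notation L := (lines G).
Implicit Types (p q r l m n : P) (K M N : L).

(** * Heights and the sine rule *)

(** The sine rule for a distance [d] and the sine [s] of an angle, in the form
    that the height of a triangle can be computed from either side adjacent to
    it; degenerate triangles are included. *)
Record sine_geometry (d : P -> P -> R) (s : L -> L ->
  R) : Prop := SineGeometry {
  sg_dsym : forall p q, d p q = d q p;
  sg_dge0 : forall p q, 0 <= d p q;
  sg_deq0 : forall p q, d p q = 0 <-> p = q;
  sg_ssym : forall K M, s K M = s M K;
  sg_sge0 : forall K M, 0 <= s K M;
  sg_seq0 : forall K M, s K M = 0 <-> K = M;
  sg_sine : forall p q q' K M M', inc p M -> inc q M -> inc q K ->
    inc p M' -> inc q' M' -> inc q' K -> d p q * s M K = d p q' * s M' K }.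

(** If [p] lies on [K], then both sides vanish, since [q] is [p] or [M] is [K];
    and if [q] and [q'] coincide, then so do [M] and [M']. *)
Lemma sine_degenerate (d : P -> P -> R) (s : L -> L -> R) :
  (forall p q, d p q = 0 <-> p = q) -> (forall K M, s K M = 0 <-> K = M) ->
  (forall p q q' K M M', ~ inc p K -> q <> q' -> inc p M -> inc q M ->
    inc q K ->
    inc p M' -> inc q' M' -> inc q' K -> d p q * s M K = d p q' * s M' K) ->
  forall p q q' K M M', inc p M -> inc q M -> inc q K ->
    inc p M' -> inc q' M' -> inc q' K -> d p q * s M K = d p q' * s M' K.
Proof.
move=> d0 s0 H p q q' K M M' pM qM qK pM' qM' qK'.
have [pK|pK] := pselect (inc p K).
  have z r N : inc p N -> inc r N -> inc r K -> d p r * s N K = 0.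
    move=> pN rN rK; have [NK|NK] := pselect (N = K).
      by rewrite ((s0 _ _).2 NK) mulr0.
    by rewrite ((d0 _ _).2 _) ?mul0r //; exact: (point_eq hG NK).
  by rewrite !z.
have [qq'|qq'] := pselect (q = q'); last exact: H.
subst q'; have pq : p <> q by move=> E; apply: pK; rewrite E.
by rewrite (line_eq hG pq pM qM pM' qM').
Qed.

Variables (d : P -> P -> R) (s : L -> L -> R).
Hypothesis hs : sine_geometry d s.

Definition height p K : R := xget 0 [set x | exists q M,
  [/\ inc p M, inc q M, inc q K & x = d p q * s M K]].

Lemma heightE p q K M : inc p M -> inc q M -> inc q K ->
  height p K = d p q * s M K.
Proof.
move=> pM qM qK; rewrite /height; set S := [set x | _].
have : S (xget 0 S) by apply: xgetPex; exists (d p q * s M K), q, M.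
by move=> [q' [M' [pM' qM' qK' ->]]]; exact: (sg_sine hs).
Qed.

Lemma height_base p K : exists q M,
  [/\ inc p M, inc q M, inc q K & height p K = d p q * s M K].
Proof.
have [q [_ [_ [[qK _ _] _]]]] := pp_thick_line hG K.
have [M [pM qM]] := line_through hG p q.
by exists q, M; split=> //; exact: heightE.
Qed.

Lemma height_ge0 p K : 0 <= height p K.
Proof.
have [q [M [_ _ _ ->]]] := height_base p K.
by rewrite mulr_ge0 ?(sg_dge0 hs) ?(sg_sge0 hs).
Qed.

Lemma height_eq0 p K : height p K = 0 <-> inc p K.
Proof.
split=> [|pK]; last first.
  by rewrite (heightE pK pK pK) ((sg_deq0 hs _ _).2 erefl) mul0r.
have [q [M [pM qM qK ->]]] := height_base p K.
move=> /eqP; rewrite mulf_eq0 => /orP[/eqP/(sg_deq0 hs)->//|/eqP/(sg_seq0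
  hs)<-//].
Qed.

Lemma height_sine p q r K M : inc q K -> inc r K -> inc p M -> inc q M ->
  height p K * d q r = height r M * d p q.
Proof.
move=> qK rK pM qM; rewrite (heightE pM qM qK) (heightE rK qK qM).
by rewrite (sg_ssym hs K) (sg_dsym hs r); ring.
Qed.

(** The sine rule for the triangle [p l m], with its height over [M] expressed
    by the angle at [p]. *)
Lemma sine_section p l m K M N : inc p M -> inc l M -> inc l K ->
  inc p N -> inc m N -> inc m K ->
  s M N * (d p l * d p m) = height p K * d l m.
Proof.
move=> pM lM lK pN mN mK.
rewrite (sg_dsym hs l) (height_sine mK lK pN mN).
by rewrite (heightE lM pM pN) (sg_dsym hs l); ring.
Qed.

Lemma off_line p : exists K, ~ inc p K.
Proof.
have [K [_ [_ [[pK _ _] _]]]] := pp_thick_point hG p.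
have [q qK qp] := other_point hG p K; have [r rK] := off_point hG K.
have [M [qM rM]] := line_through hG q r; exists M => pM; apply: rK.
by rewrite (line_eq hG qp qK pK qM pM).
Qed.

(** Ptolemy's inequality for [p] and the points in which the three lines meet a
    line that does not contain [p]; [sine_section] turns distances between the
    latter into sines. *)
Lemma sine_max p K M N : (forall p q r, d p q <= d p r \/ d p q <= d r q) ->
  inc p K -> inc p M -> inc p N -> s K N <= s K M \/ s K N <= s M N.
Proof.
move=> um pK pM pN; have [A pA] := off_line p.
have [k [kK kA]] := meet_point hG K A; have [m [mM mA]] := meet_point hG M A.
have [n [nN nA]] := meet_point hG N A.
have pos q : inc q A -> 0 < d p q.
  move=> qA; rewrite lt_neqAle (sg_dge0 hs) andbT eq_sym.
  by apply/eqP => /(sg_deq0 hs) E; apply: pA; rewrite E.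
have h0 := height_ge0 p A.
have Pkmn : 0 < d p k * d p m * d p n by rewrite !mulr_gt0 ?pos.
have Ekn := sine_section pK kK kA pN nN nA.
have Ekm := sine_section pK kK kA pM mM mA.
have Emn := sine_section pM mM mA pN nN nA.
have := ptolemy (sg_dge0 hs) (sg_dsym hs) um k n p m.
rewrite (sg_dsym hs n p) (sg_dsym hs n m) (sg_dsym hs k p) => -[h|h];
  [left|right]; rewrite -(ler_pM2r Pkmn).
  apply: (@le_trans _ _ (height p A * (d p m * d k n))).
    rewrite le_eqVlt; apply/orP; left; apply/eqP.
    by transitivity (s K N * (d p k * d p n) * d p m); [ring|rewrite Ekn; ring].
  apply: le_trans (ler_wpM2l h0 h) _.
  rewrite le_eqVlt; apply/orP; left; apply/eqP.
  by transitivity (height p A * d k m * d p n); [ring|rewrite -Ekm; ring].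
apply: (@le_trans _ _ (height p A * (d p m * d k n))).
  rewrite le_eqVlt; apply/orP; left; apply/eqP.
  by transitivity (s K N * (d p k * d p n) * d p m); [ring|rewrite Ekn; ring].
apply: le_trans (ler_wpM2l h0 h) _.
rewrite le_eqVlt; apply/orP; left; apply/eqP.
by transitivity (height p A * d m n * d p k); [ring|rewrite -Emn; ring].
Qed.

(** ** From angles to distances *)

Hypothesis d_le1 : forall p q, d p q <= 1.
Hypothesis s_le1 : forall K M, s K M <= 1.
Hypothesis d_line : forall p q r K, inc p K -> inc q K -> inc r K ->
  d p q <= d p r \/ d p q <= d r q.
Hypothesis s_point : forall p K M N, inc p K -> inc p M -> inc p N ->
  s K N <= s K M \/ s K N <= s M N.
Hypothesis d_one : forall K, exists p q, [/\ inc p K, inc q K & d p q = 1].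
Hypothesis s_one : forall p, exists K M, [/\ inc p K, inc p M & s K M = 1].

(** Of two points [l] and [m] at distance 1 on [K], one has distance 1 to [p].
    Otherwise a line [K'] through [m] orthogonal to [K] would be orthogonal to
    [pm] and to [pl] as well, and would intersect [pl] in a point at distance 1
    from [l] and less than 1 from [p], although [l] has distance less than 1
    from [p]. *)
Lemma far_point p K : ~ inc p K -> exists2 n, inc n K & d p n = 1.
Proof.
move=> pK; have [l [m [lK mK lm1]]] := d_one K.
have lm : l <> m.
  by move=> /(sg_deq0 hs); rewrite lm1 => /eqP; rewrite oner_eq0.
have [pl|pl] := eqVneq (d p l) 1; first by exists l.
have [pm|pm] := eqVneq (d p m) 1; first by exists m.
have {}pl : d p l < 1 by rewrite lt_neqAle pl d_le1.
exfalso; have [M [pM mM]] := line_through hG p m.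
have [N [pN lN]] := line_through hG p l.
have mN : ~ inc m N by move=> mN; apply: pK;
  rewrite (line_eq hG lm lK mK lN mN).
have [K' [mK' KK']] : exists K', inc m K' /\ s K' K = 1.
  have [A [B [mA mB AB]]] := s_one m.
  have [h|h] := s_point mA mK mB; [exists A|exists B]; split=> //;
    apply/eqP; rewrite eq_le s_le1 -AB //=.
  by rewrite (sg_ssym hs B K).
have nK' : K' <> K by move=> /(sg_seq0 hs); rewrite KK' => /eqP;
  rewrite oner_eq0.
have lK' : ~ inc l K'.
  by move=> lK'; apply: nK'; rewrite (line_eq hG lm lK mK lK' mK').
have sMK : s M K < 1.
  apply: le_lt_trans pl.
  have := heightE lK mK mM; rewrite (heightE lN pN pM) lm1 mul1r (sg_ssym hs K).
  by move=> <-; rewrite (sg_dsym hs l) ler_piMr ?(sg_dge0 hs).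
have sK'M : s K' M = 1.
  apply/eqP; rewrite eq_le s_le1 /= -KK'.
  by have [//|h] := s_point mK' mM mK; move: sMK; rewrite ltNge -KK' h.
have [y [yN yK']] := meet_point hG N K'.
have ly : d l y * s N K' = 1.
  by rewrite -(heightE lN yN yK') (heightE lK mK mK') lm1 mul1r (sg_ssym hs).
have sNK' : s N K' = 1.
  apply/eqP; rewrite eq_le s_le1 /= -ly ler_piMl ?(sg_sge0 hs) //.
rewrite sNK' mulr1 in ly.
have py : d p y = d p m.
  have := heightE pN yN yK'; rewrite (heightE pM mM mK') sNK' mulr1.
  by rewrite (sg_ssym hs M) sK'M mulr1.
have [h|h] := d_line lN yN pN.
  by move: pl; rewrite ltNge (sg_dsym hs) -ly h.
by move: pm; rewrite -py eq_le d_le1 -ly h.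
Qed.

Lemma dist_ultrametric p q r : d p q <= d p r \/ d p q <= d r q.
Proof.
have [pq|pq] := pselect (p = q).
  by left; rewrite ((sg_deq0 hs p q).2 pq) (sg_dge0 hs).
have [K [pK qK]] := line_through hG p q.
have [rK|rK] := pselect (inc r K); first exact: (d_line pK qK rK).
have [n nK rn] := far_point rK.
have [A [rA pA]] := line_through hG r p;
  have [B [rB qB]] := line_through hG r q.
have [C [rC nC]] := line_through hG r n.
have Epq := sine_section rA pA pK rB qB qK.
have Epn := sine_section rA pA pK rC nC nK.
have Enq := sine_section rC nC nK rB qB qK.
rewrite rn ?mulr1 ?mul1r in Epn Enq.
have h0 : 0 < height r K.
  rewrite lt_neqAle height_ge0 andbT eq_sym; apply/eqP => /height_eq0;
    exact: rK.
have drp : 0 <= d r p := sg_dge0 hs _ _;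
  have drq : 0 <= d r q := sg_dge0 hs _ _.
suff : height r K * d p q <= height r K * d r p \/
    height r K * d p q <= height r K * d r q.
  by rewrite !ler_pM2l // (sg_dsym hs p r).
rewrite -Epq.
have [h|h] := s_point rA rC rB; [right|left].
  apply: (@le_trans _ _ (s A C * (d r p * d r q)));
    first by rewrite ler_wpM2r ?mulr_ge0.
  by rewrite mulrA Epn ler_wpM2r // ler_piMr // ltW.
apply: (@le_trans _ _ (s C B * (d r p * d r q)));
  first by rewrite ler_wpM2r ?mulr_ge0.
by rewrite mulrCA mulrC Enq ler_wpM2r // ler_piMr // ltW.
Qed.

End SineGeometry.

(** * Frames and coordinates *)

Section Frames.
Variables (R : realType) (G : gauged_plane R).
Notation P := (points G).
Notation L := (lines G).
Notation d := (@dist R G).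
Local Notation hG := (gp_proj G).
Implicit Types (p q r s : P) (K M : L) (f g : P -> R).

Record frame : Type := Frame {
  corner :> 'I_3 -> P;
  side : 'I_3 -> L;
  frameP : forall i j, inc (corner i) (side j) <-> i != j }.

Implicit Type e : frame.

Lemma frame_off e i : ~ inc (e i) (side e i).
Proof. by move/frameP; rewrite eqxx. Qed.

Lemma frame_on e i j : i != j -> inc (e i) (side e j).
Proof. by move/frameP. Qed.

Lemma frame_neq e i j : i != j -> e i <> e j.
Proof. by move=> ij eij; apply: (@frame_off e j); rewrite -eij;
  exact/frameP. Qed.

Lemma frame_of_corners (x : 'I_3 -> P) :
  ~ (exists K, forall i, inc (x i) K) -> exists e, corner e = x.
Proof.
move=> nc.
have /choice[l lP] i : exists K, forall j, j != i -> inc (x j) K.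
  have [j [k [ij ik jk H]]] := ord3_third i.
  have [K [jK kK]] := line_through hG (x j) (x k); exists K => m.
  by have [->|->|->] := H m; rewrite ?eqxx.
have off i : ~ inc (x i) (l i).
  by move=> xi; apply: nc; exists (l i) => j; have [->//|/lP] := eqVneq j i.
have lE i j : inc (x i) (l j) <-> i != j.
  by split=> [xij|/lP//]; apply/eqP => ij; apply: (off i); rewrite {2}ij.
by exists (Frame lE).
Qed.

(** ** Coordinates with respect to a frame *)

(** The absolute value of the [i]-th coordinate of a vector spanning [p], in
    the basis spanning the corners of [e], scaled so that the corners have
    coordinates 0 and 1. *)
Definition fcoord e i p : R :=
  locked (delta p (side e i) / delta (e i) (side e i)).

Lemma fcoordE e i p :
  fcoord e i p = delta p (side e i) / delta (e i) (side e i).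
Proof. by rewrite /fcoord -lock. Qed.

Lemma fcoord_denom_gt0 e i : 0 < delta (e i) (side e i).
Proof. exact/delta_gt0/frame_off. Qed.

Lemma fcoord_ge0 e i p : 0 <= fcoord e i p.
Proof. by rewrite fcoordE divr_ge0 ?delta_ge0. Qed.

Lemma fcoord_eq0 e i p : fcoord e i p = 0 <-> inc p (side e i).
Proof.
rewrite fcoordE; split=> [/eqP|/delta0 h]; last by rewrite h mul0r.
rewrite mulf_eq0 invr_eq0 (negbTE (lt0r_neq0 (fcoord_denom_gt0 e i))) orbF.
by move/eqP/delta_eq0.
Qed.

Lemma fcoord_gt0 e i p : ~ inc p (side e i) -> 0 < fcoord e i p.
Proof.
by move=> h; rewrite fcoordE; apply: divr_gt0;
  [exact: delta_gt0|exact: fcoord_denom_gt0]. Qed.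

Lemma fcoordii e i : fcoord e i (e i) = 1.
Proof. by rewrite fcoordE divff ?lt0r_neq0 ?fcoord_denom_gt0. Qed.

Lemma fcoordij e i j : j != i -> fcoord e i (e j) = 0.
Proof. by move=> ij; apply/fcoord_eq0/frameP. Qed.

Lemma seminormZ g a : 0 <= a -> seminorm g -> seminorm (fun p => g p * a).
Proof.
move=> a0 [g0 gm]; split=> [p|p q r K pK qK rK]; first exact: mulr_ge0.
by rewrite !(mulrAC _ a); have [h|h] := gm _ _ _ _ pK qK rK; [left|right];
  apply: ler_wpM2r.
Qed.

Lemma fcoord_seminorm e i : seminorm (fcoord e i).
Proof.
have h : 0 <= (delta (e i) (side e i))^-1 by rewrite invr_ge0 delta_ge0.
have [? hm] := seminormZ h (delta_seminorm (side e i)).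
by split=> [p|p q r K pK qK rK]; [exact: fcoord_ge0|rewrite !fcoordE;
  exact: (hm p q r K)].
Qed.

(** The relation between a point of a side and the two corners on it. *)
Lemma side_max_twice e i j k q g : i != j -> i != k -> j != k ->
  inc q (side e i) -> seminorm g ->
  max_twice (g q) (g (e j) * fcoord e j q) (g (e k) * fcoord e k q).
Proof.
move=> ij ik jk qi hg.
have ji : inc (e j) (side e i) by apply/frameP; rewrite eq_sym.
have ki : inc (e k) (side e i) by apply/frameP; rewrite eq_sym.
have D : 0 < d (e j) (e k) := dist_gt0 (@frame_neq e j k jk).
apply: (max_twice_pM D); have := seminorm_max_twice hg ji ki qi.
have cj : fcoord e j q * d (e j) (e k) = d (e k) q.
  rewrite fcoordE mulrAC.
  rewrite (delta_prop qi ji ki); last by apply/frameP; rewrite eq_sym.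
  by rewrite mulrC mulKf ?lt0r_neq0 ?fcoord_denom_gt0 // dist_sym.
have ck : fcoord e k q * d (e j) (e k) = d (e j) q.
  rewrite fcoordE mulrAC (dist_sym (e j)).
  rewrite (delta_prop qi ki ji); last by apply/frameP.
  by rewrite mulrC mulKf ?lt0r_neq0 ?fcoord_denom_gt0 // dist_sym.
by rewrite -!mulrA cj ck.
Qed.

(** Projecting [p] from a corner to the opposite side splits the expansion of
    [p] in a frame into its part along the corner and the rest. *)
Lemma frame_project e i p : exists q a,
  [/\ 0 <= a, inc q (side e i),
      forall j, j != i -> fcoord e j p = a * fcoord e j q &
      forall g, seminorm g -> max_twice (g p) (g (e i) * fcoord e i p) (a * g
        q)].
Proof.
have [pe|pe] := pselect (p = e i).
  have [q [qi _]] := meet_point hG (side e i) (side e i).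
  exists q, 0; split=> // [j ji|g hg].
    by rewrite mul0r pe fcoordij // eq_sym.
  rewrite pe fcoordii mulr1 mul0r; have := seminorm_ge0 hg (e i).
  by split; auto.
have [K [pK eK]] := line_through hG p (e i).
have [q [qK qi]] := meet_point hG K (side e i).
have qe : q <> e i by move=> E; apply: (@frame_off e i); rewrite -E.
have D := dist_gt0 qe.
exists q, (d p (e i) / d q (e i)); split=> [||j ji|g hg] //.
- by rewrite divr_ge0 ?dist_ge0.
- have ej : inc (e i) (side e j) by apply/frameP; rewrite eq_sym.
  rewrite !fcoordE mulrA; congr (_ / _); apply: (mulIf (lt0r_neq0 D)).
  by rewrite (delta_prop pK qK eK ej) mulrAC divfK ?lt0r_neq0 // mulrC.
apply: (max_twice_pM D); have := seminorm_max_twice hg eK qK pK.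
rewrite -mulrA (_ : fcoord e i p * d q (e i) = d q p); last first.
  rewrite fcoordE mulrAC (dist_sym q (e i)) (delta_prop pK eK qK qi).
  by rewrite mulrC mulKf ?lt0r_neq0 ?fcoord_denom_gt0 // dist_sym.
rewrite (dist_sym q (e i)) (mulrAC _ (g q)) divfK ?(mulrC _ (g q)) //.
  by rewrite (dist_sym p).
by rewrite dist_sym lt0r_neq0.
Qed.

(** Projection from a corner reduces this to two relations, each between three
    collinear points. *)
Lemma seminorm_expand e g p : seminorm g ->
  exists i, g p <= g (e i) * fcoord e i p.
Proof.
move=> hg; pose i : 'I_3 := ord0; have [j [k [ij ik jk _]]] := ord3_third i.
have [q [a [a0 qi cE H]]] := frame_project e i p.
have [[h|h] _ _] := H _ hg; first by exists i.
have [[h'|h'] _ _] := side_max_twice ij ik jk qi hg; [exists j|exists k];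
  rewrite cE 1?eq_sym // mulrCA (le_trans h) // ler_wpM2l //.
Qed.

(** The relations used for [seminorm_expand], read for another term: a largest
    term that is unique is not cancelled. This replaces linear independence. *)
Lemma seminorm_expand_term e g p i : seminorm g ->
  g (e i) * fcoord e i p <= g p \/
  exists2 j, j != i & g (e i) * fcoord e i p <= g (e j) * fcoord e j p.
Proof.
move=> hg; have [j [k [ij ik jk _]]] := ord3_third i.
have [q [a [a0 qi cE H]]] := frame_project e i p.
have [_ [h|h] _] := H _ hg; first by left.
right; have T := side_max_twice ij ik jk qi hg.
rewrite eq_sym in ij; rewrite eq_sym in ik.
by have [[h'|h'] _ _] := T;
  [exists j; rewrite // (cE j)|exists k; rewrite // (cE k)];
  rewrite // mulrCA (le_trans h) // ler_wpM2l.
Qed.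

(** ** Norms split by a frame *)

(** A norm is split by a frame if its value is the largest of the terms of the
    expansion; one inequality is automatic. *)
Definition splits f e : Prop :=
  norm f /\ forall i p, f (e i) * fcoord e i p <= f p.

Lemma splits_norm f e : splits f e -> norm f. Proof. by case. Qed.

Lemma splits_term f e i p : splits f e -> f (e i) * fcoord e i p <= f p.
Proof. by case. Qed.

Lemma splits_gt0 f e p : splits f e -> 0 < f p.
Proof. by move/splits_norm/norm_gt0. Qed.

Lemma splits_attained f e p : splits f e ->
  exists i, f p = f (e i) * fcoord e i p.
Proof.
move=> [hf H]; have [i h] := seminorm_expand e p (norm_seminorm hf).
by exists i; apply/eqP; rewrite eq_le h H.
Qed.

Lemma splits_determined f g e k : splits f e -> splits g e -> 0 < k ->
  (forall i, f (e i) = k * g (e i)) -> forall p, f p = k * g p.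
Proof.
move=> sf sg k0 E p; apply/eqP; rewrite eq_le; apply/andP; split.
  have [i ->] := splits_attained p sf.
  by rewrite E -mulrA ler_pM2l // splits_term.
have [i ->] := splits_attained p sg.
by rewrite mulrA -E splits_term.
Qed.

Lemma normZ f k : 0 < k -> norm f -> norm (fun p => k * f p).
Proof.
move=> k0 [f0 fm]; split=> [p|p q r K pK qK rK]; first exact: mulr_gt0.
by rewrite -!mulrA !ler_pM2l //; exact: (fm _ _ _ K).
Qed.

Lemma splitsZ f e k : 0 < k -> splits f e -> splits (fun p => k * f p) e.
Proof.
move=> k0 [hf H]; split=> [|i p]; first exact: normZ.
by rewrite -mulrA ler_pM2l.
Qed.

Lemma splits_exists e (b : 'I_3 -> R) : (forall i, 0 < b i) ->
  exists2 f, splits f e & forall i, f (e i) = b i.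
Proof.
move=> b0; have /choice[m mP] p := ord3_max (fun i => b i * fcoord e i p).
pose f p := b (m p) * fcoord e (m p) p.
have le i p : b i * fcoord e i p <= f p := mP p i.
have fe i : f (e i) = b i.
  apply/eqP; rewrite eq_le; apply/andP; split.
    rewrite /f; have [->|mi] := eqVneq (m (e i)) i.
      by rewrite fcoordii mulr1.
    by rewrite fcoordij 1?eq_sym // mulr0 ltW.
  by rewrite -[leLHS]mulr1 -(fcoordii e i).
exists f => //; split=> [|i p]; last by rewrite fe.
split=> [p|p q r K pK qK rK].
  have [i hi] : exists i, ~ inc p (side e i).
    apply: contrapT => /forallNP H.
    have H' i : inc p (side e i) by apply: contrapT; apply: H.
    have [j [k [ij ik jk _]]] := ord3_third ord0.
    have pj : p <> e ord0 by move=> E; apply: (@frame_off e ord0); rewrite -E.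
    apply: (@frame_neq e j k jk); apply: contrapT => ejk.
    have E : side e ord0 = side e j.
      apply: (line_eq hG (p := p) (q := e k)) => //.
      + by move=> E; apply: (@frame_off e k); rewrite -E.
      + by apply/frameP; rewrite eq_sym.
      + by apply/frameP; rewrite eq_sym.
    by apply: (@frame_off e ord0); rewrite E; apply/frameP.
  by apply: lt_le_trans (le i p); rewrite mulr_gt0 // fcoord_gt0.
pose i := m r; rewrite (_ : f r = b i * fcoord e i r) //.
have := seminorm_max (fcoord_seminorm e i) pK qK rK.
by case=> h; [left|right]; rewrite -mulrA;
  apply: le_trans (ler_wpM2l (ltW (b0 i)) h) _; rewrite mulrA;
  apply: ler_wpM2r; rewrite ?dist_ge0.
Qed.

(** The coordinates with respect to [e'] are seminorms and therefore bounded by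
    their values at the corners of [e]. *)
Lemma splits_criterion f e e' : splits f e ->
  (forall j k, f (e' j) * fcoord e' j (e k) <= f (e k)) -> splits f e'.
Proof.
move=> sf H; split=> [|j q]; first exact: splits_norm sf.
have [k h] := seminorm_expand e q (fcoord_seminorm e' j).
apply: le_trans (splits_term k q sf).
apply: le_trans (ler_wpM2l (ltW (splits_gt0 _ sf)) h) _.
by rewrite mulrA ler_wpM2r ?fcoord_ge0.
Qed.

End Frames.

(** * Exchange and volume *)

Section Exchange.
Variables (R : realType) (G : gauged_plane R).
Notation P := (points G).
Notation L := (lines G).
Notation d := (@dist R G).
Local Notation hG := (gp_proj G).
Implicit Types (p q r s : P) (K M : L) (f g : P -> R) (e : frame G).

Definition exchanged e e' i := forall j, j != i -> e' j = e j.

Lemma exchange e i p : ~ inc p (side e i) ->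
  exists2 e', exchanged e e' i & e' i = p.
Proof.
move=> pi; have [j [k [ij ik jk _]]] := ord3_third i.
have [] := @frame_of_corners _ G (fun j => if j == i then p else e j).
  move=> [K HK]; apply: pi.
  have := HK i; have := HK j; have := HK k.
  rewrite eqxx !(eq_sym _ i) (negbTE ij) (negbTE ik) => kK jK.
  have -> // : K = side e i.
  apply: (line_eq hG (@frame_neq _ _ e j k jk)) => //;
    by apply/frameP; rewrite eq_sym.
move=> e' E; exists e' => [m mi|]; by rewrite E ?eqxx ?(negbTE mi).
Qed.

Lemma exchanged_side e e' i : exchanged e e' i -> side e' i = side e i.
Proof.
move=> ee'; have [j [k [ij ik jk _]]] := ord3_third i.
have [ji ki] : (j != i) /\ (k != i) by rewrite !(eq_sym _ i).
apply: (line_eq hG (@frame_neq _ _ e j k jk)); try exact/frameP.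
  by rewrite -(ee' j ji); apply/frameP.
by rewrite -(ee' k ki); apply/frameP.
Qed.

Lemma exchanged_fcoord e e' i q : exchanged e e' i ->
  fcoord e i q = fcoord e' i q * fcoord e i (e' i).
Proof.
move=> ee'; have s := exchanged_side ee'.
have := fcoord_denom_gt0 e' i; rewrite !fcoordE s => /lt0r_neq0 h.
by rewrite mulrA divfK.
Qed.

(** The only corner of [e] at which a coordinate with respect to [e'] is not
    evident is the exchanged one; its coordinates are those of the new corner,
    up to the factor by which the norms of the two differ. *)
Lemma exchange_splits f e e' i : splits f e -> exchanged e e' i ->
  f (e' i) = f (e i) * fcoord e i (e' i) -> splits f e'.
Proof.
move=> sf ee' E; apply: (splits_criterion sf) => j k.
have f0 q := splits_gt0 q sf.
have back : f (e' i) * fcoord e' i (e i) = f (e i).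
  by rewrite E -mulrA (mulrC (fcoord e i _)) -exchanged_fcoord // fcoordii
    mulr1.
have [ki|ki] := eqVneq k i; last first.
  rewrite -(ee' k ki); have [->|kj] := eqVneq k j.
    by rewrite fcoordii mulr1.
  by rewrite fcoordij // mulr0 ltW.
rewrite {}ki; have [->|ji] := eqVneq j i; first by rewrite back.
rewrite (ee' j ji).
have [|[l lj]] := seminorm_expand_term e' (e i) j (fcoord_seminorm e j).
  rewrite (ee' j ji) fcoordii mul1r (fcoordij e) 1?eq_sym // => h.
  by apply: le_trans (ler_wpM2l (ltW (f0 _)) h) _; rewrite mulr0 ltW.
rewrite (ee' j ji) fcoordii mul1r.
have [->|li] := eqVneq l i; last first.
  rewrite (ee' l li) (fcoordij e) // mul0r => h.
  by apply: le_trans (ler_wpM2l (ltW (f0 _)) h) _; rewrite mulr0 ltW.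
move=> h; apply: le_trans (ler_wpM2l (ltW (f0 _)) h) _.
by rewrite mulrA -[leRHS]back ler_wpM2r ?fcoord_ge0 ?splits_term.
Qed.

(** The absolute value of the determinant of a basis spanning the corners,
    relative to the lengths of its vectors. *)
Definition volume e : R := locked
  (delta (e ord0) (side e ord0) * d (e (Ordinal (isT : 1 < 3)%N)) (e ord_max)).

Lemma volumeE e i j k : i != j -> i != k -> j != k ->
  volume e = delta (e i) (side e i) * d (e j) (e k).
Proof.
pose V i j k := delta (e i) (side e i) * d (e j) (e k).
have sw a b c : V a b c = V a c b by rewrite /V dist_sym.
have cyc a b c : a != b -> a != c -> b != c -> V a b c = V c a b.
  move=> ab ac bc; apply: gauge_sine; apply/frameP => //;
  by rewrite eq_sym.
move=> ij ik jk; rewrite -[RHS]/(V i j k) /volume -lock -/(V _ _ _).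
have h1 : V j k i = V i j k by rewrite cyc // eq_sym.
have h2 : V k i j = V i j k by rewrite -cyc.
have [l [_ _ H]] := ord3_other ij; have {H} H m : [\/ m = i, m = j | m = k].
  have [E|E|E] := H m; have [F|F|F] := H k; subst;
  by [apply: Or31|apply: Or32|apply: Or33|rewrite eqxx in ik jk].
have : ord0 != Ordinal (isT : 1 < 3)%N by [].
have : ord0 != ord_max :> 'I_3 by [].
have : Ordinal (isT : 1 < 3)%N != ord_max by [].
have [->|->|->] := H ord0; have [->|->|->] := H ord_max;
  have [->|->|->] := H (Ordinal (isT : 1 < 3)%N); rewrite ?eqxx // => _ _ _;
  by rewrite // sw.
Qed.

End Exchange.

(** * Two frames of a norm *)

Section CommonFrames.
Variables (R : realType) (G : gauged_plane R).
Notation P := (points G).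
Notation L := (lines G).
Local Notation hG := (gp_proj G).
Implicit Types (p q r s : P) (K M : L) (f g : P -> R) (e : frame G).

Lemma volume_gt0 e : 0 < volume e.
Proof.
rewrite /volume -lock mulr_gt0 ?fcoord_denom_gt0 //; apply: dist_gt0.
exact: (@frame_neq _ _ e (Ordinal (isT : 1 < 3)%N) ord_max).
Qed.

Lemma volume_exchange e e' i : exchanged e e' i ->
  volume e' = fcoord e i (e' i) * volume e.
Proof.
move=> ee'; have [j [k [ij ik jk _]]] := ord3_third i.
have [ji ki] : (j != i) /\ (k != i) by rewrite !(eq_sym _ i).
rewrite !(volumeE _ ij ik jk) (exchanged_side ee') (ee' j ji) (ee' k ki).
by rewrite mulrA fcoordE divfK // lt0r_neq0 // fcoord_denom_gt0.
Qed.

(** The corner [e i] with the largest term in the expansion of the coordinate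
    [j] of [e' j] also has the largest term in the expansion of [f (e' j)].
    Hence exchanging it for [e' j] keeps [f] split, and multiplies the volume
    and the value of [f] by the same factor. *)
Lemma steinitz f e e' j : splits f e -> splits f e' ->
  exists i e1, [/\ fcoord e' j (e i) != 0, exchanged e e1 i, e1 i = e' j,
    splits f e1 &
    (\prod_m f (e m)) * volume e1 = (\prod_m f (e1 m)) * volume e].
Proof.
move=> sf sf'; have f0 p := splits_gt0 p sf.
have [i] := seminorm_expand e (e' j) (fcoord_seminorm e' j).
rewrite fcoordii => h; exists i.
have ci : fcoord e' j (e i) != 0.
  by apply: contraTneq h => ->; rewrite mul0r -ltNge.
have E : f (e' j) = f (e i) * fcoord e i (e' j).
  apply/eqP; rewrite eq_le splits_term // andbT -[leLHS]mulr1.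
  apply: le_trans (ler_wpM2l (ltW (f0 _)) h) _.
  by rewrite mulrA ler_wpM2r ?fcoord_ge0 ?splits_term.
have [|e1 ee1 e1i] := @exchange _ _ e i (e' j).
  by move=> /fcoord_eq0 c0; have := f0 (e' j); rewrite E c0 mulr0 ltxx.
exists e1; split=> //; first by apply: (exchange_splits sf ee1); rewrite e1i.
have [k [l [ik il kl _]]] := ord3_third i.
have [ki li] : (k != i) /\ (l != i) by rewrite !(eq_sym _ i).
rewrite !(prod3 _ ik il kl) (volume_exchange ee1) (ee1 k ki) (ee1 l li) e1i E.
by ring.
Qed.

(** Three exchanges lead from one frame to the other. The corners exchanged are
    distinct, since a coordinate that vanishes at the corners already introduced
    cannot select one of them. *)
Lemma volume_invariant f e e' : splits f e -> splits f e' ->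
  (\prod_i f (e i)) * volume e' = (\prod_i f (e' i)) * volume e.
Proof.
move=> sf sf'.
have [j [k [ij ik jk _]]] := ord3_third (ord0 : 'I_3); set i := ord0 in ij ik.
have [a [e1 [_ ex1 e1a sf1 E1]]] := steinitz i sf sf'.
have [b [e2 [cb ex2 e2b sf2 E2]]] := steinitz j sf1 sf'.
have ba : b != a.
  by apply: contraNneq cb => ->; rewrite e1a fcoordij.
have [c [e3 [cc ex3 e3c sf3 E3]]] := steinitz k sf2 sf'.
have ca : c != a.
  apply: contraNneq cc => ->; rewrite (ex2 a) 1?eq_sym // e1a.
  by rewrite fcoordij.
have cb' : c != b.
  by apply: contraNneq cc => ->; rewrite e2b fcoordij.
have e3b : e3 b = e' j by rewrite (ex3 b) // eq_sym.
have e3a : e3 a = e' i by rewrite (ex3 a) 1?eq_sym // (ex2 a) // eq_sym.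
have [ab ac bc] : [/\ a != b, a != c & b != c] by split; rewrite eq_sym.
have V3 : volume e3 = volume e'.
  rewrite (volumeE _ ab ac bc) (volumeE _ ij ik jk) e3a e3b e3c.
  congr (delta _ _ * _).
  apply: (line_eq hG (@frame_neq _ _ e' j k jk)).
  - by rewrite -e3b; apply/frameP; rewrite eq_sym.
  - by rewrite -e3c; apply/frameP; rewrite eq_sym.
  - by apply/frameP; rewrite eq_sym.
  - by apply/frameP; rewrite eq_sym.
have P3 : \prod_m f (e3 m) = \prod_m f (e' m).
  by rewrite (prod3 _ ab ac bc) (prod3 _ ij ik jk) e3a e3b e3c.
have v e'' : volume e'' != 0 by rewrite lt0r_neq0 ?volume_gt0.
rewrite -P3 -V3.
apply: (mulIf (v e1)); apply: (mulIf (v e2)).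
transitivity ((\prod_m f (e m) * volume e1) * volume e2 * volume e3).
  by ring.
rewrite E1 -(mulrAC _ _ (volume e)).
transitivity ((\prod_m f (e1 m) * volume e2) * volume e * volume e3).
  by ring.
rewrite E2.
transitivity ((\prod_m f (e2 m) * volume e3) * volume e * volume e1).
  by ring.
by rewrite E3; ring.
Qed.

(** The corner [i] carries the largest term in the expansion of the coordinate
    [j] of [e' j], which is 1; the product of the two mutual coordinates is then
    at least 1, so that splitting by both frames forces equality. This choice
    does not depend on the norm. *)
Lemma partner e e' j : exists i a, 0 < a /\
  forall f, splits f e -> splits f e' -> f (e' j) = a * f (e i).
Proof.
have [i] := seminorm_expand e (e' j) (fcoord_seminorm e' j).
rewrite fcoordii => h; exists i, (fcoord e i (e' j)); split.
  rewrite lt_neqAle fcoord_ge0 andbT eq_sym.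
  by apply: contraTneq h => ->; rewrite mulr0 -ltNge.
move=> f sf sf'; have f0 p := splits_gt0 p sf.
apply/eqP; rewrite mulrC eq_le splits_term // andbT -[leLHS]mulr1.
apply: le_trans (ler_wpM2l (ltW (f0 _)) h) _.
by rewrite mulrA ler_wpM2r ?fcoord_ge0 ?splits_term.
Qed.

(** Every corner has a partner in the other frame by [partner]; if the partners
    do not already form a permutation, invariance of volume shows that the
    values at two corners are proportional, so that partners can be traded. *)
Lemma transition e e' : exists (s : 'I_3 -> 'I_3) (a : 'I_3 -> R),
  [/\ injective s, forall j, 0 < a j &
   forall f, splits f e -> splits f e' ->
     forall j, f (e' j) = a j * f (e (s j))].
Proof.
have /choice[s /choice[a saP]] := partner e e'.
have a0 j : 0 < a j by case: (saP j).
have H f : splits f e -> splits f e' -> forall j, f (e' j) = a j * f (e (s j)).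
  by move=> sf sf' j; case: (saP j) => _; apply.
have [si|nsi] := pselect (injective s); first by exists s, a.
have [j1 [j2 [j12 s12]]] : exists j1 j2, j1 != j2 /\ s j1 = s j2.
  apply: contrapT => hn; apply: nsi => x y sxy; apply: contrapT => /eqP xy.
  by apply: hn; exists x, y.
have [j3 [j13 j23 j3P]] := ord3_other j12.
have [s3|s3] := eqVneq (s j1) (s j3).
  have sc j : s j = s j1 by have [->|->|->] := j3P j.
  have /choice[s' /choice[b sbP]] := partner e' e.
  have b0 j : 0 < b j by case: (sbP j).
  exists id, (fun j => a j / (b j * a (s' j))); split=> // [j|f sf sf' j].
    by rewrite divr_gt0 // mulr_gt0.
  have Ee : f (e j) = b j * f (e' (s' j)) by case: (sbP j) => _; apply.
  rewrite Ee (H _ sf sf' (s' j)) (H _ sf sf' j) !sc.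
  by field; rewrite !lt0r_neq0.
have [l [il kl lP]] := ord3_other s3.
pose c := a j1 * a j2 * a j3 * volume e / volume e'.
have c0 : 0 < c by rewrite divr_gt0 ?volume_gt0 // !mulr_gt0 ?volume_gt0.
pose s' j := if j == j2 then l else s j.
exists s', (fun j => if j == j2 then a j2 / c else a j); split.
- have s'1 : s' j1 = s j1 by rewrite /s' (negbTE j12).
  have s'2 : s' j2 = l by rewrite /s' eqxx.
  have s'3 : s' j3 = s j3 by rewrite /s' eq_sym (negbTE j23).
  by move=> x y; have [->|->|->] := j3P x; have [->|->|->] := j3P y;
    rewrite ?s'1 ?s'2 ?s'3 // => E; move: il kl s3;
    first [rewrite E eqxx | rewrite -E eqxx].
- by move=> j; case: ifP => // _; rewrite divr_gt0.
move=> f sf sf' j; rewrite /s'; case: ifP => [/eqP->|_]; last exact: H.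
have f0 p := splits_gt0 p sf.
have V := volume_invariant sf sf'.
rewrite (prod3 _ s3 il kl) (prod3 _ j12 j13 j23) !(H _ sf sf') -s12 in V *.
suff -> : f (e l) = c * f (e (s j1)) by field; rewrite lt0r_neq0.
apply: (mulfI (lt0r_neq0 (f0 (e (s j1))))).
apply: (mulfI (lt0r_neq0 (f0 (e (s j3))))).
apply: (mulIf (lt0r_neq0 (volume_gt0 e'))).
rewrite (mulrC (f (e (s j3)))) mulrAC (mulrAC _ _ (f (e (s j3)))).
rewrite (mulrAC (f (e (s j1)))) V /c.
by field; rewrite lt0r_neq0 ?volume_gt0.
Qed.

End CommonFrames.

(** * Common frames of two norms *)

Section TwoNorms.
Variables (R : realType) (G : gauged_plane R).
Notation P := (points G).
Notation L := (lines G).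
Notation d := (@dist R G).
Local Notation hG := (gp_proj G).
Implicit Types (p q r s : P) (K M : L) (f g : P -> R) (e : frame G).

(** [K] is a complement of [p] such that a vector is at least as long as its
    component along [p]. *)
Definition orth f p K := forall q, f p * delta q K <= f q * delta p K.

Lemma splits_orth f e p : splits f e -> exists2 K, ~ inc p K & orth f p K.
Proof.
move=> sf; have [i E] := splits_attained p sf.
exists (side e i).
  by move=> /fcoord_eq0 c0; have := splits_gt0 p sf; rewrite E c0 mulr0 ltxx.
move=> q; rewrite {1}E.
have D := fcoord_denom_gt0 e i.
have cE r : delta r (side e i) = fcoord e i r * delta (e i) (side e i).
  by rewrite fcoordE divfK ?lt0r_neq0.
rewrite (cE q) (cE p) !mulrA ler_wpM2r ?delta_ge0 // mulrAC ler_wpM2r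
  ?fcoord_ge0 //.
exact: splits_term.
Qed.

(** Where [f / g] is largest, [g] is smallest relative to [f], so that
    orthogonality is a weaker condition for [g] than for [f]. *)
Lemma orth_transfer f g p K : norm f -> norm g ->
  (forall q, f q * g p <= f p * g q) -> orth f p K -> orth g p K.
Proof.
move=> hf hg mx of_ q; have f0 := norm_gt0 hf; have g0 := norm_gt0 hg.
rewrite -(ler_pM2l (f0 p)).
apply: (@le_trans _ _ (g p * (f q * delta p K))).
  by rewrite mulrCA ler_wpM2l // ltW.
rewrite mulrA (mulrC (g p)) mulrA ler_wpM2r ?delta_ge0 //.
Qed.

(** The first complement splits off [p1]; the second one then splits off [p3]
    inside the line [K1]. The frame is the same for all norms. *)
Lemma orth_frame p1 K1 p3 K3 : ~ inc p1 K1 -> inc p3 K1 -> ~ inc p3 K3 ->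
  exists e, forall f, norm f -> orth f p1 K1 -> orth f p3 K3 -> splits f e.
Proof.
move=> p1K1 p3K1 p3K3.
have [p2 [p2K1 p2K3]] := meet_point hG K1 K3.
have p23 : p2 <> p3 by move=> E; apply: p3K3; rewrite -E.
have [j [k [ij ik jk H]]] := ord3_third (ord0 : 'I_3); set i := ord0 in ij ik H.
pose x m := if m == i then p1 else if m == j then p2 else p3.
have xi : x i = p1 by rewrite /x eqxx.
have xj : x j = p2 by rewrite /x eq_sym (negbTE ij) eqxx.
have xk : x k = p3 by rewrite /x !(eq_sym k) (negbTE ik) (negbTE jk).
have [|e E] := @frame_of_corners _ G x.
  move=> [K HK]; apply: p1K1.
  have := HK i; have := HK j; have := HK k; rewrite xi xj xk => kK jK.
  by have -> // := line_eq hG p23 p2K1 p3K1 jK kK.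
have ei : e i = p1 by rewrite E.
have ej : e j = p2 by rewrite E.
have ek : e k = p3 by rewrite E.
have [ji ki kj] : [/\ j != i, k != i & k != j] by split; rewrite eq_sym.
have sideE : side e i = K1.
  apply: (line_eq hG p23) => //; rewrite -?ej -?ek; exact/frameP.
exists e => f hf o1 o3; have f0 p := norm_gt0 hf p.
have t1 q : f p1 * fcoord e i q <= f q.
  have D : 0 < delta p1 K1 by apply: delta_gt0.
  by rewrite fcoordE ei sideE mulrA ler_pdivrMr.
have t3 q : inc q K1 -> f p3 * fcoord e k q <= f q.
  move=> qK1; have D := dist_gt0 p23.
  have c3 : fcoord e k q * d p3 p2 = d q p2.
    rewrite fcoordE ek mulrAC.
    have pk : inc p2 (side e k) by rewrite -ej; apply/frameP.
    have ck : 0 < delta p3 (side e k) by rewrite -ek fcoord_denom_gt0.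
    by rewrite (delta_prop qK1 p3K1 p2K1 pk) mulrC mulKf // lt0r_neq0.
  have D3 : 0 < delta p3 K3 by apply: delta_gt0.
  rewrite -(ler_pM2r D) (dist_sym p2) -mulrA c3 -(ler_pM2r D3) -mulrA.
  rewrite (mulrC (d q p2)) -(delta_prop qK1 p3K1 p2K1 p2K3) mulrA.
  by rewrite (mulrAC (f q)) ler_wpM2r ?dist_ge0.
split=> // m p.
have [q [a [a0 qi cE tri1]]] := frame_project e i p.
rewrite sideE in qi.
have fq : a * f q <= f p.
  have [_ _] := tri1 f (norm_seminorm hf).
  by rewrite ei => -[//|h]; exact: le_trans (t1 p).
have [->|->|->] := H m; first by rewrite ei.
  rewrite cE // mulrCA (le_trans _ fq) // ler_wpM2l //.
  have qs : inc q (side e i) by rewrite sideE.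
  have [_ + _] := side_max_twice ij ik jk qs (norm_seminorm hf).
  by case=> // h; apply: le_trans h _; rewrite ek t3.
by rewrite cE // mulrCA (le_trans _ fq) // ler_wpM2l // ek t3.
Qed.

(** The expansion of [p] in [e] bounds [f p] from above and [g p] from below by
    terms with the same coefficients, so that the ratio of the norms is largest
    at a corner. *)
Lemma ratio_max f g e : norm f -> splits g e ->
  exists i, forall q, f q * g (e i) <= f (e i) * g q.
Proof.
move=> hf sg; have [i iP] := ord3_max (fun i => f (e i) / g (e i)).
have g0 p := splits_gt0 p sg; have f0 := norm_gt0 hf.
exists i => q; have [k h] := seminorm_expand e q (norm_seminorm hf).
have := iP k; rewrite ler_pdivrMr // mulrAC ler_pdivlMr // => hik.
rewrite -(ler_pM2r (g0 (e k))).
apply: (@le_trans _ _ (f (e i) * (g (e k) * fcoord e k q) * g (e k))).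
  apply: (@le_trans _ _ (f (e k) * fcoord e k q * g (e i) * g (e k))).
    by rewrite !ler_wpM2r // ltW.
  rewrite ler_wpM2r ?(ltW (g0 _)) // mulrAC mulrA.
  by rewrite ler_wpM2r ?fcoord_ge0.
by rewrite ler_wpM2r ?(ltW (g0 _)) // ler_wpM2l ?(ltW (f0 _)) // splits_term.
Qed.

(** A point [p1] where the ratio of the norms is largest has an orthogonal
    complement for one of them, which is then orthogonal for the other as well;
    by projection the smallest ratio is attained on that line, at a point [p3]
    to which the same reasoning applies. *)
Lemma common_frame f g e e' : splits f e -> splits g e' ->
  exists e'', splits f e'' /\ splits g e''.
Proof.
move=> sf sg; have hf := splits_norm sf; have hg := splits_norm sg.
have f0 := norm_gt0 hf; have g0 := norm_gt0 hg.
have [i1 mx] := ratio_max hf sg; set p1 := e' i1 in mx.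
have [i3 mn] := ratio_max hg sf; set p0 := e i3 in mn.
have [K1 p1K1 o1] := splits_orth p1 sf.
have o1' := orth_transfer hf hg mx o1.
have [c|c] := leP (f p1 * g p0) (f p0 * g p1).
  (* then the largest and the smallest ratio agree *)
  exists e'; split=> //.
  have k0 : 0 < f p0 / g p0 by rewrite divr_gt0.
  suff -> : f = (fun q => f p0 / g p0 * g q) by apply: splitsZ.
  apply/funext => q; apply/eqP; rewrite eq_le; apply/andP; split.
    rewrite mulrAC ler_pdivlMr // -(ler_pM2r (g0 p1)) mulrAC.
    apply: (@le_trans _ _ (f p1 * g q * g p0));
      first by rewrite ler_wpM2r // ltW.
    by rewrite mulrAC [leRHS]mulrAC ler_wpM2r // ltW.
  by rewrite mulrAC ler_pdivrMr // mulrC [leRHS]mulrC.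
have p01 : p0 <> p1 by move=> E; move: c; rewrite E ltxx.
have [K [p0K p1K]] := line_through hG p0 p1.
have [p3 [p3K p3K1]] := meet_point hG K K1.
have p13 : p1 <> p3 by move=> E; apply: p1K1; rewrite E.
have D := dist_gt0 p13.
have oK h : orth h p1 K1 -> h p1 * d p0 p3 <= h p0 * d p1 p3.
  move=> /(_ p0); have d0 : 0 < delta p1 K1 by apply: delta_gt0.
  move=> le0; rewrite -(ler_pM2r d0).
  rewrite -mulrA (mulrC (d p0 p3)) -(delta_prop p0K p1K p3K p3K1) mulrA.
  by rewrite [leRHS]mulrAC ler_wpM2r ?dist_ge0.
have mn3 q : g q * f p3 <= g p3 * f q.
  have tf := seminorm_max_twice (norm_seminorm hf) p1K p3K p0K.
  have tg := seminorm_max_twice (norm_seminorm hg) p1K p3K p0K.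
  rewrite !(dist_sym p3 p0) in tf tg.
  have e1 : f p3 * d p1 p0 <= f p0 * d p1 p3.
    by have [_ _ [//|h]] := tf; apply: le_trans h _; exact: oK.
  have e2 : g p0 * d p1 p3 <= g p3 * d p1 p0.
    have [[h|//] _ _] := tg; exfalso.
    have h' := oK f o1; move: c; rewrite ltNge => /negP; apply.
    rewrite -(ler_pM2r D) -mulrA.
    apply: (@le_trans _ _ (f p1 * (g p1 * d p0 p3))).
      by rewrite ler_wpM2l // ltW.
    by rewrite mulrCA [leRHS]mulrAC [leRHS]mulrC ler_wpM2l // ltW.
  have e3 : g p0 * f p3 <= g p3 * f p0.
    have D' : 0 < d p1 p0 by apply: dist_gt0; exact: nesym.
    rewrite -(ler_pM2r D) -(ler_pM2r D').
    have := ler_pM (mulr_ge0 (ltW (g0 p0)) (dist_ge0 _ _))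
      (mulr_ge0 (ltW (f0 p3)) (dist_ge0 _ _)) e2 e1.
    congr (_ <= _); ring.
  rewrite -(ler_pM2l (f0 p0)) -(ler_pM2l (g0 p0)).
  have := ler_pM (mulr_ge0 (ltW (g0 q)) (ltW (f0 p0)))
      (mulr_ge0 (ltW (g0 p0)) (ltW (f0 p3))) (mn q) e3.
  congr (_ <= _); ring.
have [K3 p3K3 o3] := splits_orth p3 sg.
have o3' := orth_transfer hg hf mn3 o3.
have [e'' He] := orth_frame p1K1 p3K1 p3K3.
by exists e''; split; apply: He.
Qed.

(** With respect to [e], the corners of [e'] have triangular coordinates, and
    deep in the sector pointing towards the corner [a] and the side [c] the
    off-diagonal terms are negligible. *)
Lemma sector_splits e e' a b c : a != b -> a != c -> b != c ->
  e' a = e a -> side e' c = side e c ->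
  exists2 C, 0 < C & forall f, splits f e ->
    C * f (e a) <= f (e b) -> C * f (e b) <= f (e c) -> splits f e'.
Proof.
move=> ab ac bc ea sc.
have [ba [ca cb]] : b != a /\ c != a /\ c != b by rewrite !(eq_sym _ a) (eq_sym
  c).
have abcP m : [\/ m = a, m = b | m = c].
  have [l [al bl lP]] := ord3_other ab.
  have E : c = l by have [E|E|//] := lP c; rewrite E eqxx in ca cb.
  by rewrite E.
pose F (x : 'I_3 * 'I_3 * 'I_3) :=
  fcoord e x.1.1 (e' x.1.2) * fcoord e' x.1.2 (e x.2).
pose C := 1 + \sum_x F x.
have F0 x : 0 <= F x by rewrite mulr_ge0 ?fcoord_ge0.
have S0 : 0 <= \sum_x F x by apply: sumr_ge0.
have FC i j k : fcoord e i (e' j) * fcoord e' j (e k) <= C.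
  rewrite -[X in X <= _]/(F (i, j, k)) /C (bigD1 (i, j, k)) //=.
  by rewrite addrCA lerDl addr_ge0 ?ler01 // sumr_ge0.
have C1 : 1 <= C by rewrite lerDl.
exists C; first exact: lt_le_trans C1.
move=> f sf lab lbc; apply: (splits_criterion sf) => j k.
have f0 p := ltW (splits_gt0 p sf).
have [i ->] := splits_attained (e' j) sf.
have small x y : C * f (e x) <= f (e y) ->
    f (e x) * fcoord e x (e' j) * fcoord e' j (e y) <= f (e y).
  move=> h; apply: le_trans h; rewrite -mulrA mulrC ler_wpM2r //.
have zero1 x y : fcoord e x (e' j) = 0 ->
    f (e x) * fcoord e x (e' j) * fcoord e' j (e y) <= f (e y).
  by move=> ->; rewrite mulr0 mul0r.
have zero2 x y : fcoord e' j (e y) = 0 ->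
    f (e x) * fcoord e x (e' j) * fcoord e' j (e y) <= f (e y).
  by move=> ->; rewrite mulr0.
have diag x : fcoord e' j (e x) * fcoord e x (e' j) <= 1 ->
    f (e x) * fcoord e x (e' j) * fcoord e' j (e x) <= f (e x).
  by move=> h; rewrite -mulrA mulrC -[leRHS]mul1r ler_wpM2r // mulrC.
have lac : C * f (e a) <= f (e c).
  apply: le_trans lbc; apply: le_trans lab _.
  by rewrite -[leLHS]mul1r ler_wpM2r.
have cs x : x != c -> fcoord e' c (e x) = 0.
  by move=> xc; apply/fcoord_eq0; rewrite sc; apply/frameP.
have cs' x : x != c -> fcoord e c (e' x) = 0.
  by move=> xc; apply/fcoord_eq0; rewrite -sc; apply/frameP.
have [Ej|Ej|Ej] := abcP j; subst j.
- have [Ei|Ei|Ei] := abcP i; subst i.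
  + have [Ek|Ek|Ek] := abcP k; subst k; try exact: small.
    by apply: diag; rewrite -ea fcoordii ea fcoordii mulr1.
  + by apply: zero1; rewrite ea fcoordij.
  + by apply: zero1; rewrite ea fcoordij.
- have [Ek|Ek|Ek] := abcP k; subst k.
  + by apply: zero2; rewrite -ea fcoordij.
  + have [Ei|Ei|Ei] := abcP i; subst i; first exact: small.
      apply: diag.
      have [|[l lb]] := seminorm_expand_term e (e' b) b (fcoord_seminorm e' b).
        by rewrite fcoordii.
      have [El|El|El] := abcP l; subst l; last 1 first.
      * by rewrite cs' // mulr0 => /le_trans; apply; exact: ler01.
      * by rewrite -ea fcoordij // mul0r => /le_trans; apply; exact: ler01.
      * by rewrite eqxx in lb.
    exact/zero1/cs'.
  + have [Ei|Ei|Ei] := abcP i; subst i; try exact: small.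
    exact/zero1/cs'.
- have [Ek|Ek|Ek] := abcP k; subst k; try exact/zero2/cs.
  have [Ei|Ei|Ei] := abcP i; subst i; try exact: small.
  apply: diag.
  have [|[l lc]] := seminorm_expand_term e (e' c) c (fcoord_seminorm e' c).
    by rewrite fcoordii.
  by rewrite (cs l) // mul0r => /le_trans; apply; exact: ler01.
Qed.

End TwoNorms.

(** * Frames adapted to a flag of the residual plane *)

Section Cells.
Variables (R : realType) (G : gauged_plane R).
Notation P := (points G).
Notation L := (lines G).
Implicit Types (p q r s : P) (K M : L) (f g : P -> R) (e : frame G).

(** The points whose last residually nonzero coordinate is the [i]-th one. These
    are the Schubert cells of the residual plane of [f], for the flag given by
    the order of the corners of [e]. *)
Definition cell e f i p : Prop :=
  f p = f (e i) * fcoord e i p /\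
  forall j : 'I_3, (i < j)%N -> f (e j) * fcoord e j p < f p.

Lemma cell_exists e f p : splits f e -> exists i, cell e f i p.
Proof.
move=> sf; have [i0 /eqP h0] := splits_attained p sf.
have [i /eqP hi H] := @arg_maxnP _ i0
  (fun i => f p == f (e i) * fcoord e i p) (fun i => val i) h0.
exists i; split=> // j ij; rewrite lt_neqAle splits_term // andbT eq_sym.
by apply: contraTN ij => /H; rewrite -leqNgt.
Qed.

Lemma cell_corner e f i : splits f e -> cell e f i (e i).
Proof.
move=> sf; split; first by rewrite fcoordii mulr1.
move=> j ij; rewrite fcoordij ?mulr0 ?(splits_gt0 _ sf) //.
by apply: contraTneq ij => ->; rewrite ltnn.
Qed.

Lemma cell_off e f i p : splits f e -> cell e f i p -> ~ inc p (side e i).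
Proof.
move=> sf [E _] /fcoord_eq0 c0.
by have := splits_gt0 p sf; rewrite E c0 mulr0 ltxx.
Qed.

(** The term of the exchanged corner [k] does not change. Another term [j]
    changes at most by the contribution of the new corner, which is bounded by
    the term [k], strictly if [j] is larger than [k]. *)
Lemma cell_exchange_sub e e' f k : splits f e -> exchanged e e' k ->
  cell e f k (e' k) -> forall i q, cell e f i q -> cell e' f i q.
Proof.
move=> sf ee' [Ek lk] i q [Ei li].
have sf' : splits f e' by apply: exchange_splits sf ee' Ek.
have f0 p := splits_gt0 p sf.
have tk : f (e' k) * fcoord e' k q = f (e k) * fcoord e k q.
  by rewrite Ek (exchanged_fcoord q ee') mulrA mulrAC.
pose X j := f (e j) * fcoord e j (e' k) * fcoord e' k q.
have X1 j : X j <= f (e k) * fcoord e k q.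
  by rewrite -tk ler_wpM2r ?fcoord_ge0 ?splits_term.
have X2 (j : 'I_3) : (k < j)%N -> X j < f q.
  move=> kj; have := fcoord_ge0 e' k q; rewrite le_eqVlt => /predU1P[c0|c0].
    by rewrite /X -c0 mulr0.
  apply: lt_le_trans (splits_term k q sf).
  by rewrite -tk ltr_pM2r ?lk.
have sub1 j : j != k -> f (e' j) * fcoord e' j q <= f (e j) * fcoord e j q \/
    f (e' j) * fcoord e' j q <= X j.
  move=> jk; have ej := ee' j jk.
  have [|[l lj]] := seminorm_expand_term e' q j (fcoord_seminorm e j).
    by rewrite ej fcoordii mul1r => h; left; rewrite ler_wpM2l // ltW.
  rewrite ej fcoordii mul1r; have [->|lk'] := eqVneq l k.
    by move=> h; right; rewrite /X -mulrA ler_wpM2l // ltW.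
  rewrite (ee' l lk') (fcoordij e) // mul0r => h; left.
  by rewrite ler_wpM2l ?(ltW (f0 _)) // (le_trans h) ?fcoord_ge0.
have sub2 j : j != k -> f (e j) * fcoord e j q <= f (e' j) * fcoord e' j q \/
    f (e j) * fcoord e j q <= X j.
  move=> jk; have ej := ee' j jk; rewrite ej.
  have [l] := seminorm_expand e' q (fcoord_seminorm e j).
  have [->|lk'] := eqVneq l k.
    by move=> h; right; rewrite /X -mulrA ler_wpM2l // ltW.
  rewrite (ee' l lk'); have [->|lj] := eqVneq l j.
    by rewrite fcoordii mul1r => h; left; rewrite ler_wpM2l // ltW.
  rewrite (fcoordij e) // mul0r => h; left.
  by rewrite ler_wpM2l ?(ltW (f0 _)) // (le_trans h) ?fcoord_ge0.
split=> [|j ij].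
  have [ik|ik] := eqVneq i k; last first.
    apply/eqP; rewrite eq_le splits_term // andbT.
    have [|] := sub2 i ik; first by rewrite -Ei.
    rewrite -Ei => h; exfalso.
    have [ki|ki|/val_inj ki] := ltngtP k i; last by rewrite ki eqxx in ik.
    - by have := X2 i ki; rewrite ltNge h.
    - by have := le_lt_trans (le_trans h (X1 i)) (li k ki); rewrite ltxx.
  by rewrite ik tk -ik.
have [jk|jk] := eqVneq j k; first by rewrite jk tk -jk li.
have [h|h] := sub1 j jk; first exact: le_lt_trans h (li _ ij).
apply: (le_lt_trans h).
have [kj|jk'|/val_inj kj] := ltngtP k j; last by rewrite kj eqxx in jk.
- exact: X2.
- by apply: le_lt_trans (X1 j) (li _ _); exact: ltn_trans ij jk'.
Qed.

Lemma cell_exchange e e' f k : splits f e -> exchanged e e' k ->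
  cell e f k (e' k) -> forall i q, cell e' f i q <-> cell e f i q.
Proof.
move=> sf ee' ck i q; have sub := cell_exchange_sub sf ee' ck.
split; last exact: sub.
have sf' : splits f e' by have [Ek _] := ck; apply: exchange_splits sf ee' Ek.
have ee : exchanged e' e k by move=> j jk; rewrite (ee' j jk).
exact: cell_exchange_sub sf' ee (sub _ _ (cell_corner k sf)) i q.
Qed.

(** Any choice of a point in each cell is residually a triangular change of
    basis. *)
Lemma cell_frame e f (x : 'I_3 -> P) : splits f e ->
  (forall i, cell e f i (x i)) ->
  exists e', [/\ corner e' =1 x, splits f e' &
                forall i q, cell e' f i q <-> cell e f i q].
Proof.
move=> sf cx.
have step e1 k : splits f e1 -> (forall i q, cell e1 f i q <-> cell e f i q) ->
    exists e2, [/\ exchanged e1 e2 k, e2 k = x k, splits f e2 &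
                  forall i q, cell e2 f i q <-> cell e f i q].
  move=> sf1 c1; have ck : cell e1 f k (x k) by apply/c1.
  have [e2 ex2 e2k] := exchange (cell_off sf1 ck).
  rewrite -e2k in ck; have [Ek _] := ck.
  exists e2; split=> // [|i q]; first exact: exchange_splits sf1 ex2 Ek.
  by rewrite (cell_exchange sf1 ex2 ck).
have [j [k [ij ik jk H]]] := ord3_third (ord0 : 'I_3).
set i : 'I_3 := ord0 in ij ik H.
have [e1 [ex1 e1i sf1 c1]] := step e i sf (fun _ _ => iff_refl _).
have [e2 [ex2 e2j sf2 c2]] := step e1 j sf1 c1.
have [e3 [ex3 e3k sf3 c3]] := step e2 k sf2 c2.
exists e3; split=> // m; have [->|->|->] := H m => //.
  by rewrite ex3 // ex2.
by rewrite ex3.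
Qed.

(** Projecting [p] from the corner [k] removes a component that is residually
    zero, so that the leading terms with respect to [e] survive; [f] does not
    increase, because its value dominates each of its terms. *)
Lemma cell_truncate e e' f g i p k :
  splits g e -> splits f e' -> splits g e' -> cell e g i p ->
  exists q, [/\ cell e g i q, f q * g p <= f p * g q,
    fcoord e' k q = 0 \/ g q = g (e' k) * fcoord e' k q &
    forall j, fcoord e' j p = 0 \/ g p = g (e' j) * fcoord e' j p ->
      fcoord e' j q = 0 \/ g q = g (e' j) * fcoord e' j q].
Proof.
move=> sg sf' sg' [Ei li]; have g0 p := splits_gt0 p sg.
have f0 p := splits_gt0 p sf'.
have := splits_term k p sg'; rewrite le_eqVlt => /predU1P[E|lt_k].
  by exists p; split=> //; right.
have [q [a [a0 qk cE T]]] := frame_project e' k p.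
have gE : g p = a * g q.
  have [h1 _ h3] := T g (norm_seminorm (splits_norm sg)).
  apply/eqP; rewrite eq_le; apply/andP; split.
    by case: h1 => // h; move: lt_k; rewrite ltNge h.
  by case: h3 => // h; apply: le_trans h (ltW lt_k).
have a_gt0 : 0 < a.
  rewrite lt_neqAle a0 andbT eq_sym; apply/eqP => a00.
  by have := g0 p; rewrite gE a00 mul0r ltxx.
have fE : a * f q <= f p.
  have [_ _ [//|h]] := T f (norm_seminorm (splits_norm sf')).
  by apply: le_trans h _; exact: splits_term.
have qk0 : fcoord e' k q = 0 by apply/fcoord_eq0.
have mid j : g (e j) * (fcoord e j (e' k) * fcoord e' k p) < g p.
  apply: le_lt_trans lt_k; rewrite mulrA ler_wpM2r ?fcoord_ge0 //.
  exact: splits_term.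
exists q; split.
- split=> [|j ij].
    apply/eqP; rewrite eq_le splits_term // andbT -(ler_pM2l a_gt0) -gE Ei.
    have [[h|h] _ _] := T _ (fcoord_seminorm e i).
      by have := mid i; rewrite Ei ltr_pM2l // ltNge h.
    by rewrite mulrCA ler_wpM2l // ltW.
  rewrite -(ltr_pM2l a_gt0) -gE mulrCA.
  have [_ _ [h|h]] := T _ (fcoord_seminorm e j).
    by apply: le_lt_trans (li _ ij); rewrite ler_wpM2l // ltW.
  by apply: le_lt_trans (mid j); rewrite ler_wpM2l // ltW.
- by rewrite gE mulrA (mulrC (f q)) ler_wpM2r // ltW.
- by left.
move=> j; have [->|jk] := eqVneq j k; first by left.
rewrite gE cE // => -[/eqP|E].
  by rewrite mulf_eq0 (negbTE (lt0r_neq0 a_gt0)) => /eqP; left.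
by right; apply: (mulfI (lt0r_neq0 a_gt0)); rewrite E mulrCA.
Qed.

Lemma cell_min e e' f g i : splits g e -> splits f e' -> splits g e' ->
  exists2 p, cell e g i p & forall q, cell e g i q -> f p * g q <= f q * g p.
Proof.
move=> sg sf' sg'; have g0 p := splits_gt0 p sg.
pose good j := `[< exists2 p, cell e g i p & f p * g (e' j) = f (e' j) * g p >].
have trunc q : cell e g i q -> exists p j,
    [/\ cell e g i p, f p * g q <= f q * g p & f p * g (e' j) = f (e' j) * g p].
  move=> cq; have [j [k [_ _ _ H]]] := ord3_third (ord0 : 'I_3).
  have [q1 [c1 l1 t1 _]] := cell_truncate ord0 sg sf' sg' cq.
  have [q2 [c2 l2 t2 T2]] := cell_truncate j sg sf' sg' c1.
  have [q3 [c3 l3 t3 T3]] := cell_truncate k sg sf' sg' c2.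
  have trans x y z : f y * g x <= f x * g y -> f z * g y <= f y * g z ->
      f z * g x <= f x * g z.
    move=> xy yz; rewrite -(ler_pM2r (g0 y)) mulrAC.
    apply: (@le_trans _ _ (f y * g z * g x)); first by rewrite ler_wpM2r // ltW.
    by rewrite mulrAC [leRHS]mulrAC ler_wpM2r // ltW.
  have all3 m : fcoord e' m q3 = 0 \/ g q3 = g (e' m) * fcoord e' m q3.
    by have [->|->|->] := H m; auto.
  have [m Em] := splits_attained q3 sf'.
  exists q3, m; split=> //; first exact: trans (trans _ _ _ l1 l2) l3.
  have [c0|E] := all3 m.
    by have := splits_gt0 q3 sf'; rewrite Em c0 mulr0 ltxx.
  by rewrite Em E; ring.
have [p0 [j0 [cp0 _ E0]]] := trunc _ (cell_corner i sg).
have g_j0 : good j0 by apply/asboolP; exists p0.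
have [j /asboolP[p cp Ep] H] := arg_minP (fun j => f (e' j) / g (e' j)) g_j0.
exists p => // q /trunc[r [k [cr lr Er]]].
have gk : good k by apply/asboolP; exists r.
have fE x m : f x * g (e' m) = f (e' m) * g x ->
  f (e' m) / g (e' m) = f x / g x.
  by move=> E; apply/eqP; rewrite eqr_div ?lt0r_neq0 // E.
have := H k gk; rewrite (fE _ _ Ep) (fE _ _ Er) ler_pdivrMr // mulrAC.
rewrite ler_pdivlMr // => le_pr.
rewrite -(ler_pM2r (g0 r)) mulrAC.
apply: (@le_trans _ _ (f r * g p * g q)); first by rewrite ler_wpM2r // ltW.
by rewrite mulrAC [leRHS]mulrAC ler_wpM2r // ltW.
Qed.

(** The corners are points where the minima of [f / g] over the cells are
    attained. If their frame did not split [f] at a point [q], then after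
    removing from [q] the terms of [f] that are not maximal, [f q] would be
    smaller than the remaining ones, one of which is residually the leading term
    of [q]; the ratio at [q] would be smaller than its minimum on the cell of
    [q]. *)
Lemma adapted_frame e f g : splits g e -> (exists e', splits f e') ->
  exists e', [/\ splits f e', splits g e', forall i, cell e g i (e' i) &
    forall i q, cell e g i q -> f (e' i) * g q <= f q * g (e' i)].
Proof.
move=> sg [e0 sf0]; have [e1 [sf1 sg1]] := common_frame sf0 sg.
have /choice[x xP] i : exists p, cell e g i p /\
    forall q, cell e g i q -> f p * g q <= f q * g p.
  by have [p cp H] := cell_min i sg sf1 sg1; exists p.
have [e' [ex sg' cE]] := cell_frame sg (fun i => (xP i).1).
have mn i q : cell e' g i q -> f (e' i) * g q <= f q * g (e' i).
  by move=> /cE; rewrite ex; exact: (xP i).2.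
exists e'; split=> // [|i|i q]; last 2 first.
- by rewrite ex; exact: (xP i).1.
- by move=> cq; apply: mn; apply/cE.
have hf := splits_norm sf0; have f0 := norm_gt0 hf;
  have g0 p := splits_gt0 p sg.
split=> // i q; rewrite leNgt; apply/negP.
pose t m := f (e' m) * fcoord e' m q; rewrite -/(t i) => lti.
have [m mP] := ord3_max t.
have ltm : f q < t m by apply: lt_le_trans lti (mP i).
have lead j r : cell e' g j r -> f (e' j) * fcoord e' j r <= f r.
  move=> cj; have [Ej _] := cj; have := mn _ _ cj.
  by rewrite Ej mulrCA [leRHS]mulrC ler_pM2l.
have [|[j jm]] := seminorm_expand_term e' q m (norm_seminorm hf).
  by rewrite leNgt ltm.
rewrite -/(t m) -/(t j) => tmj.
have tj : t j = t m by apply/eqP; rewrite eq_le mP tmj.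
have [k [jk mk kP]] := ord3_other jm.
have := mP k; rewrite le_eqVlt => /predU1P[tk|tk].
  have [l cl] := cell_exists q sg'.
  have := lead l q cl; rewrite -/(t l) leNgt => /negP; apply.
  by have [->|->|->] := kP l; rewrite ?tk ?tj.
have [r [a [a0 rk cEr T]]] := frame_project e' k q.
have frE : a * f r < t m.
  have [_ _ [h|h]] := T f (norm_seminorm hf); first exact: le_lt_trans h ltm.
  exact: le_lt_trans h tk.
have [l cl] := cell_exists r sg'.
have lk : l != k.
  by apply/eqP => lk; apply: (cell_off sg' cl); rewrite lk.
have tl : t l = t m by have [->|->|E] := kP l => //; rewrite E eqxx in lk.
have := ler_wpM2l a0 (lead l r cl).
by rewrite mulrCA -cEr // -/(t l) tl leNgt frE.
Qed.

End Cells.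

(** * The model apartment of type A2 *)

Section Apartment.
Variable R : realType.
Notation plane := 'cV[R]_2.
Implicit Types (x y v : plane) (i j k : 'I_3).

Lemma cos_third : cos (pi / 3) = 2^-1 :> R.
Proof.
have pi0 := pi_gt0 R.
have c0 : 0 < cos (pi / 3 : R) by apply: cos_gt0_pihalf; apply/andP; split; lra.
have : cos (pi / 3 + (pi / 3 + pi / 3)) = -1 :> R.
  by rewrite (_ : _ + _ = pi) ?cospi //; field.
rewrite cosD cosD sinD; have := cos2Dsin2 (pi / 3 : R).
move: (cos _) (sin _) c0 => c s c0 cs H.
have {}H : (c + 1) * (2 * c - 1) ^+ 2 = 0.
  have s2 : s ^+ 2 = 1 - c ^+ 2 by rewrite -cs; ring.
  transitivity (c * (c * c - s * s) - s * (s * c + c * s) + 1); last first.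
    by rewrite H; ring.
  transitivity (4 * c ^+ 3 - 3 * c + 1); first by ring.
  transitivity (c ^+ 3 - 3 * c * s ^+ 2 + 1); last by ring.
  by rewrite s2; ring.
move/eqP: H; rewrite mulf_eq0 expf_eq0 /= => /orP[/eqP H|/eqP H]; first lra.
by apply: (mulfI (_ : 2 != 0)) => //; rewrite divff //; lra.
Qed.

Definition half_sqrt3 : R := Num.sqrt 3 / 2.

Lemma half_sqrt3_sqr : half_sqrt3 ^+ 2 = 3 / 4.
Proof. by rewrite exprMn sqr_sqrtr // exprVn; field. Qed.

Lemma sin_third : sin (pi / 3) = half_sqrt3.
Proof.
have pi0 := pi_gt0 R.
have s0 : 0 < sin (pi / 3 : R) by apply: sin_gt0_pihalf; apply/andP; split; lra.
have h0 : 0 <= half_sqrt3 by rewrite divr_ge0 ?sqrtr_ge0.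
apply/eqP; rewrite -(eqrXn2 (n := 2)) // ?ltW // half_sqrt3_sqr.
by apply/eqP; have := cos2Dsin2 (pi / 3 : R); rewrite cos_third => H; lra.
Qed.

Definition dir_angle (n : nat) : R := 2 * n%:R * pi / 3%:R.

Lemma dir_angleD n : dir_angle (n + 3)%N = dir_angle n + pi *+ 2.
Proof. by rewrite /dir_angle natrD -mulr_natr; field. Qed.

(** The coordinates of the apartment: the scalar products with the unit vectors
    at the angles 0, 120 and 240 degrees. *)
Definition xi (n : nat) x : R := x 0 0 * cos (dir_angle n) + x 1 0 * sin
  (dir_angle n).

Lemma xi_mod n x : xi (n %% 3)%N x = xi n x.
Proof.
rewrite {2}(divn_eq n 3) addnC; elim: (n %/ 3)%N => [|m IH];
  first by rewrite addn0.
by rewrite mulSnr addnA /xi dir_angleD cosD2pi sinD2pi.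
Qed.

Lemma xi0 x : xi 0 x = x 0 0.
Proof. by rewrite /xi /dir_angle mulr0 !mul0r cos0 sin0; ring. Qed.

Lemma xi1 x : xi 1 x = - (2^-1) * x 0 0 + half_sqrt3 * x 1 0.
Proof.
rewrite /xi (_ : dir_angle 1 = pi / 3 + pi / 3); last by rewrite /dir_angle;
  field.
rewrite cosD sinD cos_third sin_third; have := half_sqrt3_sqr;
  rewrite expr2 => ->.
by field.
Qed.

Lemma xi2 x : xi 2 x = - (2^-1) * x 0 0 - half_sqrt3 * x 1 0.
Proof.
rewrite /xi (_ : dir_angle 2 = pi + pi / 3); last by rewrite /dir_angle; field.
by rewrite cosD sinD cospi sinpi cos_third sin_third; ring.
Qed.

Lemma xiD n x y : xi n (x + y) = xi n x + xi n y.
Proof. by rewrite /xi !mxE; ring. Qed.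

Lemma xiZ n a x : xi n (a *: x) = a * xi n x.
Proof. by rewrite /xi !mxE; ring. Qed.

Lemma xiN n x : xi n (- x) = - xi n x.
Proof. by rewrite /xi !mxE; ring. Qed.

Lemma xi_0 n : xi n 0 = 0.
Proof. by rewrite /xi !mxE; ring. Qed.

Lemma xi_cont n : continuous (xi n).
Proof.
move=> x; have c (m : 'I_2) : (fun y : plane => y m 0) @ x --> x m 0.
  exact: coord_continuous.
exact: (cvgD (cvgM (c 0) (cvg_cst _)) (cvgM (c 1) (cvg_cst _))).
Qed.

Lemma ord3P i : [\/ i = @Ordinal 3 0 isT, i = @Ordinal 3 1 isT | i = @Ordinal 3
  2 isT].
Proof.
by case: i => [[|[|[|//]]] h]; [apply: Or31|apply: Or32|apply: Or33];
  apply: val_inj.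
Qed.

Lemma sum_xi x i j k : i != j -> i != k -> j != k ->
  xi i x + xi j x + xi k x = 0.
Proof.
have [->|->|->] := ord3P i; have [->|->|->] := ord3P j;
have [->|->|->] := ord3P k => // _ _ _; by rewrite /= xi0 xi1 xi2; field.
Qed.

Lemma half_sqrt3_neq0 : half_sqrt3 != 0.
Proof. by apply/eqP => h; have := half_sqrt3_sqr; rewrite h expr0n /= => H;
  lra. Qed.

Lemma xi_inj x y : (forall i, xi i x = xi i y) -> x = y.
Proof.
move=> H; have h0 := H (@Ordinal 3 0 isT); have h1 := H (@Ordinal 3 1 isT).
rewrite /= !xi0 in h0; rewrite /= !xi1 h0 in h1.
have {}h1 : x 1 0 = y 1 0.
  by apply: (mulfI half_sqrt3_neq0); apply: (@addrI _ (- 2^-1 * y 0 0)).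
apply/matrixP => a b; rewrite !ord1.
by case: a => [[|[|//]]] p; [move: h0|move: h1]; congr (x _ _ = y _ _);
  apply: val_inj.
Qed.

Definition plane_vec (a b : R) : plane := \col_i (if i == 0 then a else b).

Lemma xi_surj (t : 'I_3 -> R) : exists x, forall i, xi i x = t i - (\sum_j t j)
  / 3.
Proof.
pose a := (t (@Ordinal 3 0 isT)); pose b := (t (@Ordinal 3 1 isT)).
pose c := (t (@Ordinal 3 2 isT)).
exists (plane_vec (a - (a + b + c) / 3) ((b - c) / (2 * half_sqrt3))) => i.
rewrite (@sum3 _ _ (@Ordinal 3 0 isT) (@Ordinal 3 1 isT) (@Ordinal 3 2 isT)) //.
have h := half_sqrt3_neq0.
by have [->|->|->] := ord3P i; rewrite /= ?xi0 ?xi1 ?xi2 !mxE /= -/a -/b -/c;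
  field.
Qed.

Lemma edistE x y : Defs.edist x y =
  Num.sqrt (2 / 3 * \sum_(i < 3) (xi i x - xi i y) ^+ 2).
Proof.
rewrite /Defs.edist; congr Num.sqrt.
rewrite (@sum3 _ _ (@Ordinal 3 0 isT) (@Ordinal 3 1 isT) (@Ordinal 3 2 isT)) //.
rewrite /= !xi0 !xi1 !xi2.
rewrite !big_ord_recl big_ord0 addr0.
rewrite (_ : lift ord0 ord0 = 1); last exact: val_inj.
set a := x _ _; set b := y _ _; set c := x _ _; set e := y _ _.
have h := half_sqrt3_sqr.
transitivity (2 / 3 * (3 / 2 * (a - b) ^+ 2 + 2 * (3 / 4) * (c - e) ^+ 2)).
  by field.
by rewrite -h; field.
Qed.

Lemma rotation_xi n (k : nat) x :
  xi n (rotation (2 * k%:R * pi / 3%:R) *m x) = xi (n + 2 * k)%N x.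
Proof.
rewrite -/(dir_angle k) /xi !mxE !big_ord_recl !big_ord0 !addr0 !mxE /=.
rewrite (_ : lift ord0 ord0 = 1); last exact: val_inj.
have -> : dir_angle (n + 2 * k)%N = (dir_angle n - dir_angle k) + (pi *+ 2) *+
  k.
  by rewrite /dir_angle natrD natrM -mulrnA -(mulr_natr pi) natrM; field.
rewrite (periodicn (@cosD2pi R)) (periodicn (@sinD2pi R)) cosB sinB.
by ring.
Qed.

Lemma reflection_xi n (k : nat) x :
  xi n (reflection (k%:R * pi / 3%:R) *m x) = xi (k + 2 * n)%N x.
Proof.
rewrite /xi !mxE !big_ord_recl !big_ord0 !addr0 !mxE /=.
rewrite (_ : lift ord0 ord0 = 1); last exact: val_inj.
have -> : 2 * (k%:R * pi / 3%:R) = dir_angle k by rewrite /dir_angle; field.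
have -> : dir_angle (k + 2 * n)%N = (dir_angle k - dir_angle n) + (pi *+ 2) *+
  n.
  by rewrite /dir_angle natrD natrM -mulrnA -(mulr_natr pi) natrM; field.
rewrite (periodicn (@cosD2pi R)) (periodicn (@sinD2pi R)) cosB sinB.
by ring.
Qed.

Lemma Wbar_perm (g : 'M[R]_2) : Wbar 3 g ->
  exists2 s : 'I_3 -> 'I_3, injective s &
    forall i x, xi i (g *m x) = xi (s i) x.
Proof.
have lt3 n : (n %% 3 < 3)%N by rewrite ltn_mod.
move=> [k [->|->]].
  exists (fun i => Ordinal (lt3 (i + 2 * k)%N)).
    move=> i j /(congr1 val) /= /eqP; rewrite eqn_modDr !modn_small // => /eqP.
    exact: val_inj.
  by move=> i x; rewrite rotation_xi -xi_mod.
exists (fun i => Ordinal (lt3 (k + 2 * i)%N)); last first.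
  by move=> i x; rewrite reflection_xi -xi_mod.
move=> i j /(congr1 val) /= /eqP; rewrite eqn_modDl.
by have [->|->|->] := ord3P i; have [->|->|->] := ord3P j.
Qed.

Lemma perm_Wbar (s : 'I_3 -> 'I_3) : injective s ->
  exists2 g : 'M[R]_2, Wbar 3 g & forall i x, xi i (g *m x) = xi (s i) x.
Proof.
move=> si; pose o0 := @Ordinal 3 0 isT; pose o1 := @Ordinal 3 1 isT.
pose o2 := @Ordinal 3 2 isT.
have n01 : s o0 != s o1 by apply/eqP => /si.
have n02 : s o0 != s o2 by apply/eqP => /si.
have n12 : s o1 != s o2 by apply/eqP => /si.
have [E|E] : (forall i, s i = (i + s o0) %% 3 :> nat)%N \/
             (forall i, s i = (s o0 + 2 * i) %% 3 :> nat)%N.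
  have [e0|e0|e0] := ord3P (s o0); have [e1|e1|e1] := ord3P (s o1);
  have [e2|e2|e2] := ord3P (s o2); rewrite e0 e1 e2 // in n01 n02 n12;
  by [left=> i; have [->|->|->] := ord3P i; rewrite ?e0 ?e1 ?e2
     |right=> i; have [->|->|->] := ord3P i; rewrite ?e0 ?e1 ?e2].
- exists (rotation (2 * (2 * s o0)%N%:R * pi / 3%:R)).
    by exists (2 * s o0)%N; left.
  move=> i x; rewrite rotation_xi -xi_mod (E i); congr (xi _ x).
  by rewrite mulnA (_ : 2 * 2 = 1 + 3)%N // mulnDl mul1n addnA addnC (mulnC
    3%N) modnMDl.
- exists (reflection ((s o0)%:R * pi / 3%:R)).
    by exists (s o0); right.
  by move=> i x; rewrite reflection_xi -xi_mod -E.
Qed.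

End Apartment.

(** * Sectors and their panels *)

Section Sectors.
Variable R : realType.
Notation plane := 'cV[R]_2.
Implicit Types (x y v : plane) (i j k : 'I_3).

Definition dir i : plane := unit_vector (dir_angle R i).

Lemma dir0 : dir (@Ordinal 3 0 isT) = unit_vector 0.
Proof. by rewrite /dir /dir_angle mulr0 !mul0r. Qed.

Lemma xi_dir i j : xi i (dir j) = if i == j then 1 else - 2^-1.
Proof.
have c1 : cos (dir_angle R 1) = - 2^-1.
  by have := xi1 (plane_vec 1 0 : plane); rewrite /xi !mxE /= => H; lra.
have s1 : sin (dir_angle R 1) = half_sqrt3 R.
  by have := xi1 (plane_vec 0 1 : plane); rewrite /xi !mxE /= => H; lra.
have c2 : cos (dir_angle R 2) = - 2^-1.
  by have := xi2 (plane_vec 1 0 : plane); rewrite /xi !mxE /= => H; lra.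
have s2 : sin (dir_angle R 2) = - half_sqrt3 R.
  by have := xi2 (plane_vec 0 1 : plane); rewrite /xi !mxE /= => H; lra.
have t0 : dir_angle R 0 = 0 by rewrite /dir_angle mulr0 !mul0r.
have h := half_sqrt3_sqr R; rewrite expr2 in h.
have [->|->|->] := ord3P i; have [->|->|->] := ord3P j;
  rewrite /= ?xi0 ?xi1 ?xi2 /dir !mxE /= ?t0 ?cos0 ?sin0 ?c1 ?s1 ?c2 ?s2;
  by lra.
Qed.

Lemma unit_vector_third : unit_vector (pi / 3%:R) = - dir (@Ordinal 3 2 isT).
Proof.
apply: xi_inj => i; rewrite xiN xi_dir.
have h := half_sqrt3_sqr R; rewrite expr2 in h.
by have [->|->|->] := ord3P i; rewrite /= ?xi0 ?xi1 ?xi2 !mxE /=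
  ?cos_third ?sin_third; lra.
Qed.

Lemma line_cont x v (t0 : R) : (fun t : R => x + t *: v) @ t0 --> x + t0 *: v.
Proof. apply: cvgD; [exact: cvg_cst|apply: cvgZr_tmp; exact: cvg_id]. Qed.

Definition cone i j k : set plane :=
  [set x | xi k x <= xi j x /\ xi j x <= xi i x].
Definition ocone i j k : set plane :=
  [set x | xi k x < xi j x /\ xi j x < xi i x].

Lemma xi_diff_cont i j : continuous (fun x => xi i x - xi j x).
Proof. by move=> x; exact: (cvgB (@xi_cont R i x) (@xi_cont R j x)). Qed.

Lemma ocone_open i j k : open (ocone i j k).
Proof.
rewrite (_ : ocone _ _ _ =
  (fun x => xi j x - xi k x) @^-1` [set r | 0 < r] `&`
  (fun x => xi i x - xi j x) @^-1` [set r | 0 < r]).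
  by apply: openI; apply: open_comp; [move=> x _;
    exact: xi_diff_cont|exact: open_gt
    |move=> x _; exact: xi_diff_cont|exact: open_gt].
by apply/seteqP; split=> x; rewrite /ocone /= !subr_gt0.
Qed.

Lemma cone_closed i j k : closed (cone i j k).
Proof.
rewrite (_ : cone _ _ _ =
  (fun x => xi j x - xi k x) @^-1` [set r | 0 <= r] `&`
  (fun x => xi i x - xi j x) @^-1` [set r | 0 <= r]).
  by apply: closedI; apply: closed_comp; [move=> x _; exact: xi_diff_cont
    |exact: closed_ge|move=> x _; exact: xi_diff_cont|exact: closed_ge].
by apply/seteqP; split=> x; rewrite /cone /= !subr_ge0.
Qed.

Lemma closure_ocone i j k v : ocone i j k v ->
  closure (ocone i j k) = cone i j k.
Proof.
move=> [v1 v2]; apply/seteqP; split.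
  rewrite [X in _ `<=` X](closure_id _).1; last exact: cone_closed.
  by apply: closureS => x [x1 x2]; split; exact: ltW.
move=> x [x1 x2] B Bx.
have := @line_cont x v 0; rewrite scale0r addr0 =>
  /(_ _ Bx) /nbhs_ballP[e /= e0 He].
exists (x + (e / 2) *: v); split.
  by split; rewrite !xiD !xiZ; apply: ler_ltD => //;
    rewrite ltr_pM2l // divr_gt0.
by apply: He; rewrite /ball /= sub0r normrN gtr0_norm ?divr_gt0 // gtr_pMr //
  invf_lt1 // ltr1n.
Qed.

Lemma interior_cone i j k : i != j -> i != k -> j != k ->
  interior (cone i j k) = ocone i j k.
Proof.
move=> ij ik jk; apply/seteqP; split; last first.
  move=> x ox; apply: (filterS _ (open_nbhs_nbhs (conj (@ocone_open i j k)
    ox))).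
  by move=> y [y1 y2]; split; exact: ltW.
have key (a b : 'I_3) x : a != b ->
    interior (cone i j k) x -> (forall y, cone i j k y -> xi a y <= xi b y) ->
    xi a x < xi b x.
  move=> ab Ix H.
  have := @line_cont x (dir a) 0; rewrite scale0r addr0 => /(_ _ Ix).
  move=> /nbhs_ballP[e /= e0 He].
  have /H : cone i j k (x + (e / 2) *: dir a).
    by apply: He; rewrite /ball /= sub0r normrN gtr0_norm ?divr_gt0 // gtr_pMr
      // invf_lt1 // ltr1n.
  rewrite !xiD !xiZ !xi_dir eqxx eq_sym (negbTE ab) => h.
  have e2 : 0 < e / 2 by rewrite divr_gt0.
  lra.
move=> x Ix; split; apply: key => //; rewrite 1?eq_sym //; by move=> y [].
Qed.

Lemma rotation_det a : \det (rotation a : 'M[R]_2) = 1.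
Proof.
rewrite (expand_det_row _ ord0) !big_ord_recl big_ord0 /cofactor !det_mx11 !mxE
  /=.
rewrite /bump /= addn0 expr0 expr1.
by transitivity (cos a ^+ 2 + sin a ^+ 2); [ring|exact: cos2Dsin2].
Qed.

Lemma reflection_det a : \det (reflection a : 'M[R]_2) = -1.
Proof.
rewrite (expand_det_row _ ord0) !big_ord_recl big_ord0 /cofactor !det_mx11 !mxE
  /=.
rewrite /bump /= addn0 expr0 expr1;
  transitivity (- (cos (2 * a) ^+ 2 + sin (2 * a) ^+ 2)).
  by ring.
by rewrite cos2Dsin2.
Qed.

Lemma reflection_orth a : reflection a *m (reflection a)^T = 1%:M :> 'M[R]_2.
Proof.
apply/matrixP => i j; rewrite !mxE !big_ord_recl big_ord0 !mxE /=.
have := cos2Dsin2 (2 * a).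
by case: i => [[|[|//]]] hi; case: j => [[|[|//]]] hj /=;
  rewrite ?mulr1n ?mulr0n => H; first [ring|rewrite -[RHS]H; ring].
Qed.

Lemma axesP x : (\bigcup_(H in axes 3) H) x <->
  exists i j, i != j /\ xi i x = xi j x.
Proof.
split=> [[H [g [[k [->|->]] _ dg ->]]] /= gx|[i [j [ij E]]]].
- by move: dg {gx}; rewrite rotation_det => h; lra.
- have xE n : xi (k + 2 * n)%N x = xi n x by rewrite -reflection_xi gx.
  have [k0|k0] := eqVneq (k %% 3)%N 0%N.
    exists (@Ordinal 3 2 isT), (@Ordinal 3 1 isT); split=> //=.
    by rewrite -(xE 1%N) -[RHS]xi_mod -modnDml k0.
  exists (Ordinal (ltn_mod k 3 : k %% 3 < 3)%N), (@Ordinal 3 0 isT);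
    split=> //=.
  by rewrite xi_mod -[RHS]xE muln0 addn0.
exists [set x | reflection ((i + j)%N%:R * pi / 3%:R) *m x = x].
  exists (reflection ((i + j)%N%:R * pi / 3%:R)); split=> //.
  - by exists (i + j)%N; right.
  - exact: reflection_orth.
  - exact: reflection_det.
apply: xi_inj => m; rewrite reflection_xi -xi_mod; move: ij E.
by have [->|->|->] := ord3P i; have [->|->|->] := ord3P j;
  have [->|->|->] := ord3P m => //= _ ->.
Qed.

Definition chambers : set plane := ~` (\bigcup_(H in axes 3) H).

Lemma ocone_chambers i j k x : i != j -> i != k -> j != k ->
  ocone i j k x -> chambers x.
Proof.
move=> ij ik jk [x1 x2] /axesP [a [b [ab E]]].
have [l [_ _ H]] := ord3_other ij.
have lk : k = l by have [E'|E'|//] := H k; rewrite E' eqxx in ik jk.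
by have [ea|ea|ea] := H a; have [eb|eb|eb] := H b; subst a b l;
  rewrite ?eqxx // in ab; lra.
Qed.

Lemma chambersP x : chambers x -> exists i j k,
  [/\ i != j, i != k, j != k & ocone i j k x].
Proof.
move=> Ux; have ne i j : i != j -> xi i x != xi j x.
  by move=> ij; apply/eqP => E; apply: Ux; apply/axesP; exists i, j.
pose a := @Ordinal 3 0 isT; pose b := @Ordinal 3 1 isT;
  pose c := @Ordinal 3 2 isT.
have ab := ne a b isT; have ac := ne a c isT; have bc := ne b c isT.
case: (ltgtP (xi a x) (xi b x)) ab => // h1 _;
case: (ltgtP (xi a x) (xi c x)) ac => // h2 _;
case: (ltgtP (xi b x) (xi c x)) bc => // h3 _;
by [exists c, b, a|exists c, a, b|exists b, c, a|exists b, a, c|exists a, b,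
  c|exists a, c, b|lra].
Qed.

Lemma component i j k x : i != j -> i != k -> j != k -> ocone i j k x ->
  connected_component chambers x = ocone i j k.
Proof.
move=> ij ik jk ox; apply/seteqP; split=> [y [C [Cx CU cC] Cy]|y oy].
  have sep (a b : 'I_3) : a != b -> xi a x < xi b x -> xi a y < xi b y.
    move=> ab xab; suff : C `&` [set z | xi a z < xi b z] = C.
      by move=> E; move: Cy; rewrite -E => -[].
    apply: cC; first by exists x.
      exists ((fun z => xi b z - xi a z) @^-1` [set r | 0 < r]).
        by apply: open_comp; [move=> z _; exact: xi_diff_cont|exact: open_gt].
      by apply/seteqP; split=> z /= [Cz]; rewrite subr_gt0.
    exists ((fun z => xi b z - xi a z) @^-1` [set r | 0 <= r]).
      by apply: closed_comp; [move=> z _; exact: xi_diff_cont|exact: closed_ge].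
    apply/seteqP; split=> z /= [Cz]; rewrite subr_ge0 => h; split=> //.
      exact: ltW.
    rewrite lt_neqAle h andbT; apply/eqP => E.
    by apply: (CU z Cz); apply/axesP; exists a, b.
  by case: ox => x1 x2; split; apply: sep; rewrite // eq_sym.
exists ((fun t : R => x + t *: (y - x)) @` `[0, 1]); last first.
  by exists 1; rewrite /= ?in_itv /= ?lexx ?ler01 // scale1r addrC subrK.
split.
- by exists 0; rewrite /= ?in_itv /= ?lexx ?ler01 // scale0r addr0.
- move=> z [t /=]; rewrite in_itv /= => /andP[t0 t1] <-.
  apply: (ocone_chambers ij ik jk).
  have conv (a b c e : R) : a < b -> c < e -> a + t * (c - a) < b + t * (e - b).
    move=> ab ce; have : 0 <= (1 - t) * (b - a) by apply: mulr_ge0; lra.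
    have : 0 <= t * (e - c) by apply: mulr_ge0; lra.
    have [->|tn] := eqVneq t 0; first by move=> *; lra.
    have : 0 < t * (e - c) by apply: mulr_gt0;
      [rewrite lt_neqAle eq_sym tn t0|lra].
    by lra.
  by case: ox => x1 x2; case: oy => y1 y2; split;
    rewrite !xiD !xiZ !xiD !xiN; apply: conv.
- apply: connected_continuous_connected; first exact: segment_connected.
  by apply: continuous_subspaceT => t; exact: line_cont.
Qed.

Lemma sectorP S : vector_sector 3 S <-> exists i j k,
  [/\ i != j, i != k, j != k & S = cone i j k].
Proof.
split=> [[x Ux ->]|[i [j [k [ij ik jk ->]]]]].
  have [i [j [k [ij ik jk ox]]]] := chambersP Ux.
  exists i, j, k; split=> //.
  by rewrite -/chambers (component ij ik jk ox) (closure_ocone ox).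
have [x xE] := @xi_surj R (fun m =>
  if m == k then -1 else if m == j then 0 else 1).
have ox : ocone i j k x.
  split; rewrite !xE eqxx ?(negbTE jk) ?eqxx ?(negbTE ij) ?(negbTE ik); lra.
exists x; first exact: ocone_chambers ox.
by rewrite -/chambers (component ij ik jk ox) (closure_ocone ox).
Qed.

Lemma boundingP e i j k : i != j -> i != k -> j != k ->
  bounding e (cone i j k) <->
  exists2 s, 0 < s & e = s *: dir i \/ e = s *: (- dir k).
Proof.
move=> ij ik jk; rewrite /bounding interior_cone //.
rewrite -(closure_id _).1; last exact: cone_closed.
have [l [_ _ H]] := ord3_other ij.
have {l} H m : [\/ m = i, m = j | m = k].
  by have [E|E|E] := H k; [rewrite E eqxx in ik|rewrite E eqxx in jk|rewrite E;
    exact: H].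
have sum x := sum_xi x ij ik jk.
split=> [[e0 he]|[s s0 E]].
  have [[h1 h2] ho] : (cone i j k `\` ocone i j k) e.
    by apply: he; exists 1; rewrite /= ?ler01 // scale1r.
  have se := sum e.
  have [E|E] : xi k e = xi j e \/ xi j e = xi i e.
    apply: contrapT => /not_orP[/eqP n1 /eqP n2]; apply: ho.
    by split; rewrite lt_neqAle ?n1 ?n2.
  - have ei : e = xi i e *: dir i.
      apply: xi_inj => m; rewrite xiZ xi_dir.
      have [->|->|->] := H m; first by rewrite eqxx mulr1.
        by rewrite eq_sym (negbTE ij); lra.
      by rewrite eq_sym (negbTE ik); lra.
    exists (xi i e); last by left.
    rewrite lt_neqAle; apply/andP; split; last lra.
    by rewrite eq_sym; apply/eqP => z; apply: e0; rewrite ei z scale0r.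
  - have ei : e = (- xi k e) *: (- dir k).
      apply: xi_inj => m; rewrite xiZ xiN xi_dir.
      have [->|->|->] := H m.
      + by rewrite (negbTE ik); lra.
      + by rewrite (negbTE jk); lra.
      + by rewrite eqxx; lra.
    exists (- xi k e); last by right.
    rewrite lt_neqAle; apply/andP; split; last lra.
    by rewrite eq_sym; apply/eqP => z; apply: e0; rewrite ei z scale0r.
split.
  move=> e0; case: E => E; [have := xi_dir i i|have := xi_dir k k];
  rewrite eqxx => h; [have := xiZ i s (dir i)|have := xiZ k s (- dir k)];
  by rewrite -E e0 xi_0 ?xiN h => h'; lra.
move=> z [t /= t0 <-].
have st : 0 <= t * s by rewrite mulr_ge0 // ltW.
case: E => ->; rewrite scalerA; split.
- by split; rewrite !xiZ !xi_dir ?eqxx !(eq_sym _ i) ?(negbTE ij) ?(negbTE ik);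
  lra.
- by case; rewrite !xiZ !xi_dir !(eq_sym _ i) (negbTE ij) (negbTE ik) ltxx.
- by split; rewrite !xiZ !xiN !xi_dir ?eqxx ?(negbTE jk) ?(negbTE ik); lra.
- by case=> _; rewrite !xiZ !xiN !xi_dir (negbTE jk) (negbTE ik) ltxx.
Qed.

Definition panel_dir (b : bool) i : plane := if b then - dir i else dir i.

Lemma Wbar_dir (g : 'M[R]_2) i : Wbar 3 g -> exists j, g *m dir i = dir j.
Proof.
move=> /Wbar_perm[s si gE].
have [s' s's ss'] := injF_bij si.
exists (s' i); apply: xi_inj => m; rewrite gE !xi_dir.
by rewrite -[m == _](inj_eq si) ss'.
Qed.

Lemma dir_transitive i j : exists2 g : 'M[R]_2, Wbar 3 g & g *m dir i = dir j.
Proof.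
pose s := fun m : 'I_3 => if m == j then i else if m == i then j else m.
have [|g Wg gE] := @perm_Wbar R s.
  move=> x y; rewrite /s.
  have [->|xj] := eqVneq x j; have [->|yj] := eqVneq y j => //.
  - by have [->|yi] := eqVneq y i => E; [rewrite E|rewrite -E eqxx in yi].
  - by have [->|xi] := eqVneq x i => E; [rewrite E|rewrite E eqxx in xi].
  have [->|xi] := eqVneq x i; have [->|yi] := eqVneq y i => // E.
    by rewrite E eqxx in yj.
  by rewrite E eqxx in xj.
exists g => //; apply: xi_inj => m; rewrite gE !xi_dir /s.
have [mj|mj] := eqVneq m j; first by rewrite eqxx.
have [mi|mi] := eqVneq m i; last by rewrite (negbTE mi).
by case: eqVneq => // ji; rewrite mi ji eqxx in mj.
Qed.

Lemma direction_typeP b e : direction_type 3 b e <->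
  exists s i, 0 < s /\ e = s *: panel_dir b i.
Proof.
pose o0 := @Ordinal 3 0 isT; pose o2 := @Ordinal 3 2 isT.
have base : unit_vector (if b then pi / 3%:R else 0) = panel_dir b (if b then
  o2 else o0).
  by case: b; rewrite /= ?unit_vector_third ?dir0.
have gt (g : 'M[R]_2) i : g *m panel_dir b i = if b then - (g *m dir i) else g
  *m dir i.
  by case: (b); rewrite /= ?mulmxN.
split=> [[g [s [Wg s0 ->]]]|[s [i [s0 ->]]]].
  rewrite base gt; have [j ->] := Wbar_dir (if b then o2 else o0) Wg.
  by exists s, j; split=> //; case: (b).
have [g Wg gE] := dir_transitive (if b then o2 else o0) i.
exists g, s; split=> //; rewrite base gt gE.
by case: (b).
Qed.

End Sectors.

(** * Lengths of displacements *)

Section Displacement.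
Variable R : realType.
Implicit Types l v : 'I_3 -> R.

(** The length, in the coordinates [xi], of the projection of a vector of R^3
    along the diagonal. *)
Definition proj_length l : R :=
  Num.sqrt (2 / 3 * (\sum_i l i ^+ 2 - (\sum_i l i) ^+ 2 / 3)).

(** The hypotheses say that [v] lies in the convex hull of the permutations of
    [l], as there are only three coordinates. *)
Lemma proj_length_le v l i j : (forall m, v m <= l i) ->
  (forall m, l j <= v m) ->
  \sum_m v m = \sum_m l m -> proj_length v <= proj_length l.
Proof.
move=> hi lo S; rewrite /proj_length S ler_wsqrtr // ler_wpM2l //; last first.
  rewrite lerD2r; have [ij|ij] := eqVneq i j.
    have E m : v m = l j by apply/eqP; rewrite eq_le lo -ij hi.
    under eq_bigr do rewrite E.
    have [a [b [ja jb ab _]]] := ord3_third j.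
    rewrite !(@sum3 _ _ j a b) // in S *; rewrite !E in S.
    have := sqr_ge0 (l a - l j); have := sqr_ge0 (l b - l j).
    move: (l a) (l b) (l j) S => x y z S; rewrite !expr2 => h1 h2; nra.
  have [k [ik jk _]] := ord3_other ij.
  have [b [c [ab ac bc _]]] := ord3_third i.
  rewrite (@sum3 _ l i j k) // (@sum3 _ v i b c) // in S.
  rewrite (@sum3 _ (fun m => l m ^+ 2) i j k) // (@sum3 _ (fun m =>
    v m ^+ 2) i b c) //.
  move: (hi i) (hi b) (hi c) (lo i) (lo b) (lo c) S.
  move: (v i) (v b) (v c) (l i) (l j) (l k) => x y z M m n.
  move=> xM yM zM mx my mz S.
  have {S} -> : n = x + y + z - M - m by rewrite S; ring.
  suff : 0 <= M ^+ 2 + m ^+ 2 + (x + y + z - M - m) ^+ 2 -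
      (x ^+ 2 + y ^+ 2 + z ^+ 2) by rewrite subr_ge0.
  have sorted (p q r : R) : p <= M -> m <= r -> r <= q -> q <= p ->
      0 <= M ^+ 2 + m ^+ 2 + (p + q + r - M - m) ^+ 2 -
      (p ^+ 2 + q ^+ 2 + r ^+ 2).
    move=> pM mr rq qp.
    have h1 : 0 <= (p - q) * (M - p) by rewrite mulr_ge0 // subr_ge0.
    have h2 : 0 <= (q - r) * (r - m) by rewrite mulr_ge0 // subr_ge0.
    have := sqr_ge0 (M - p); have := sqr_ge0 (m - r).
    have := sqr_ge0 (p + r - M - m).
    rewrite !expr2; nra.
  have [xy|/ltW xy] := leP x y; have [yz|/ltW yz] := leP y z;
  have [xz|/ltW xz] := leP x z.
  - by have := sorted z y x zM mx xy yz; congr (_ <= _); ring.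
  - by have := sorted z y x zM mx xy yz; congr (_ <= _); ring.
  - by have := sorted y z x yM mx xz yz; congr (_ <= _); ring.
  - by have := sorted y x z yM mz xz xy; congr (_ <= _); ring.
  - by have := sorted z x y zM my xy xz; congr (_ <= _); ring.
  - by have := sorted x z y xM my yz xz; congr (_ <= _); ring.
  - by have := sorted x y z xM mz yz xy; congr (_ <= _); ring.
  - by have := sorted x y z xM mz yz xy; congr (_ <= _); ring.
Qed.

Lemma proj_length_spread l i j : l i - l j <= 2 * proj_length l.
Proof.
have [lij|/ltW lij] := leP (l i - l j) 0.
  by rewrite (le_trans lij) // mulr_ge0 // sqrtr_ge0.
have [E|ij] := eqVneq i j.
  by rewrite E subrr mulr_ge0 // sqrtr_ge0.
have [k [ik jk _]] := ord3_other ij.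
rewrite -(ler_pXn2r (_ : (0 < 2)%N)) ?nnegrE // ?mulr_ge0 ?sqrtr_ge0 //.
rewrite exprMn /proj_length sqr_sqrtr; last first.
  rewrite !(@sum3 _ _ i j k) //.
  move: (l i) (l j) (l k) => x y z.
  rewrite (_ : _ - _ = ((x - y) ^+ 2 + (y - z) ^+ 2 + (x - z) ^+ 2) / 3).
    by rewrite mulr_ge0 // mulr_ge0 // !addr_ge0 // sqr_ge0.
  by field.
rewrite !(@sum3 _ _ i j k) //; move: (l i) (l j) (l k) {lij} => x y z.
have := sqr_ge0 (x - y); have := sqr_ge0 (y - z); have := sqr_ge0 (x - z).
rewrite !expr2 => h1 h2 h3; nra.
Qed.

Lemma proj_length_bound l C : (forall i j, l i - l j <= C) ->
  proj_length l <= 2 * C.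
Proof.
move=> H; have C0 : 0 <= C by rewrite -(subrr (l ord0)) H.
rewrite /proj_length -[leRHS]ger0_norm ?mulr_ge0 // -sqrtr_sqr ler_wsqrtr //.
have [j [k [ij ik jk _]]] := ord3_third (ord0 : 'I_3).
rewrite !(@sum3 _ _ ord0 j k) //.
have sq a b : (l a - l b) ^+ 2 <= C ^+ 2.
  rewrite -(real_normK (num_real (l a - l b))) ler_pXn2r ?nnegrE //.
  by rewrite ler_norml lerNl opprB !H.
have := sq ord0 j; have := sq ord0 k; have := sq j k.
move: (l ord0) (l j) (l k) => x y z; rewrite !expr2 => h1 h2 h3; nra.
Qed.

End Displacement.

(** * The building *)

Section Building.
Variables (R : realType) (G : gauged_plane R).
Notation P := (points G).
Notation L := (lines G).
Notation plane := 'cV[R]_2.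
Implicit Types (p q r : P) (K M : L) (f g : P -> R) (e : frame G) (i j : 'I_3).

Definition value_ratio f : P -> P -> R := fun p q => f p / f q.

(** A norm that some frame splits, up to a factor; passing to the ratios of its
    values removes the factor. *)
Definition bpoint : Type :=
  {h : P -> P -> R | exists f e, splits f e /\ h = value_ratio f}.

Implicit Types X Y Z : bpoint.

Definition represents X f : Prop := sval X = value_ratio f.

Lemma represents_exists X : exists f e, splits f e /\ represents X f.
Proof. by case: X => h [f [e [sf E]]]; exists f, e. Qed.

Lemma bpoint_exists f e : splits f e -> exists X, represents X f.
Proof.
move=> sf; have H : exists f' e', splits f' e' /\ value_ratio f = value_ratio
  f'.
  by exists f, e.
by exists (exist _ (value_ratio f) H).
Qed.

Lemma represents_inj X Y f g k : 0 < k -> (forall p, f p = k * g p) ->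
  represents X f -> represents Y g -> X = Y.
Proof.
move=> k0 fg; rewrite /represents; case: X => h hP; case: Y => h' hP' /= E E'.
have {E E'} : h = h'.
  rewrite E E'; apply/funext => p; apply/funext => q.
  rewrite /value_ratio !fg invfM mulrACA divff ?mul1r //; exact: lt0r_neq0.
by move=> E; subst h'; congr exist; apply: Prop_irrelevance.
Qed.

Lemma represents_unique X f g e : splits f e -> splits g e \/ norm g ->
  represents X f -> represents X g ->
    exists2 k, 0 < k & forall p, f p = k * g p.
Proof.
move=> sf hg; have {}hg : norm g by case: hg => // /splits_norm.
move=> rf rg; have f0 p := splits_gt0 p sf; have g0 := norm_gt0 hg.
exists (f (e ord0) / g (e ord0)); first exact: divr_gt0.
move=> p; have := congr1 (fun h => h p (e ord0)) (etrans (esym rf) rg).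
rewrite /value_ratio => /(canRL (divfK (lt0r_neq0 (f0 (e ord0))))) ->.
by field; rewrite lt0r_neq0.
Qed.

Lemma represents_splits X f g e : splits f e -> norm g -> represents X f ->
  represents X g ->
  splits g e.
Proof.
move=> sf hg rf rg.
have [k k0 E] := represents_unique sf (or_intror hg) rf rg.
suff -> : g = (fun p => k^-1 * f p) by apply: splitsZ; rewrite ?invr_gt0.
by apply/funext => p; rewrite E mulKf // lt0r_neq0.
Qed.

(** In the chart of [e] with origin [b], the coordinates of a norm are, up to
    sign, the logarithms of its values at the corners; with this sign the
    rays in the direction of the vector [dir i] converge to the corner [e i]. *)
Definition chart e (b : 'I_3 -> R) (phi : plane -> bpoint) : Prop :=
  forall x, exists f, [/\ splits f e, represents (phi x) f &
    forall i, f (e i) = b i * expR (- xi i x)].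

Definition charts : set (plane -> bpoint) :=
  [set phi | exists e b, (forall i, 0 < b i) /\ chart e b phi].

Lemma chart_exists e b : (forall i, 0 < b i) -> exists phi, chart e b phi.
Proof.
move=> b0; have /choice[phi H] x : exists X, exists f, [/\ splits f e,
  represents X f &
    forall i, f (e i) = b i * expR (- xi i x)].
  have [|f sf fE] := @splits_exists _ _ e (fun i => b i * expR (- xi i x)).
    by move=> i; rewrite mulr_gt0 ?expR_gt0.
  by have [X rX] := bpoint_exists sf; exists X, f.
by exists phi.
Qed.

Lemma chart_splits e b phi x f : chart e b phi -> norm f ->
  represents (phi x) f ->
  splits f e /\
  exists2 k, 0 < k & forall i, f (e i) = k * (b i * expR (- xi i x)).
Proof.
move=> ch hf rf; have [g [sg rg gE]] := ch x.
have sf := represents_splits sg hf rg rf; split=> //.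
have [k k0 E] := represents_unique sf (or_introl sg) rf rg.
by exists k => // i; rewrite E gE.
Qed.

Lemma log_coordinates (t : 'I_3 -> R) : (forall i, 0 < t i) ->
  exists x : plane, exists2 k, 0 < k & forall i, expR (- xi i x) = k * t i.
Proof.
move=> t0; have [x xE] := @xi_surj R (fun i => - ln (t i)).
exists x, (expR (\sum_j - ln (t j) / 3)); first exact: expR_gt0.
move=> i; rewrite xE opprB expRD opprK lnK ?posrE // mulr_suml.
by [].
Qed.

Lemma chart_onto e b phi X f : (forall i, 0 < b i) -> chart e b phi ->
  splits f e -> represents X f -> exists x, phi x = X.
Proof.
move=> b0 ch sf rf; have f0 p := splits_gt0 p sf.
have [|x [k k0 xE]] := @log_coordinates (fun i => f (e i) / b i).
  by move=> i; apply: divr_gt0.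
exists x; have [g [sg rg gE]] := ch x.
apply: (represents_inj k0 _ rg rf); apply: (splits_determined sg sf k0) => i.
by rewrite gE xE; field; rewrite lt0r_neq0.
Qed.

Lemma chart_inj e b phi : (forall i, 0 < b i) -> chart e b phi -> injective phi.
Proof.
move=> b0 ch x y E; have [f [sf rf fE]] := ch x; have [g [sg rg gE]] := ch y.
rewrite -E in rg; have [k k0 fg] := represents_unique sf (or_introl sg) rf rg.
have D (i : 'I_3) : xi i y - xi i x = ln k.
  have := fg (e i); rewrite fE gE mulrCA => /(mulfI (lt0r_neq0 (b0 i))).
  move=> /(congr1 (@ln R)); rewrite lnM ?posrE ?expR_gt0 // !expRK => h; lra.
have [j [l [ij il jl _]]] := ord3_third (ord0 : 'I_3).
have := sum_xi x ij il jl; have := sum_xi y ij il jl.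
have := D ord0; have := D j; have := D l => h1 h2 h3 h4 h5.
have k1 : ln k = 0 by lra.
by apply: xi_inj => i; have := D i; rewrite k1; lra.
Qed.

(** ** Invariance under the Weyl group *)

Definition frame_perm e (s : 'I_3 -> 'I_3) (si : injective s) : frame G.
Proof.
apply: (@Frame _ G (fun i => e (s i)) (fun i => side e (s i))) => i j.
by rewrite -(inj_eq si); exact: frameP.
Defined.

Lemma frame_perm_splits e (s : 'I_3 -> 'I_3) (si : injective s) f :
  splits f e -> splits f (frame_perm e si).
Proof.
move=> [hf H]; split=> // i p; apply: le_trans (H (s i) p).
by rewrite !fcoordE.
Qed.

Lemma building_A1 w phi : W 3 w -> charts phi -> charts (phi \o w).
Proof.
move=> [g [v [Wg ->]]] [e [b [b0 ch]]].
have [s si gE] := Wbar_perm Wg; have [s' ss' s's] := injF_bij si.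
have s'i := can_inj s's.
exists (frame_perm e s'i), (fun i => b (s' i) * expR (- xi (s' i) v)); split.
  by move=> i; rewrite mulr_gt0 ?expR_gt0.
move=> x; have [f [sf rf fE]] := ch (g *m x + v); exists f; split=> //.
  exact: frame_perm_splits.
by move=> i; rewrite /= fE xiD gE s's opprD expRD -mulrA (mulrC (expR (- xi (s'
  i) v))).
Qed.

(** ** Intersections of apartments *)

Lemma overlap e b phi e' b' phi' : (forall i, 0 < b i) ->
  (forall i, 0 < b' i) ->
  chart e b phi -> chart e' b' phi' ->
  phi @^-1` range phi' = [set x | forall i j k : 'I_3,
    b i * fcoord e i (e' j) * fcoord e' j (e k) * expR (xi k x - xi i x) <= b
      k].
Proof.
move=> b0 b0' ch ch'; apply/seteqP; split=> x /=.
  move=> [y _ E] i j k; have [f [sf rf fE]] := ch x.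
  rewrite -E in rf; have [[_ /(_ j (e k)) h] _] :=
    chart_splits ch' (splits_norm sf) rf.
  have := splits_term i (e' j) sf; have c0 := fcoord_ge0 e' j (e k).
  move=> /(ler_wpM2r c0) /le_trans /(_ h); rewrite !fE.
  rewrite -(ler_pM2r (expR_gt0 (xi k x))) -!mulrA -expRD addNr expR0 mulr1.
  rewrite expRD; congr (_ <= _); ring.
move=> H; have [f [sf rf fE]] := ch x.
suff sf' : splits f e' by have [y E] := chart_onto b0' ch' sf' rf; exists y.
apply: (splits_criterion sf) => j k; have [i ->] := splits_attained (e' j) sf.
have := H i j k; rewrite -(ler_pM2r (expR_gt0 (- xi k x))) !fE => h.
apply: le_trans h; rewrite -[leRHS]mulrA -expRD addrAC subrr add0r.
by rewrite le_eqVlt; apply/orP; left; apply/eqP; ring.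
Qed.

Lemma building_A2 phi phi' : charts phi -> charts phi' ->
  let Y := phi @^-1` range phi' in
  [/\ closed Y, convex_set Y &
      exists2 w, W 3 w & forall y, Y y -> phi y = phi' (w y)].
Proof.
move=> [e [b [b0 ch]]] [e' [b' [b0' ch']]] Y; split.
- rewrite /Y (overlap b0 b0' ch ch').
  pose T := ('I_3 * 'I_3 * 'I_3)%type.
  pose F (t : T) (x : plane) := b t.1.1 * fcoord e t.1.1 (e' t.1.2) *
    fcoord e' t.1.2 (e t.2) * expR (xi t.2 x - xi t.1.1 x).
  rewrite (_ : [set x | _] = \bigcap_(t in @setT T) (F t @^-1` [set r | r <= b
    t.2])).
    apply: closed_bigI => t _; apply: closed_comp; last exact: closed_le.
    move=> x _; have c := @xi_diff_cont R t.2 t.1.1 x.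
    exact: (cvgM (cvg_cst _) (continuous_comp c (@continuous_expR R _))).
  apply/seteqP; split=> x /= H; first by move=> t _; exact: H.
  by move=> i j k; exact: (H (i, j, k)).
- rewrite /Y (overlap b0 b0' ch ch') => x y l; rewrite !inE /= => hx hy i j k.
  have := hx i j k; have := hy i j k; set c := b i * _ * _.
  have : 0 <= c by rewrite !mulr_ge0 ?fcoord_ge0 // ltW.
  rewrite le_eqVlt => /predU1P[<-|c0]; first by rewrite !mul0r.
  rewrite -!ler_pdivlMl // !(mulrC c^-1).
  have q0 : 0 < b k / c by rewrite divr_gt0.
  rewrite -[b k / c]lnK ?posrE // !ler_expR.
  have l0 : 0 <= l%:num by [].
  have l1 : l%:num <= 1 by [].
  rewrite !xiD !xiZ /unstable.onem => h1 h2.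
  have h3 := ler_wpM2l l0 h2.
  have l1' : 0 <= 1 - l%:num by lra.
  have h4 := ler_wpM2l l1' h1.
  by move: h3 h4; lra.
have [s [a [si a0 tr]]] := transition e e'.
have [g Wg gE] := perm_Wbar R si.
have [|v [k k0 vE]] := @log_coordinates (fun j => a j * b (s j) / b' j).
  by move=> j; rewrite divr_gt0 // mulr_gt0.
exists (fun x => g *m x + v); first by exists g, v.
move=> x [y _ E]; have [f [sf rf fE]] := ch x.
rewrite -E in rf; have [sf' _] := chart_splits ch' (splits_norm sf) rf.
rewrite E in rf; have [f' [sf1 rf' fE']] := ch' (g *m x + v).
apply: (represents_inj (k := k^-1) _ _ rf rf'); first by rewrite invr_gt0.
apply: (splits_determined sf' sf1) => [|j]; first by rewrite invr_gt0.
rewrite (tr _ sf sf') fE fE' xiD gE (opprD (xi (s j) x)) expRD vE.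
by field; rewrite !lt0r_neq0.
Qed.

(** ** Common apartments of two points *)

Lemma building_A3 X Y : exists2 phi, charts phi & range phi X /\ range phi Y.
Proof.
have [f [e [sf rf]]] := represents_exists X;
  have [g [e' [sg rg]]] := represents_exists Y.
have [e'' [sf'' sg'']] := common_frame sf sg.
have [phi ch] := @chart_exists e'' (fun=> 1) (fun=> ltr01).
exists phi; first by exists e'', (fun=> 1).
by split; [have [x <-] := chart_onto (fun=> ltr01) ch sf'' rf; exists x
          |have [x <-] := chart_onto (fun=> ltr01) ch sg'' rg; exists x].
Qed.

(** ** Distances *)

Definition displacement e f g : 'I_3 -> R := fun i => ln (f (e i) / g (e i)).

Lemma displacement_max f g e e' : splits f e -> splits g e' ->
  exists i, forall p, ln (f p / g p) <= displacement e' f g i.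
Proof.
move=> sf sg; have [i H] := ratio_max (splits_norm sf) sg.
have f0 p := splits_gt0 p sf; have g0 p := splits_gt0 p sg.
exists i => p; rewrite ler_ln ?posrE ?divr_gt0 //.
by rewrite ler_pdivrMr // mulrAC ler_pdivlMr.
Qed.

Lemma displacement_min f g e e' : splits f e -> splits g e' ->
  exists i, forall p, displacement e f g i <= ln (f p / g p).
Proof.
move=> sf sg; have [i H] := displacement_max sg sf.
have f0 p := splits_gt0 p sf; have g0 p := splits_gt0 p sg.
have inv p : ln (f p / g p) = - ln (g p / f p).
  by rewrite -lnV ?posrE ?divr_gt0 // invf_div.
by exists i => p; rewrite /displacement !inv lerN2; exact: H.
Qed.

Lemma displacement_sum f g e : splits f e -> splits g e ->
  \sum_i displacement e f g i = ln (\prod_i f (e i)) - ln (\prod_i g (e i)).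
Proof.
move=> sf sg; have f0 p := splits_gt0 p sf; have g0 p := splits_gt0 p sg.
have [j [k [ij ik jk _]]] := ord3_third (ord0 : 'I_3).
rewrite (@sum3 _ _ ord0 j k) // !(prod3 _ ij ik jk) /displacement.
rewrite !lnM ?posrE ?mulr_gt0 ?invr_gt0 // !lnV ?posrE //.
by ring.
Qed.

Lemma log_volume f e e' : splits f e -> splits f e' ->
  ln (\prod_i f (e i)) - ln (volume e) = ln (\prod_i f (e' i)) - ln (volume e').
Proof.
move=> sf sf'; have f0 p := splits_gt0 p sf.
have pr (e0 : frame G) : 0 < \prod_i f (e0 i) by apply: prodr_gt0.
have := volume_invariant sf sf'; move=> /(congr1 (@ln R)).
by rewrite !lnM ?posrE ?volume_gt0 // => H; lra.
Qed.

(** The extreme values of the ratio of the norms, and by [volume_invariant] the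
    product of its values at the corners, do not depend on the frame; so each
    displacement lies in the convex hull of the permutations of the other. *)
Lemma length_displacement f g e e' : splits f e -> splits g e -> splits f e' ->
  splits g e' ->
  proj_length (displacement e f g) = proj_length (displacement e' f g).
Proof.
have half e1 e2 : splits f e1 -> splits g e1 -> splits f e2 -> splits g e2 ->
    proj_length (displacement e1 f g) <= proj_length (displacement e2 f g).
  move=> sf1 sg1 sf2 sg2.
  have [i hi] := displacement_max sf1 sg2;
    have [j hj] := displacement_min sf2 sg1.
  apply: (@proj_length_le _ _ _ i j) => [m|m|]; [exact: hi|exact: hj|].
  rewrite !displacement_sum //.
  by have := log_volume sf1 sf2; have := log_volume sg1 sg2 => h1 h2; lra.
by move=> *; apply/eqP; rewrite eq_le !half.
Qed.

Lemma bdistE X Y f g e : splits f e -> splits g e -> represents X f ->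
  represents Y g ->
  bdist charts X Y = proj_length (displacement e f g).
Proof.
move=> sf sg rf rg.
have [phi ch] := @chart_exists e (fun=> 1) (fun=> ltr01).
have [x xE] := chart_onto (fun=> ltr01) ch sf rf.
have [y yE] := chart_onto (fun=> ltr01) ch sg rg.
rewrite /bdist; set S := [set r | _].
have : S (xget 0 S).
  apply: xgetPex; exists (Defs.edist x y); exists phi, x, y; split=> //.
  by exists e, (fun=> 1).
move=> [psi [x' [y' [[e' [b [b0 ch']]] xE' yE' ->]]]].
rewrite -xE' in rf; have [sf' [k k0 fE]] :=
  chart_splits ch' (splits_norm sf) rf.
rewrite -yE' in rg; have [sg' [m m0 gE]] :=
  chart_splits ch' (splits_norm sg) rg.
rewrite (length_displacement sf sg sf' sg') edistE /proj_length;
  congr (Num.sqrt (_ * _)).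
have lE i : displacement e' f g i = ln k - ln m - (xi i x' - xi i y').
  rewrite /displacement fE gE; rewrite !lnM ?lnV ?posrE ?mulr_gt0 ?invr_gt0
    ?mulr_gt0 ?expR_gt0 //.
  by rewrite lnM ?posrE ?mulr_gt0 ?expR_gt0 // lnM ?posrE ?expR_gt0 // !expRK;
    ring.
have [j [l [ij il jl _]]] := ord3_third (ord0 : 'I_3).
rewrite !(@sum3 _ _ ord0 j l) // !lE.
have := sum_xi x' ij il jl; have := sum_xi y' ij il jl.
move: (xi _ _) (xi _ _) (xi _ _) (xi _ _) (xi _ _) (xi _ _) =>
  a1 a2 a3 c1 c2 c3.
move=> h1 h2.
have -> : c3 = - c1 - c2 by lra.
have -> : a3 = - a1 - a2 by lra.
by field.
Qed.

End Building.

Section AffineBuilding.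
Variables (R : realType) (G : gauged_plane R).
Notation P := (points G).
Notation L := (lines G).
Notation plane := 'cV[R]_2.
Local Notation hG := (gp_proj G).
Implicit Types (p q r : P) (K M : L) (f g : P -> R) (e : frame G) (i j : 'I_3).
Implicit Types X Y Z : bpoint G.

(** ** Common apartments of two sectors *)

Lemma frame3 p q r M : q <> r -> inc q M -> inc r M -> ~ inc p M ->
  exists e i j k, [/\ i != j, i != k, j != k & [/\ e i = p, e j = q &
    e k = r]] /\
    [/\ side e i = M, forall K, inc p K -> inc q K -> side e k = K &
        forall K, inc p K -> inc r K -> side e j = K].
Proof.
move=> qr qM rM pM; have [j [k [ij ik jk H]]] := ord3_third (ord0 : 'I_3).
set i := ord0 in ij ik H.
have [|e E] := @frame_of_corners _ G
    (fun m => if m == i then p else if m == j then q else r).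
  move=> [K HK]; apply: pM; have := HK i; have := HK j; have := HK k.
  rewrite eqxx !(eq_sym _ i) (negbTE ij) (negbTE ik) eqxx eq_sym (negbTE jk).
  by move=> rK qK; have -> := line_eq hG qr qM rM qK rK.
have ei : e i = p by rewrite E eqxx.
have ej : e j = q by rewrite E eq_sym (negbTE ij) eqxx.
have ek : e k = r by rewrite E !(eq_sym k) (negbTE ik) (negbTE jk).
have [ji ki kj] : [/\ j != i, k != i & k != j] by split; rewrite eq_sym.
exists e, i, j, k; split; first by split.
split=> [|K pK qK|K pK rK].
- by apply: (line_eq hG qr) => //; rewrite -?ej -?ek; exact: frame_on.
- apply: (line_eq hG (@frame_neq _ _ e i j ij)); rewrite ?ei ?ej //.
    by rewrite -ei; exact: frame_on.
  by rewrite -ej; exact: frame_on.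
- apply: (line_eq hG (@frame_neq _ _ e i k ik)); rewrite ?ei ?ek //.
    by rewrite -ei; exact: frame_on.
  by rewrite -ek; exact: frame_on.
Qed.

Lemma flags_frame p p' K K' : inc p K -> inc p' K' ->
  exists e i k i' k', [/\ i != k, e i = p & side e k = K] /\
                      [/\ i' != k', e i' = p' & side e k' = K'].
Proof.
move=> pK pK'.
have [E|pp'] := pselect (p = p'); have [EK|KK'] := pselect (K = K').
- subst p' K'; have [q qK qp] := other_point hG p K;
  have [r rK] := off_point hG K.
  have [e [i [j [k [[ij ik jk [ei ej ek]] [si sk sj]]]]]] :=
    frame3 (nesym qp) pK qK rK.
  by exists e, j, i, j, i; rewrite eq_sym ij; split.
- subst p'; have [a aK ap] := other_point hG p K.
  have [b bK' bp] := other_point hG p K'.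
  have aK' : ~ inc a K'.
    by move=> aK'; apply: KK'; exact: (line_eq hG ap aK pK aK' pK').
  have [e [i [j [k [[ij ik jk [ei ej ek]] [si sk sj]]]]]] :=
    frame3 (nesym bp) pK' bK' aK'.
  exists e, j, k, j, i; split; split=> //; first exact: sk.
  by rewrite eq_sym.
- subst K'; have [r rK] := off_point hG K.
  have [e [i [j [k [[ij ik jk [ei ej ek]] [si sk sj]]]]]] :=
    frame3 pp' pK pK' rK.
  by exists e, j, i, k, i; rewrite eq_sym ij eq_sym ik.
have [pK2|pK2] := pselect (inc p K').
- have [a aK ap] := other_point hG p K.
  have aK' : ~ inc a K'.
    by move=> aK'; apply: KK'; exact: (line_eq hG ap aK pK aK' pK2).
  have [e [i [j [k [[ij ik jk [ei ej ek]] [si sk sj]]]]]] :=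
    frame3 pp' pK2 pK' aK'.
  exists e, j, k, k, i; split; split=> //; first exact: sk.
  by rewrite eq_sym.
have [pK1|pK1] := pselect (inc p' K).
- have [b bK' bp] := other_point hG p' K'.
  have bK : ~ inc b K.
    by move=> bK; apply: KK'; exact: (line_eq hG bp bK pK1 bK' pK').
  have [e [i [j [k [[ij ik jk [ei ej ek]] [si sk sj]]]]]] :=
    frame3 pp' pK pK1 bK.
  exists e, j, i, k, j; split; split=> //; rewrite 1?eq_sym //; exact: sj.
have [x [xK xK']] := meet_point hG K K'.
have xp' : x <> p' by move=> E; apply: pK1; rewrite -E.
have [e [i [j [k [[ij ik jk [ei ej ek]] [si sk sj]]]]]] :=
  frame3 xp' xK' pK' pK2.
exists e, i, k, k, i; split; split=> //; first exact: sk.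
by rewrite eq_sym.
Qed.

Lemma frame_relabel e (a c i k : 'I_3) : a != c -> i != k ->
  exists e', [/\ e' i = e a, side e' k = side e c &
                 forall f, splits f e' -> splits f e].
Proof.
move=> ac ik; have [b [ab cb H]] := ord3_other ac.
have [j [ij kj H']] := ord3_other ik.
have [ji ki jk] : [/\ j != i, k != i & j != k] by split; rewrite eq_sym.
pose s m := if m == i then a else if m == k then c else b.
have s_i : s i = a by rewrite /s eqxx.
have sk : s k = c by rewrite /s (negbTE ki) eqxx.
have sj : s j = b by rewrite /s (negbTE ji) (negbTE jk).
have si : injective s.
  move=> x y; have [->|->|->] := H' x; have [->|->|->] := H' y;
    rewrite ?s_i ?sk ?sj // => E; move: ab cb ac;
    first [rewrite E eqxx | rewrite -E eqxx]; by [].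
exists (frame_perm e si); split=> [||f [hf Hf]] /=; rewrite ?s_i ?sk //.
split=> // m p; have : exists m', m = s m'.
  by have [->|->|->] := H m; [exists i|exists k|exists j].
by move=> [m' ->]; apply: le_trans (Hf m' p); rewrite !fcoordE.
Qed.

(** Moving the apex far enough into the sector ensures the hypotheses of
    [sector_splits]. *)
Lemma subsector e b phi (v : plane) (i j k : 'I_3) e' (a c : 'I_3) :
  (forall i, 0 < b i) -> chart e b phi -> i != j -> i != k -> j != k ->
    a != c ->
  e' a = e i -> side e' c = side e k ->
  exists v', translate v' (cone i j k) `<=` translate v (cone i j k) /\
    forall x f, translate v' (cone i j k) x -> norm f -> represents (phi x) f ->
      splits f e'.
Proof.
move=> b0 ch ij ik jk ac ea ec.
have [e1 [e1i e1k e1s]] := frame_relabel e' ac ik.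
rewrite ea in e1i; rewrite ec in e1k.
have [C C0 HC] := sector_splits ij ik jk e1i e1k.
pose N := C * b i / b j + C * b j / b k.
have N1 : 0 < C * b i / b j by rewrite divr_gt0 // mulr_gt0.
have N2 : 0 < C * b j / b k by rewrite divr_gt0 // mulr_gt0.
pose N' := N + `|xi i v - xi j v| + `|xi j v - xi k v|.
have N'0 : 0 <= N' by rewrite /N' /N !addr_ge0 // ltW.
have [w wE] := @xi_surj R (fun m =>
  if m == i then N' else if m == k then - N' else 0).
have wij : xi i w - xi j w = N'.
  by rewrite !wE eqxx eq_sym (negbTE ij) (negbTE jk); ring.
have wjk : xi j w - xi k w = N'.
  by rewrite !wE !(eq_sym _ i) (negbTE ij) (negbTE ik) (negbTE jk) eqxx; ring.
have cw : cone i j k w by split; rewrite -subr_ge0 ?wij ?wjk.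
exists (v + w); split.
  move=> x [z [z1 z2] <-]; exists (w + z); last by rewrite addrA.
  by case: cw => w1 w2; split; rewrite !xiD lerD.
move=> x f [z [z1 z2] zE] hf rf.
have [sf [m m0 fE]] := chart_splits ch hf rf.
have xij : N <= xi i x - xi j x.
  have := ler_norm (- (xi i v - xi j v)); rewrite normrN.
  have := normr_ge0 (xi j v - xi k v).
  rewrite -zE !xiD; move: wij; rewrite /N'.
  by move: `|_| `|_| => u1 u2; lra.
have xjk : N <= xi j x - xi k x.
  have := ler_norm (- (xi j v - xi k v)); rewrite normrN.
  have := normr_ge0 (xi i v - xi j v).
  rewrite -zE !xiD; move: wjk; rewrite /N'.
  by move: `|_| `|_| => u1 u2; lra.
have est (s t : 'I_3) : C * b s / b t <= N -> N <= xi s x - xi t x ->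
    C * f (e s) <= f (e t).
  move=> h1 h2; rewrite !fE mulrCA ler_pM2l // mulrA -ler_pdivlMr ?expR_gt0 //.
  rewrite -mulrA -expRN -expRD opprK (addrC (- _)) -ler_pdivrMl //.
  rewrite mulrC (le_trans h1) // (le_trans h2) //.
  by apply: le_trans (expR_ge1Dx _); lra.
by apply/e1s/(HC _ sf); apply: est => //; rewrite /N; lra.
Qed.

Lemma building_A4 S S' : is_sector 3 (@charts R G) S ->
  is_sector 3 (@charts R G) S' ->
  exists T T' phi, [/\ is_sector 3 (@charts R G) T, is_sector 3 (@charts R G)
    T',
    T `<=` S, T' `<=` S' & charts phi /\ T `|` T' `<=` range phi].
Proof.
move=> [phi1 [S1 [v1 [F1 s1 ->]]]] [phi2 [S2 [v2 [F2 s2 ->]]]].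
have [i1 [j1 [k1 [ij1 ik1 jk1 E1]]]] := (sectorP S1).1 s1.
have [i2 [j2 [k2 [ij2 ik2 jk2 E2]]]] := (sectorP S2).1 s2.
have [e1 [b1 [b10 ch1]]] := F1; have [e2 [b2 [b20 ch2]]] := F2.
have [e [a1 [c1 [a2 [c2 [[ac1 ea1 ec1] [ac2 ea2 ec2]]]]]]] :=
  flags_frame (frame_on e1 ik1) (frame_on e2 ik2).
have [w1 [sub1 H1]] := subsector v1 b10 ch1 ij1 ik1 jk1 ac1 ea1 ec1.
have [w2 [sub2 H2]] := subsector v2 b20 ch2 ij2 ik2 jk2 ac2 ea2 ec2.
have [phi ch] := @chart_exists _ G e (fun=> 1) (fun=> ltr01).
exists (phi1 @` translate w1 S1), (phi2 @` translate w2 S2), phi; split.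
- by exists phi1, S1, w1.
- by exists phi2, S2, w2.
- by rewrite E1; apply: image_subset.
- by rewrite E2; apply: image_subset.
split; first by exists e, (fun=> 1).
rewrite E1 E2 => X [] [x Hx <-].
  have [f [sf rf _]] := ch1 x; have sf' := H1 x f Hx (splits_norm sf) rf.
  by have [y <-] := chart_onto (fun=> ltr01) ch sf' rf; exists y.
have [f [sf rf _]] := ch2 x; have sf' := H2 x f Hx (splits_norm sf) rf.
by have [y <-] := chart_onto (fun=> ltr01) ch sf' rf; exists y.
Qed.

(** ** Retractions *)

(** The coordinates of the image of [f] are the minima of [f / g] over the
    cells, attained at the corners of an adapted frame. *)
Lemma building_A5' phi X : charts phi -> range phi X ->
  exists rho : bpoint G -> bpoint G,
    [/\ range rho `<=` range phi,
        forall Y, range phi Y -> rho Y = Y,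
        rho @^-1` [set X] = [set X] &
        forall Y Z, bdist (@charts R G) (rho Y) (rho Z) <= bdist (@charts R G)
          Y Z].
Proof.
move=> [e [b [b0 ch]]] [x0 _ x0E].
have [g [sg rg _]] := ch x0; rewrite x0E in rg.
have g0 p := splits_gt0 p sg.
have /choice[rho rhoP] Y : exists Z, exists f h e',
    [/\ represents Y f, represents Z h, splits f e', splits g e' &
      splits h e] /\
    [/\ forall i, cell e g i (e' i),
        forall i q, cell e g i q -> f (e' i) * g q <= f q * g (e' i) &
        forall i, h (e i) = g (e i) * (f (e' i) / g (e' i))].
  have [f [ef [sf rf]]] := represents_exists Y.
  have [|e' [sf' sg' ce mn]] := @adapted_frame _ _ e f g sg; first by exists ef.
  have f0 p := splits_gt0 p sf.
  have [|h sh hE] := @splits_exists _ _ e (fun i =>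
    g (e i) * (f (e' i) / g (e' i))).
    by move=> i; rewrite mulr_gt0 // divr_gt0.
  by have [Z rZ] := bpoint_exists sh; exists Z, f, h, e'.
have fix_ Y : range phi Y -> rho Y = Y.
  move=> [y _ yE]; have [f [h [e' [[rf rh sf' sg' sh] [ce mn hE]]]]] := rhoP Y.
  rewrite -yE in rf; have [sf _] := chart_splits ch (splits_norm sf') rf.
  rewrite yE in rf; apply: (represents_inj ltr01 _ rh rf).
  apply: (splits_determined sh sf ltr01) => i; rewrite mul1r hE.
  have e1 : f (e' i) * g (e i) = f (e i) * g (e' i).
    apply/eqP; rewrite eq_le mn ?andTb; last exact: cell_corner.
    have [-> _] := ce i; rewrite mulrCA mulrA mulrAC.
    by rewrite -mulrA mulrC ler_wpM2r ?(ltW (g0 _)) // mulrC splits_term.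
  by rewrite mulrA (mulrC (g _)) e1 mulfK // lt0r_neq0.
exists rho; split=> //.
- move=> _ [Y _ <-]; have [f [h [e' [[rf rh sf' sg' sh] _]]]] := rhoP Y.
  by have [y <-] := chart_onto b0 ch sh rh; exists y.
- apply/seteqP; split=> [Y /= E|_ ->]; last by apply: fix_; exists x0.
  have [f [h [e' [[rf rh sf' sg' sh] [ce mn hE]]]]] := rhoP Y.
  rewrite E in rh; have [k k0 hg] := represents_unique sh (or_introl sg) rh rg.
  apply: (represents_inj k0 _ rf rg);
    apply: (splits_determined sf' sg' k0) => i.
  have := hg (e i); rewrite hE mulrC => /(mulIf (lt0r_neq0 (g0 (e i)))) <-.
  by rewrite divfK // lt0r_neq0.
move=> Y Z.
have [f [h [e' [[rf rh sf sge' sh] [ce mn hE]]]]] := rhoP Y.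
have [f' [h' [e'' [[rf' rh' sf' sge'' sh'] [ce' mn' hE']]]]] := rhoP Z.
have [E [sfE sfE']] := common_frame sf sf'.
rewrite (bdistE sh sh' rh rh') (bdistE sfE sfE' rf rf').
have f0 p := splits_gt0 p sf; have f'0 p := splits_gt0 p sf'.
have [im him] := displacement_max sf sfE';
  have [il hil] := displacement_min sfE sf'.
have lnd a c : 0 < a -> 0 < c -> ln (a / c) = ln a - ln c :> R.
  by move=> a0 c0; rewrite lnM ?lnV ?posrE ?invr_gt0.
have dE i : displacement e h h' i =
    ln (f (e' i) / g (e' i)) - ln (f' (e'' i) / g (e'' i)).
  rewrite /displacement hE hE' -mulf_div divff ?mul1r ?lt0r_neq0 //.
  by rewrite lnd ?divr_gt0.
apply: (@proj_length_le _ _ _ im il) => [i|i|].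
- apply: le_trans (him (e'' i)); rewrite dE !lnd //.
  have := mn i _ (ce' i); rewrite -ler_ln ?posrE ?mulr_gt0 //.
  by rewrite !lnM ?posrE //; lra.
- apply: le_trans (hil (e' i)) _; rewrite dE !lnd //.
  have := mn' i _ (ce i); rewrite -ler_ln ?posrE ?mulr_gt0 //.
  by rewrite !lnM ?posrE //; lra.
under eq_bigr do rewrite dE.
rewrite sumrB -[X in X - _]/(\sum_i displacement e' f g i).
rewrite -[X in _ - X]/(\sum_i displacement e'' f' g i) !displacement_sum //.
have := log_volume sf sfE; have := log_volume sf' sfE'.
by have := log_volume sge' sge''; lra.
Qed.

Lemma building : R_building 3 (@charts R G).
Proof.
split=> //.
- by move=> phi [e [b [b0 ch]]]; exact: chart_inj b0 ch.
- exact: building_A1.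
- exact: building_A2.
- exact: building_A3.
- exact: building_A4.
- exact: building_A5'.
Qed.

End AffineBuilding.

(** * The building at infinity *)

Section Infinity.
Variables (R : realType) (G : gauged_plane R).
Notation P := (points G).
Notation L := (lines G).
Notation plane := 'cV[R]_2.
Local Notation hG := (gp_proj G).
Local Notation F := (@charts R G).
Implicit Types (p q r : P) (K M : L) (f g : P ->
  R) (e : frame G) (i j m : 'I_3).
Implicit Types (X Y : bpoint G) (Q : set (bpoint G)) (Z : set P) (t : bool).

(** A point of the ray with parameters [e], [B], [t] and [i], starting at the
    norm with values [B] at the corners, and going towards the corner [i] if
    [t] is [false] and towards the side [i] if [t] is [true]. The norm is scaled
    so that some of its values at the corners are constant along the ray. *)
Definition on_ray e (B : 'I_3 -> R) t i (T : R) f : Prop :=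
  splits f e /\ forall m, f (e m) = B m * (if (m == i) == t then T else 1).

Definition ray e B t i Q : Prop := forall X, Q X <->
  exists T f, [/\ 1 <= T, on_ray e B t i T f & represents X f].

(** The points at which the norms do not grow along a ray. *)
Definition trace e t i : set P :=
  if t then [set q | inc q (side e i)] else [set e i].

Definition panel_trace Z Q : Prop := exists e B t i,
  [/\ forall m, 0 < B m, ray e B t i Q & Z = trace e t i].

Lemma represents_scale X f (c : R) : 0 < c -> represents X f ->
  represents X (fun p => c * f p).
Proof.
move=> c0; rewrite /represents => ->; apply/funext => p; apply/funext => q.
by rewrite /value_ratio /= invfM mulrACA divff ?mul1r // lt0r_neq0.
Qed.

Lemma panel_ray e b phi v t i (s : R) : (forall m, 0 < b m) -> chart e b phi ->
  0 < s -> panel_trace (trace e t i) (phi @` translate v (half_line (s *: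
    panel_dir R t i))).
Proof.
move=> b0 ch s0; pose B m := b m * expR (- xi m v).
have B0 m : 0 < B m by rewrite mulr_gt0 ?expR_gt0.
exists e, B, t, i; split=> // X.
have tau m (r : R) : expR (- xi m (v + r *: (s *: panel_dir R t i))) =
    expR (- (if t then r * s / 2 else r * s)) * (expR (- xi m v) *
    (if (m == i) == t then expR (3 / 2 * (r * s)) else 1)).
  rewrite xiD !xiZ; case: t => /=; rewrite ?xiN xi_dir; case: (m == i) => /=;
  rewrite ?mulr1 -!expRD; congr expR; by field.
split=> [[_ [_ [r /= r0 <-] <-] <-]|[T [f [T1 [sf fE] rf]]]].
  have [f [sf rf fE]] := ch (v + r *: (s *: panel_dir R t i)).
  set k := expR (- (if t then r * s / 2 else r * s)) in tau.
  have k0 : 0 < k^-1 by rewrite invr_gt0 expR_gt0.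
  exists (expR (3 / 2 * (r * s))), (fun p => k^-1 * f p); split.
  - by rewrite -[leLHS]expR0 ler_expR !mulr_ge0 // ltW.
  - split=> [|m]; first exact: splitsZ.
    rewrite fE tau /B; have kn : k != 0 by rewrite lt0r_neq0 ?expR_gt0.
    by rewrite mulrCA mulKf // mulrA.
  - exact: represents_scale.
have T0 : 0 < T by apply: lt_le_trans T1.
pose r := 2 / 3 * ln T / s.
have r0 : 0 <= r by rewrite /r divr_ge0 ?(ltW s0) // !mulr_ge0 ?ln_ge0.
have rE : expR (3 / 2 * (r * s)) = T.
  rewrite (_ : _ * _ = ln T) ?lnK ?posrE // /r; field; exact: lt0r_neq0.
exists (v + r *: (s *: panel_dir R t i)).
  exists (r *: (s *: panel_dir R t i)) => //; exists r => //.
have [g [sg rg gE]] := ch (v + r *: (s *: panel_dir R t i)).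
set k := expR (- (if t then r * s / 2 else r * s)) in tau.
have k0 : 0 < k by exact: expR_gt0.
apply: (represents_inj k0 _ rg rf); apply: (splits_determined sg sf k0) => m.
by rewrite gE tau rE fE /B mulrCA !mulrA.
Qed.

(** ** Panels *)

Lemma is_panel_trace Q : is_panel 3 F Q -> exists Z, panel_trace Z Q.
Proof.
move=> [phi [S0 [v [d [[e [b [b0 ch]]] hS hd ->]]]]].
have [i [j [k [ij ik jk E]]]] := (sectorP S0).1 hS; rewrite E in hd.
have [s s0 [->|->]] := (boundingP d ij ik jk).1 hd.
  by exists (trace e false i); exact: (panel_ray v false i b0 ch s0).
by exists (trace e true k); exact: (panel_ray v true k b0 ch s0).
Qed.

Lemma is_panel_of_type_trace t Q : is_panel_of_type 3 F t Q ->
  exists e i, panel_trace (trace e t i) Q.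
Proof.
move=> [phi [S0 [v [d [[e [b [b0 ch]]] _ _ /direction_typeP[s [i [s0 ->]]]
  ->]]]]].
by exists e, i; exact: panel_ray.
Qed.

Lemma panels_of_sector_trace t t' Q Q' : panels_of_sector 3 F t t' Q Q' ->
  exists e i i', [/\ panel_trace (trace e t i) Q, panel_trace (trace e t' i')
    Q' &
    t != t' -> i != i'].
Proof.
move=> [phi [S0 [v [d [d' [[e [b [b0 ch]]] hS [bd td] [bd' td'] [-> ->]]]]]]].
have [s [i [s0 dE]]] := (direction_typeP t d).1 td.
have [s' [i' [s'0 dE']]] := (direction_typeP t' d').1 td'.
exists e, i, i'; rewrite dE dE'; split; try exact: panel_ray.
(* otherwise the sector would contain two opposite vectors *)
move=> tt'; apply/eqP => ii'; subst i'.
have [a [c [k [ac ak ck E]]]] := (sectorP S0).1 hS.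
have inS d0 : bounding d0 S0 -> cone a c k d0.
  move=> [_ /(_ (1 *: d0))]; rewrite E -(closure_id _).1;
    last exact: cone_closed.
  by rewrite scale1r => H; case: H => //; exists 1; rewrite /= ?ler01 ?scale1r.
have h := inS _ bd; have h' := inS _ bd'.
have {}h : cone a c k (panel_dir R t i).
  by move: h; rewrite dE /cone /= !xiZ !ler_pM2l.
have {}h' : cone a c k (panel_dir R t' i).
  by move: h'; rewrite dE' /cone /= !xiZ !ler_pM2l.
have {h h'} [h h'] : cone a c k (dir R i) /\ cone a c k (- dir R i).
  by move: tt' h h'; case: (t); case: (t').
move: h h'; rewrite /cone /= !xiN !xi_dir => -[h1 h2] [h3 h4].
have [n [_ _ H]] := ord3_other ac.
have kn : k = n by have [Ek|Ek|//] := H k; rewrite Ek eqxx in ak ck.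
subst n; move: h1 h2 h3 h4.
by have [->|->|->] := H i; rewrite !eqxx ?(eq_sym k) ?(eq_sym c a)
  ?(negbTE ac) ?(negbTE ak) ?(negbTE ck); lra.
Qed.

(** ** Growth of norms along rays *)

Lemma fcoord_nontrivial e q : exists m, ~ inc q (side e m).
Proof.
have [f sf _] := @splits_exists _ _ e (fun=> 1) (fun=> ltr01).
have [m E] := splits_attained q sf; exists m => /fcoord_eq0 c0.
by have := splits_gt0 q sf; rewrite E c0 mulr0 ltxx.
Qed.

Lemma trace_fcoord e t i q : trace e t i q <->
  forall m, (m == i) == t -> fcoord e m q = 0.
Proof.
rewrite /trace; case: t => /=; split.
- by move=> /fcoord_eq0 c0 m /eqP/eqP ->.
- by move=> H; apply/fcoord_eq0/H; rewrite eqxx.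
- by move=> -> m /eqP mi; apply: fcoordij; rewrite eq_sym mi.
- move=> H; have [j [k [ij ik jk _]]] := ord3_third i.
  have sjk : side e j <> side e k.
    by move=> E; apply: (@frame_off _ _ e j); rewrite E; exact: frame_on.
  apply: (point_eq hG sjk); try exact: frame_on.
  + by apply/fcoord_eq0/H; rewrite (eq_sym j) (negbTE ij).
  + by apply/fcoord_eq0/H; rewrite (eq_sym k) (negbTE ik).
Qed.

Definition growth Z q (T : R) : R := if pselect (Z q) then 1 else T.

Lemma growth_in Z q T : Z q -> growth Z q T = 1.
Proof. by rewrite /growth; case: pselect. Qed.

Lemma growth_out Z q T : ~ Z q -> growth Z q T = T.
Proof. by rewrite /growth; case: pselect. Qed.

Lemma ray_growth e B t i q : (forall m, 0 < B m) -> exists c C,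
  [/\ 0 < c, 0 < C & forall T f, 1 <= T -> on_ray e B t i T f ->
    c * growth (trace e t i) q T <= f q /\ f q <= C * growth (trace e t i) q T].
Proof.
move=> B0; have Bc0 m : 0 <= B m * fcoord e m q by rewrite mulr_ge0 ?fcoord_ge0
  // ltW.
have up m : B m * fcoord e m q <= 1 + \sum_n B n * fcoord e n q.
  by rewrite (bigD1 m) //= addrCA lerDl addr_ge0 // sumr_ge0.
have C0 : 0 < 1 + \sum_n B n * fcoord e n q.
  by rewrite ltr_pwDl // sumr_ge0.
have [Zq|Zq] := pselect (trace e t i q).
  have [m qm] := fcoord_nontrivial e q.
  exists (B m * fcoord e m q), (1 + \sum_n B n * fcoord e n q).
  split=> // [|T f T1 [sf fE]]; first by rewrite mulr_gt0 // fcoord_gt0.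
  rewrite growth_in // !mulr1; split.
    apply: le_trans (splits_term m q sf); rewrite fE ler_wpM2r ?fcoord_ge0 //.
    by case: ifP => _; rewrite ?mulr1 // ler_peMr // ltW.
  have [n E] := splits_attained q sf; rewrite E fE; case: ifP => [h|_].
    have c0 := (trace_fcoord e t i q).1 Zq n h.
    by have := splits_gt0 q sf; rewrite E c0 mulr0 ltxx.
  by rewrite mulr1.
have [m mt cm] : exists2 m, (m == i) == t & 0 < fcoord e m q.
  apply: contrapT => hn; apply: Zq; apply/trace_fcoord => m mt.
  apply: contrapT => /eqP c0; apply: hn; exists m => //.
  by rewrite lt_neqAle eq_sym c0 fcoord_ge0.
exists (B m * fcoord e m q), (1 + \sum_n B n * fcoord e n q).
split=> // [|T f T1 [sf fE]]; first by rewrite mulr_gt0.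
rewrite growth_out //; split.
  by apply: le_trans (splits_term m q sf); rewrite fE mt mulrAC.
have [n ->] := splits_attained q sf; rewrite fE mulrAC ler_pM //.
  by case: ifP => _ //; apply: le_trans T1.
by case: ifP.
Qed.

(** The ratio of two norms is largest at one of three fixed points, where both
    norms grow alike. *)
Lemma rays_bound e B t i e' B' t' i' : (forall m, 0 < B m) ->
  (forall m, 0 < B' m) ->
  trace e t i = trace e' t' i' -> exists2 M, 0 <= M &
  forall T f g, 1 <= T -> on_ray e B t i T f -> on_ray e' B' t' i' T g ->
    forall p, ln (f p / g p) <= M.
Proof.
move=> B0 B0' EZ.
have /choice[c cP] m : exists c : R * R, [/\ 0 < c.1, 0 < c.2 &
    forall T f g, 1 <= T -> on_ray e B t i T f -> on_ray e' B' t' i' T g ->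
    f (e' m) <= c.1 * growth (trace e t i) (e' m) T /\
    c.2 * growth (trace e t i) (e' m) T <= g (e' m)].
  have [c [C [c0 C0 H]]] := ray_growth e t i (e' m) B0.
  have [c' [C' [c'0 C'0 H']]] := ray_growth e' t' i' (e' m) B0'.
  exists (C, c'); split=> //= T f g T1 rf rg; have [_ ?] := H T f T1 rf.
  by have [+ _] := H' T g T1 rg; rewrite -EZ.
exists (\sum_m `|ln ((c m).1 / (c m).2)|); first by apply: sumr_ge0.
move=> T f g T1 rf rg p; have [sf _] := rf; have [sg _] := rg.
have [m H] := displacement_max sf sg; apply: (le_trans (H p)).
have [c1 c2 /(_ T f g T1 rf rg)[h1 h2]] := cP m.
apply: (@le_trans _ _ `|ln ((c m).1 / (c m).2)|); last first.
  by rewrite (bigD1 m) //= lerDl sumr_ge0.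
apply: le_trans (ler_norm _); rewrite /displacement ler_ln ?posrE ?divr_gt0 //;
  try exact: splits_gt0 sf; try exact: splits_gt0 sg.
rewrite ler_pdivrMr ?(splits_gt0 _ sg) //.
apply: (le_trans h1); rewrite -mulrA ler_pM2l // mulrC ler_pdivlMr //.
by rewrite mulrC.
Qed.

Lemma trace_parallel Z Q Q' : panel_trace Z Q -> panel_trace Z Q' ->
  parallel F Q Q'.
Proof.
move=> [e [B [t [i [B0 rQ EZ]]]]] [e' [B' [t' [i' [B0' rQ' EZ']]]]].
have E : trace e t i = trace e' t' i' by rewrite -EZ.
have [M M0 H] := rays_bound B0 B0' E.
have [M' M0' H'] := rays_bound B0' B0 (esym E).
have near X Y T f g : 1 <= T -> on_ray e B t i T f -> on_ray e' B' t' i' T g ->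
    represents X f -> represents Y g -> bdist F X Y <= 2 * (M + M').
  move=> T1 rf rg rX rY; have [sf _] := rf; have [sg _] := rg.
  have [e0 [sf0 sg0]] := common_frame sf sg.
  rewrite (bdistE sf0 sg0 rX rY); apply: proj_length_bound => a c.
  have := H T f g T1 rf rg (e0 a); have := H' T g f T1 rg rf (e0 c).
  rewrite -invf_div lnV ?posrE ?divr_gt0 ?(splits_gt0 _ sf) ?(splits_gt0 _ sg)
    //.
  rewrite /displacement; lra.
have pt e1 B1 t1 i1 T : (forall m, 0 < B1 m) -> 1 <= T ->
    exists f X, on_ray e1 B1 t1 i1 T f /\ represents X f.
  move=> B10 T1; have [|f sf fE] := @splits_exists _ _ e1
    (fun m => B1 m * (if (m == i1) == t1 then T else 1)).
    by move=> m; rewrite mulr_gt0 //; case: ifP => // _; apply: lt_le_trans T1.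
  by have [X rX] := bpoint_exists sf; exists f, X.
exists (2 * (M + M')); split=> [X /rQ [T [f [T1 rf rX]]]|Y /rQ' [T [g [T1 rg
  rY]]]].
  have [g [Y [rg rY]]] := pt e' B' t' i' T B0' T1.
  by exists Y; [apply/rQ'; exists T, g|exact: near T1 rf rg rX rY].
have [f [X [rf rX]]] := pt e B t i T B0 T1.
by exists X; [apply/rQ; exists T, f|exact: near T1 rf rg rX rY].
Qed.

Lemma trace_ne e t i : (exists q, trace e t i q) /\ (exists q, ~ trace e t i q).
Proof.
rewrite /trace; have [j [k [ij ik jk _]]] := ord3_third i.
case: t => /=; split.
- by exists (e j); apply: frame_on; rewrite eq_sym.
- by exists (e i); exact: frame_off.
- by exists (e i).
- by exists (e j); apply: frame_neq; rewrite eq_sym.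
Qed.

(** If norms [f] and [g] on the two panels have bounded distance, then the ratio
    of the values of [f] at two points, one outside and one inside the trace,
    grows no faster than that of [g]; so the first point lies outside, and the
    second inside, the other trace. *)
Lemma parallel_trace Z Z' Q Q' : panel_trace Z Q -> panel_trace Z' Q' ->
  parallel F Q Q' -> Z = Z'.
Proof.
move=> [e [B [t [i [B0 rQ EZ]]]]] [e' [B' [t' [i' [B0' rQ' EZ']]]]] [C [HC _]].
have key q q' : ~ Z q -> Z q' -> ~ Z' q /\ Z' q'.
  move=> Zq Zq'.
  suff : ~ (Z' q \/ ~ Z' q').
    by move=> /not_orP[? ?]; split=> //; exact: contrapT.
  move=> hZ'.
  have [c1 [C1 [c10 C10 H1]]] := ray_growth e t i q B0.
  have [c2 [C2 [c20 C20 H2]]] := ray_growth e t i q' B0.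
  have [c3 [C3 [c30 C30 H3]]] := ray_growth e' t' i' q B0'.
  have [c4 [C4 [c40 C40 H4]]] := ray_growth e' t' i' q' B0'.
  rewrite -EZ in H1 H2; rewrite -EZ' in H3 H4.
  pose D := expR (2 * C).
  pose T := 1 + C2 * D * C3 / (c1 * c4).
  have D0 : 0 < D := expR_gt0 _.
  have T1 : 1 <= T by rewrite lerDl divr_ge0 ?mulr_ge0 // ltW.
  have [|f sf fE] := @splits_exists _ _ e
    (fun m => B m * (if (m == i) == t then T else 1)).
    by move=> m; rewrite mulr_gt0 //; case: ifP => // _; apply: lt_le_trans T1.
  have [X rX] := bpoint_exists sf.
  have rf : on_ray e B t i T f by [].
  have [|Y QY dXY] := HC X; first by apply/rQ; exists T, f.
  have [T' [g [T1' rg rY]]] := (rQ' Y).1 QY; have [sg _] := rg.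
  have f0 p := splits_gt0 p sf; have g0 p := splits_gt0 p sg.
  have [e0 [sf0 sg0]] := common_frame sf sg.
  rewrite (bdistE sf0 sg0 rX rY) in dXY.
  have [a ha] := displacement_max sf sg0;
    have [c hc] := displacement_min sf0 sg.
  have : ln (f q / g q) - ln (f q' / g q') <= 2 * C.
    apply: (@le_trans _ _ (displacement e0 f g a - displacement e0 f g c)).
      by rewrite lerB ?ha ?hc.
    by apply: le_trans (proj_length_spread _ _ _) _; rewrite ler_pM2l.
  rewrite -lnV ?posrE ?divr_gt0 // -lnM ?posrE ?invr_gt0 ?divr_gt0 //.
  rewrite -[2 * C]expRK -/D ler_ln ?posrE ?mulr_gt0 ?invr_gt0 ?divr_gt0 //.
  rewrite invf_div mulf_div ler_pdivrMr ?mulr_gt0 // => {}dXY.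
  have [l1 _] := H1 T f T1 rf; have [_ u2] := H2 T f T1 rf.
  have [_ u3] := H3 T' g T1' rg; have [l4 _] := H4 T' g T1' rg.
  rewrite growth_out // in l1; rewrite growth_in // mulr1 in u2.
  have {u3 l4} gle : g q * c4 <= C3 * g q'.
    have {}l4 : c4 <= g q'.
      apply: le_trans l4; rewrite ler_peMr ?(ltW c40) // /growth.
      by case: pselect.
    have [Zq1|Zq1] := pselect (Z' q).
      rewrite growth_in // mulr1 in u3.
      by apply: ler_pM => //; exact: ltW.
    case: hZ' => // Zq2; rewrite growth_out // in u3.
    have := H4 T' g T1' rg; rewrite growth_out // => -[{}l4 _].
    apply: (@le_trans _ _ (C3 * T' * c4)); first by rewrite ler_pM2r.
    by rewrite -mulrA ler_pM2l // mulrC.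
  have : c1 * T * c4 <= C2 * D * C3.
    rewrite -(ler_pM2r (g0 q')).
    apply: (@le_trans _ _ (f q * g q' * c4)).
      by rewrite [leRHS]mulrAC ler_pM2r // ler_pM2r.
    apply: (@le_trans _ _ (D * (g q * f q') * c4)); first by rewrite ler_pM2r.
    rewrite (_ : D * (g q * f q') * c4 = f q' * D * (g q * c4)); last by ring.
    rewrite (_ : C2 * D * C3 * g q' = C2 * D * (C3 * g q')); last by ring.
    by apply: ler_pM => //; rewrite ?mulr_ge0 ?ler_pM2r ?(ltW (f0 _)) ?(ltW (g0
      _)) ?(ltW D0) ?(ltW c40).
  rewrite (_ : c1 * T * c4 = c1 * c4 + C2 * D * C3); last first.
    by rewrite /T; field; rewrite !lt0r_neq0.
  by have := mulr_gt0 c10 c40; lra.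
have [[q1 Zq1] [q2 Zq2]] := trace_ne e t i; rewrite -EZ in Zq1 Zq2.
apply/seteqP; split=> q; first by move=> Zq; case: (key q2 q).
by move=> Zq; apply: contrapT => nq; case: (key q q1).
Qed.

Lemma parallel_class_trace Z Q : panel_trace Z Q ->
  [set Q' | is_panel 3 F Q' /\ parallel F Q Q'] =
  [set Q' | is_panel 3 F Q' /\ panel_trace Z Q'].
Proof.
move=> hQ; apply/seteqP; split=> Q' /= [pQ' h]; split=> //.
  have [Z' hQ'] := is_panel_trace pQ'.
  by rewrite (parallel_trace hQ hQ' h).
exact: trace_parallel hQ h.
Qed.

Lemma trace_unique Z Z' Q : panel_trace Z Q -> panel_trace Z' Q -> Z = Z'.
Proof. by move=> h h'; exact: parallel_trace h h' (trace_parallel h h). Qed.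

Lemma panels_exist e i k : i != k -> exists Q Q',
  [/\ panels_of_sector 3 F false true Q Q',
      is_panel_of_type 3 F false Q, is_panel_of_type 3 F true Q',
      panel_trace [set e i] Q & panel_trace [set q | inc q (side e k)] Q'].
Proof.
move=> ik; have [j [ij kj _]] := ord3_other ik; rewrite eq_sym in kj.
have [phi ch] := @chart_exists _ _ e (fun=> 1) (fun=> ltr01).
have Fphi : charts phi by exists e, (fun=> 1).
have hS : vector_sector 3 (cone i j k : set plane) by apply: (sectorP (cone i j
  k)).2; exists i, j, k.
have bi : bounding (panel_dir R false i) (cone i j k).
  by apply/(boundingP _ ij ik kj); exists 1 => //; left; rewrite scale1r.
have bk : bounding (panel_dir R true k) (cone i j k).
  by apply/(boundingP _ ij ik kj); exists 1 => //; right; rewrite scale1r.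
have ti t m : direction_type 3 t (panel_dir R t m).
  by apply/direction_typeP; exists 1, m; rewrite scale1r.
exists (phi @` translate 0 (half_line (panel_dir R false i))).
exists (phi @` translate 0 (half_line (panel_dir R true k))); split.
- by exists phi, (cone i j k), 0, (panel_dir R false i), (panel_dir R true k).
- by exists phi, (cone i j k), 0, (panel_dir R false i).
- by exists phi, (cone i j k), 0, (panel_dir R true k).
- by rewrite -[panel_dir _ _ _]scale1r;
  exact: (panel_ray 0 false i (fun=> ltr01) ch ltr01).
- by rewrite -[panel_dir _ _ _]scale1r;
  exact: (panel_ray 0 true k (fun=> ltr01) ch ltr01).
Qed.

Lemma panel_of_typeW t Q : is_panel_of_type 3 F t Q -> is_panel 3 F Q.
Proof. by move=> [phi [S0 [v [d [? ? ? _ ?]]]]]; exists phi, S0, v, d. Qed.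

Lemma flag_frame p K : inc p K -> exists e i k, [/\ i != k, e i = p &
  side e k = K].
Proof.
by move=> pK; have [e [i [k [_ [_ [? _]]]]]] := flags_frame pK pK;
  exists e, i, k.
Qed.

Definition trace_class Z : set (set (bpoint G)) :=
  [set Q' | is_panel 3 F Q' /\ panel_trace Z Q'].

Lemma point_class p : parallel_class 3 F false (trace_class [set p]).
Proof.
have [K [pK _]] := line_through hG p p.
have [e [i [k [ik <- _]]]] := flag_frame pK.
have [Q [_ [_ tQ _ hQ _]]] := panels_exist e ik.
by exists Q => //; rewrite (parallel_class_trace hQ).
Qed.

Lemma line_class K : parallel_class 3 F true (trace_class [set q | inc q K]).
Proof.
have [p [_ [_ [[pK _ _] _]]]] := pp_thick_line hG K.
have [e [i [k [ik _ <-]]]] := flag_frame pK.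
have [_ [Q [_ _ tQ _ hQ]]] := panels_exist e ik.
by exists Q => //; rewrite (parallel_class_trace hQ).
Qed.

Lemma trace_class_inj Z Z' Q : trace_class Z Q ->
  trace_class Z = trace_class Z' -> Z = Z'.
Proof.
move=> [pQ hQ] E; have : trace_class Z' Q by rewrite -E.
by move=> [_]; exact: trace_unique hQ.
Qed.

Lemma parallel_classE t c : parallel_class 3 F t c ->
  exists e i, c = trace_class (trace e t i).
Proof.
move=> [Q tQ ->]; have [e [i hQ]] := is_panel_of_type_trace tQ.
by exists e, i; rewrite (parallel_class_trace hQ).
Qed.

Lemma parallel_class_inhabited t c : parallel_class 3 F t c -> exists Q, c Q.
Proof.
move=> [Q tQ ->]; exists Q; split; first exact: panel_of_typeW tQ.
have [e [i hQ]] := is_panel_of_type_trace tQ.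
exact: (trace_parallel hQ hQ).
Qed.

Lemma points_inj K M : [set q | inc q K] = [set q | inc q M] -> K = M.
Proof.
move=> E; have [p [q [_ [[pK qK _] [pq _ _]]]]] := pp_thick_line hG K.
have pM : [set q | inc q M] p by rewrite -E.
have qM : [set q | inc q M] q by rewrite -E.
exact: (line_eq hG pq).
Qed.

Lemma infinity_iso : geometry_iso G (building_at_infinity 3 F).
Proof.
exists (fun p => exist _ (trace_class [set p]) (point_class p)).
exists (fun K => exist _ (trace_class [set q | inc q K]) (line_class K)).
have exE (T : Type) (A : T -> Prop) (x y : {x | A x}) : sval x = sval y ->
  x = y.
  case: x y => x hx [y hy] /= E; subst y; congr exist; exact: Prop_irrelevance.
split.
- rewrite -setTT_bijective; split=> //.
    move=> p q _ _ /(congr1 sval) /= E;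
      have [Q hQ] := parallel_class_inhabited (point_class p).
    have : [set p] = [set q] := trace_class_inj hQ E.
    by move=> /(congr1 (fun Z => Z p)) /= E'; have : p = p by []; rewrite E'.
  move=> [c hc] _; have [e [i E]] := parallel_classE hc.
  by exists (e i) => //; apply: exE; rewrite /= E.
- rewrite -setTT_bijective; split=> //.
    move=> K M _ _ /(congr1 sval) /= E;
      have [Q hQ] := parallel_class_inhabited (line_class K).
    exact: points_inj (trace_class_inj hQ E).
  move=> [c hc] _; have [e [i E]] := parallel_classE hc.
  by exists (side e i) => //; apply: exE; rewrite /= E.
move=> p K; split=> [pK|[Q [Q' /= [[pQ hQ] [pQ' hQ'] sQ]]]].
  have [e [i [k [ik ei ek]]]] := flag_frame pK.
  have [Q [Q' [sQ tQ tQ' hQ hQ']]] := panels_exist e ik.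
  exists Q, Q'; rewrite ei in hQ; rewrite ek in hQ'; split=> //=; split=> //.
    exact: panel_of_typeW tQ.
  exact: panel_of_typeW tQ'.
have [e [i [i' [h h' ii']]]] := panels_of_sector_trace sQ.
have E := trace_unique hQ h; have E' := trace_unique hQ' h'.
have : trace e false i p by rewrite -E.
rewrite (points_inj E') /trace /= => ->; apply: frame_on; exact: ii'.
Qed.


End Infinity.

(** * Valuations and metrics *)

Section Logarithm.
Variables (R : realType) (t : R).
Hypothesis ht : 1 < t.
Implicit Types (x y : R) (u v : \bar R).

Lemma lnt_gt0 : 0 < ln t. Proof. exact: ln_gt0. Qed.

Lemma expNE (r : R) : expN t r%:E = expR (- (r * ln t)).
Proof. by rewrite /expN /powR gt_eqF ?mulNr // (lt_trans ltr01). Qed.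

Lemma expN_oo : expN t +oo%E = 0. Proof. by []. Qed.

Lemma expN0 : expN t 0%E = 1.
Proof. by rewrite expNE mul0r oppr0 expR0. Qed.

Lemma expN_itv u : (0 <= u)%E -> 0 <= expN t u <= 1.
Proof.
case: u => [r||] //; last by rewrite expN_oo lexx ler01.
rewrite lee_fin expNE => r0; rewrite expR_ge0 -[leRHS]expR0 ler_expR.
by rewrite oppr_le0 mulr_ge0 // ltW // lnt_gt0.
Qed.

Lemma expN_eq0 u : (0 <= u)%E -> expN t u = 0 <-> u = +oo%E.
Proof.
case: u => [r||] // _; split=> // /eqP.
by rewrite expNE gt_eqF ?expR_gt0.
Qed.

Lemma le_expN u v : (0 <= u)%E -> (u <= v)%E -> expN t v <= expN t u.
Proof.
case: u => [r||] // u0; case: v => [s||] //.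
- by rewrite lee_fin => rs; rewrite !expNE ler_expR lerN2 ler_wpM2r // ltW //
  lnt_gt0.
- by rewrite expN_oo expNE expR_ge0.
Qed.

(** The inverse of [expN t] on the unit interval. *)
Definition logv x : \bar R := if x == 0 then +oo%E else (- (ln x / ln t))%:E.

Lemma logvK x : 0 <= x -> expN t (logv x) = x.
Proof.
move=> x0; rewrite /logv; case: eqVneq => [->//|xn].
rewrite expNE mulNr opprK divfK ?lt0r_neq0 ?lnt_gt0 // lnK // posrE.
by rewrite lt_neqAle eq_sym xn.
Qed.

Lemma logv_oo x : logv x = +oo%E <-> x = 0.
Proof.
rewrite /logv; case: eqVneq => [->|/eqP xn]; first by [].
by split=> // /xn.
Qed.

Lemma logv1 : logv 1 = 0%E.
Proof. by rewrite /logv oner_eq0 ln1 mul0r oppr0. Qed.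

Lemma logv_ge0 x : 0 <= x <= 1 -> (0 <= logv x)%E.
Proof.
move=> /andP[x0 x1]; rewrite /logv; case: eqVneq => // xn.
by rewrite lee_fin oppr_ge0 pmulr_lle0 ?invr_gt0 ?lnt_gt0 // ln_le0.
Qed.

Lemma logv_lt x y : 0 <= x <= 1 -> 0 <= y <= 1 -> (logv x < logv y)%E -> y < x.
Proof.
move=> hx /andP[y0 y1]; rewrite !ltNge; apply: contra => xy.
rewrite leNgt; apply/negP => h.
have := logv_ge0 hx; have /andP[x0 _] := hx => l0.
have := xy; rewrite -{1}(logvK x0) -{1}(logvK y0).
move: h; rewrite /logv; case: (eqVneq x 0) xy => [->|xn] xy.
  by case: eqVneq.
have yn : y != 0.
  by apply: contraNneq xn => yz; rewrite eq_le x0 -yz xy.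
rewrite (negbTE yn) lte_fin !expNE ler_expR => h1 _; move: h1.
rewrite ltrN2 ltr_pM2r ?invr_gt0 ?lnt_gt0 // ltr_ln ?posrE; last 2 first.
- by rewrite lt_neqAle eq_sym yn.
- by rewrite lt_neqAle eq_sym xn.
by rewrite ltNge xy.
Qed.

Lemma logvM x : forall y z w, 0 <= x -> 0 <= y -> 0 <= z -> 0 <= w ->
  x * y = z * w ->
  (1%:E * logv x + 1%:E * logv y = 1%:E * logv z + 1%:E * logv w)%E.
Proof.
move=> y z w x0 y0 z0 w0 E; rewrite !mul1e /logv.
have := congr1 (fun r => r == 0) E; rewrite !mulf_eq0.
have [xz|xn] := eqVneq x 0.
  by have [zz|zn] := eqVneq z 0; have [wz|wn] := eqVneq w 0; case: eqVneq.
have [yz|yn] := eqVneq y 0.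
  by have [zz|zn] := eqVneq z 0; have [wz|wn] := eqVneq w 0.
have [zz|zn] := eqVneq z 0; have [wz|wn] := eqVneq w 0 => // _.
have pos (r : R) : 0 <= r -> r != 0 -> r \is Num.pos.
  by move=> r0 rn; rewrite posrE lt_neqAle eq_sym rn.
rewrite -!EFinD; congr EFin.
have := congr1 (@ln R) E; rewrite !lnM ?pos // => H.
by rewrite -!opprD -!mulrDl H.
Qed.

End Logarithm.

Section Equivalence.
Variables (R : realType) (t : R).
Hypothesis ht : 1 < t.
Variables (G : geometry).
Hypothesis hG : projective_plane G.
Variables (d : points G -> points G -> R) (ang : lines G -> lines G -> R).
Hypothesis hd : distance_function d.
Hypothesis hang : angle_function ang.
Notation P := (points G).
Notation L := (lines G).
Implicit Types (p q r : P) (K M N : L).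

Lemma sin_eq0_pihalf (x : R) : 0 <= x <= pi / 2 -> sin x = 0 <-> x = 0.
Proof.
move=> /andP[x0 x1]; split=> [|->]; last by rewrite sin0.
have [//|xn] := eqVneq x 0 => s0; exfalso.
have pi0 := pi_gt0 R.
have : 0 < sin x.
  apply: sin_gt0_pi; rewrite lt_neqAle eq_sym xn x0 /=.
  by apply: le_lt_trans x1 _; rewrite ltr_pdivrMr // ltr_pMr // ltr1n.
by rewrite s0 ltxx.
Qed.

Lemma sin_ang_itv K M : 0 <= sin (ang K M) <= 1.
Proof.
have [_ /andP[h0 h1]] := hang K M; rewrite sin_le1 andbT sin_ge0_pi // h0 /=.
by apply: le_trans h1 _; rewrite ler_pdivrMr // ler_peMr ?pi_ge0 // ler1n.
Qed.

Lemma metric_sine_geometry : metric_plane d ang ->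
  sine_geometry d (fun K M => sin (ang K M)).
Proof.
move=> [um a0 _ _ sr].
have s0 K M : sin (ang K M) = 0 <-> K = M.
  have [_ h] := hang K M.
  by rewrite -a0; exact: sin_eq0_pihalf.
split.
- exact: um_sym um.
- exact: um_ge0 um.
- exact: um_eq0 um.
- by move=> K M; have [-> _] := hang K M.
- by move=> K M; have /andP[] := sin_ang_itv K M.
- exact: s0.
apply: (sine_degenerate hG (um_eq0 um) s0).
move=> p q q' K M M' pK qq' pM qM qK pM' qM' qK'.
have [|_ h] := sr p q q' K M' M.
  split=> //.
  by move=> [N [pN qN qN']]; apply: pK; rewrite (line_eq hG qq' qK qK' qN qN').
have MK : sin (ang M K) != 0 by apply/eqP => /s0 E; apply: pK; rewrite -E.
have M'K : sin (ang M' K) != 0 by apply/eqP => /s0 E; apply: pK; rewrite -E.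
have [KM' _] := hang K M'; rewrite KM' in h.
rewrite (um_sym um p q'); apply/eqP.
by move/eqP: h; rewrite eqr_div // eq_sym.
Qed.

Lemma max_or (x y z : R) : x <= Num.max y z -> x <= y \/ x <= z.
Proof. by rewrite le_max => /orP. Qed.

Lemma metric_gauged : metric_plane d ang ->
  exists D : gauged_plane R, gp_geom D = G.
Proof.
move=> hm; have hs := metric_sine_geometry hm; have [um _ _ _ _] := hm.
have mx p q r := max_or (um_max um p q r).
by exists (GaugedPlane hG (sg_dsym hs) (sg_dge0 hs) (sg_deq0 hs) mx
  (height_ge0 hG hs) (height_eq0 hG hs) (height_sine hs)).
Qed.

Lemma metric_valuation : metric_plane d ang ->
  exists uP uL, [/\ valuation uP uL, forall p q, d p q = expN t (uP p q) &
    forall K M, ang K M = asin (expN t (uL K M))].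
Proof.
move=> hm; have hs := metric_sine_geometry hm; have [um a0 m3 m4 _] := hm.
have dI p q : 0 <= d p q <= 1 by have [_] := hd p q.
have sI := sin_ang_itv.
have d0 p q : 0 <= d p q by have /andP[] := dI p q.
have s0 K M : 0 <= sin (ang K M) by have /andP[] := sI K M.
have mx p q r := max_or (um_max um p q r).
exists (fun p q => logv t (d p q)), (fun K M => logv t (sin (ang K M))); split.
- exists 1, 1, 1, 1; split; first by split.
  split.
  + by move=> p q; rewrite (um_sym um).
  + by move=> K M; have [-> _] := hang K M.
  + by move=> p q; exact: logv_ge0.
  + by move=> K M; exact: logv_ge0.
  + by move=> K; have [p [q [pK qK E]]] := m3 K; exists p, q; rewrite E logv1.
  + move=> p; have [K [M [pK pM E]]] := m4 p; exists K, M.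
    by rewrite E sin_pihalf logv1.
  + by move=> p q; rewrite logv_oo; exact: um_eq0 um p q.
  + by move=> K M; rewrite logv_oo; exact: sg_seq0 hs K M.
  + move=> K p q r _ _ _ /(logv_lt ht (dI _ _) (dI _ _)) h.
    congr (logv t _); apply/eqP; rewrite eq_le; apply/andP; split.
      by have [//|h'] := mx p r q; apply: le_trans h' (ltW h).
    by have [//|h'] := mx p q r; move: h; rewrite (um_sym um q) ltNge h'.
  + move=> p K M N pK pM pN /(logv_lt ht (sI _ _) (sI _ _)) h.
    congr (logv t _); apply/eqP; rewrite eq_le; apply/andP; split.
      have [//|h'] := sine_max hG hs mx pK pM pN.
      exact: le_trans h' (ltW h).
    have [//|h'] := sine_max hG hs mx pK pN pM.
    by move: h; rewrite (sg_ssym hs M) ltNge h'.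
  + move=> x1 x3 x5 x2 x4 x6 i12 i32 i34 i54 i56 i16.
    apply: logvM => //; rewrite (sg_dsym hs x1) mulrC (sg_ssym hs x6).
    exact: sg_sine hs _ _ _ _ _ _ i32 i12 i16 i34 i54 i56.
  + move=> x1 x3 x5 x2 x4 x6 i12 i32 i34 i54 i56 i16.
    apply: logvM => //; rewrite [RHS]mulrC (sg_dsym hs x4) (sg_ssym hs x3).
    exact: sg_sine hs _ _ _ _ _ _ i16 i12 i32 i56 i54 i34.
- by move=> p q; rewrite logvK.
move=> K M; rewrite logvK // sinK //; have [_ /andP[h0 h1]] := hang K M.
by rewrite in_itv /= h1 andbT (le_trans _ h0) // oppr_le0 divr_ge0 ?pi_ge0.
Qed.

(** For a triangle, let [x] be the difference of two angles and [y] that of the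
    opposite sides. Subtracting (U4) for the reversed hexagon gives [(a1 + a5) *
    x = (a2 + a4) * y], and the dual identities give [(a1 + a5) * y = (a2 + a4)
    * x]; as the weights are positive, [x = y], which is the sine rule. *)
Lemma valuation_metric uP uL : valuation uP uL ->
  (forall p q, d p q = expN t (uP p q)) ->
  (forall K M, ang K M = asin (expN t (uL K M))) -> metric_plane d ang.
Proof.
move=> [a1 [a2 [a4 [a5 [[a10 a20 a40 a50] hv]]]]] dE aE.
have P0 := valP_ge0 hv; have L0 := valL_ge0 hv.
pose s K M := expN t (uL K M).
have sI K M : 0 <= s K M <= 1 := expN_itv ht (L0 K M).
have dI p q : 0 <= d p q <= 1 by rewrite dE; exact: expN_itv.
have d0 p q : 0 <= d p q by have /andP[] := dI p q.
have sge0 K M : 0 <= s K M by have /andP[] := sI K M.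
have d1 p q : d p q <= 1 by have /andP[] := dI p q.
have s1 K M : s K M <= 1 by have /andP[] := sI K M.
have sE K M : sin (ang K M) = s K M.
  rewrite aE asinK // in_itv /= s1 andbT.
  by apply: le_trans (sge0 K M); exact: lerN10.
have deq0 p q : d p q = 0 <-> p = q.
  by rewrite dE -(valP_U2 hv); exact: expN_eq0.
have seq0 K M : s K M = 0 <-> K = M.
  by rewrite -(valL_U2 hv); exact: expN_eq0.
have ssym K M : s K M = s M K by rewrite /s (valL_sym hv).
have dsym p q : d p q = d q p by rewrite !dE (valP_sym hv).
have finP p q : p <> q -> exists x : R, uP p q = x%:E.
  have := P0 p q; case E: (uP p q) => [x||] // _ pq; first by exists x.
  by case: pq; apply/(valP_U2 hv).
have finL K M : K <> M -> exists x : R, uL K M = x%:E.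
  have := L0 K M; case E: (uL K M) => [x||] // _ pq; first by exists x.
  by case: pq; apply/(valL_U2 hv).
have hs : sine_geometry d s.
  split=> //; apply: (sine_degenerate hG deq0 seq0).
  move=> p q q' K M M' pK qq' pM qM qK pM' qM' qK'.
  have pq : p <> q by move=> E; apply: pK; rewrite E.
  have pq' : p <> q' by move=> E; apply: pK; rewrite E.
  have MK : M <> K by move=> E; apply: pK; rewrite -E.
  have M'K : M' <> K by move=> E; apply: pK; rewrite -E.
  have [B EB] := finP _ _ pq; have [A EA] := finP _ _ pq'.
  have [x Ex] := finL _ _ MK; have [y Ey] := finL _ _ M'K.
  have h1 := valP_U4 hv qM pM pM' qM' qK' qK.
  have h2 := valP_U4 hv qM' pM' pM qM qK qK'.
  have h3 := valL_U4 hv qM' qK' qK qM pM pM'.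
  have h4 := valL_U4 hv qM qK qK' qM' pM' pM.
  rewrite (valL_sym hv K) (valP_sym hv q) Ex EB EA Ey in h1.
  rewrite (valL_sym hv K) (valP_sym hv q') Ey EA EB Ex in h2.
  rewrite (valL_sym hv K) (valP_sym hv q) EA Ey Ex EB in h3.
  rewrite (valL_sym hv K) (valP_sym hv q') EB Ex Ey EA in h4.
  case: h1 => h1; case: h2 => h2; case: h3 => h3; case: h4 => h4.
  have E : B + x = A + y.
    have H : (a1 + a5 + (a2 + a4)) * ((x - y) - (A - B)) = 0.
      transitivity ((a1 * x + a2 * B - (a1 * y + a2 * A)) -
        (a4 * A + a5 * y - (a4 * B + a5 * x)) -
        ((a1 * A + a2 * y - (a1 * B + a2 * x)) -
         (a4 * x + a5 * B - (a4 * y + a5 * A)))); first by ring.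
      by rewrite h1 h2 h3 h4; ring.
    move/eqP: H; rewrite mulf_eq0 => /orP[/eqP H|/eqP H]; lra.
  rewrite !dE /s EB Ex EA Ey !expNE // -!expRD -!opprD -!mulrDl.
  by rewrite E.
have d_line p q r K : inc p K -> inc q K -> inc r K ->
  d p q <= d p r \/ d p q <= d r q.
  move=> pK qK rK; rewrite !dE.
  have [h|h] := leP (uP q r) (uP p q).
    by right; rewrite (valP_sym hv r); apply: le_expN.
  by left; rewrite (valP_U3 hv pK qK rK h).
have s_point p K M N : inc p K -> inc p M -> inc p N ->
  s K N <= s K M \/ s K N <= s M N.
  move=> pK pM pN; rewrite /s.
  have [h|h] := leP (uL N M) (uL K N).
    by right; rewrite (valL_sym hv M); apply: le_expN.
  by left; rewrite (valL_U3 hv pK pN pM h).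
have d_one K : exists p q, [/\ inc p K, inc q K & d p q = 1].
  by have [p [q [pK qK E]]] := val_U1_line hv K; exists p, q;
    rewrite dE E expN0.
have s_one p : exists K M, [/\ inc p K, inc p M & s K M = 1].
  by have [K [M [pK pM E]]] := val_U1_point hv p; exists K, M;
    rewrite /s E expN0.
have mx := dist_ultrametric hG hs d1 s1 d_line s_point d_one s_one.
split=> //.
- split=> // p q r.
    have [h|h] := mx p q r; apply: (le_trans h); first by rewrite lerDl.
    by rewrite lerDr.
  by rewrite le_max; apply/orP; exact: mx.
- move=> K M; have [_ h] := hang K M.
  by rewrite -(sin_eq0_pihalf h) sE; exact: seq0.
- move=> p; have [K [M [pK pM E]]] := s_one p; exists K, M; split=> //.
  rewrite aE -/(s K M) E; have := @sinK R (pi / 2); rewrite sin_pihalf; apply.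
  have pi0 : 0 <= pi / 2 :> R by rewrite divr_ge0 ?pi_ge0.
  by rewrite in_itv /= lexx andbT; apply: (le_trans _ pi0); rewrite oppr_le0.
move=> p q r a b c [nc [qa ra] [rb pb] [pc qc]].
have bc : b <> c by move=> E; apply: nc; exists b; split=> //; rewrite E.
have ca : c <> a by move=> E; apply: nc; exists c; split=> //; rewrite E.
have ab : a <> b by move=> E; apply: nc; exists a; split=> //; rewrite E.
have ne K M : K <> M -> s K M != 0 by move=> KM; apply/eqP => /seq0.
rewrite !sE; split; apply/eqP; rewrite eqr_div ?ne //; apply/eqP.
  rewrite (dsym q) (ssym c).
  exact: sg_sine hs _ _ _ _ _ _ ra qa qc rb pb pc.
rewrite (dsym r) (ssym a).
exact: sg_sine hs _ _ _ _ _ _ pb rb ra pc qc qa.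
Qed.

End Equivalence.

Unset Implicit Arguments.

Theorem theorem2p3 (R : realType) (t : R) (ht : 1 < t) (G : geometry)
    (hG : projective_plane G)
    (d : points G -> points G -> R) (hd : distance_function d)
    (ang : lines G -> lines G -> R) (hang : angle_function ang) :
  ((exists (uP : points G -> points G -> \bar R)
           (uL : lines G -> lines G -> \bar R),
      [/\ valuation uP uL,
          forall p q, d p q = expN t (uP p q) &
          forall L M, ang L M = asin (expN t (uL L M))])
   <-> metric_plane d ang)
  /\
  (metric_plane d ang ->
     exists (m : nat) (X : Type) (F : set ('cV[R]_2 -> X)),
       R_building m F /\ geometry_iso G (building_at_infinity m F)).
Proof.
split.
  split=> [[uP [uL [hv dE aE]]]|]; first exact: valuation_metric hv dE aE.
  exact: metric_valuation.
move=> /(metric_gauged hG hang)[D <-].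
exists 3%N, (bpoint D), (@charts R D); split; first exact: building.
exact: infinity_iso.
Qed.
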